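(* Let $\mathcal{P}$ be a three-dimensional convex polytope resting with one of its faces on the plane $\mathbb{R}^2$ in a fixed initial position, and let $T_{\mathcal{P}}\subseteq\mathbb{R}^2$ be its trace. If $$\inf\{|p-q| : p,q\in T_{\mathcal{P}},\ p\neq q\}=0,$$ then $T_{\mathcal{P}}$ is dense in the plane $\mathbb{R}^2$.
   Context: Identify the plane $\mathbb{R}^2$ with $\mathbb{R}^2\times\{0\}\subset\mathbb{R}^3$. A three-dimensional convex polytope $\mathcal{P}$ (with labeled vertices, edges and two-dimensional faces) is placed in the closed upper half-space with one face, the supporting face, contained in the plane. A roll over an edge $e$ of the current supporting face $F$ is the rotation of $\mathcal{P}$ about the line containing $e$ until the other face $F'$ of $\mathcal{P}$ containing $e$ lies in the plane (with $\mathcal{P}$ again in the closed upper half-space); $F'$ becomes the new supporting face. The trace $T_{\mathcal{P}}$ is the set of all points of the plane that coincide with a vertex of $\mathcal{P}$ after performing some finite sequence of rolls starting from the fixed initial position. *)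

(* Defs.v *)
From HB Require Import structures.
From mathcomp Require Import all_boot all_order all_algebra.
From mathcomp Require Import all_classical all_reals all_analysis.
Set Implicit Arguments.
Unset Strict Implicit.
Unset Printing Implicit Defensive.
Import Order.TTheory GRing.Theory Num.Theory.
Import numFieldNormedType.Exports.
Local Open Scope classical_set_scope.
Local Open Scope ring_scope.

Definition dotr (R : realType) (n : nat) (u v : 'rV[R]_n) : R :=
  \sum_(i < n) u 0 i * v 0 i.

(* The library norm on row vectors is the sup norm, hence this definition. *)
Definition enorm (R : realType) (n : nat) (u : 'rV[R]_n) : R :=
  Num.sqrt (dotr u u).

Definition aff_hull (R : realType) (n : nat) (S : set 'rV[R]_n) :
    set 'rV[R]_n :=
  [set x | exists (m : nat) (v : 'I_m -> 'rV[R]_n) (w : 'I_m -> R),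
    [/\ forall i, S (v i), \sum_(i < m) w i = 1 &
        x = \sum_(i < m) w i *: v i]].

Definition conv_hull (R : realType) (n : nat) (S : set 'rV[R]_n) :
    set 'rV[R]_n :=
  [set x | exists (m : nat) (v : 'I_m -> 'rV[R]_n) (w : 'I_m -> R),
    [/\ forall i, S (v i), forall i, 0 <= w i, \sum_(i < m) w i = 1 &
        x = \sum_(i < m) w i *: v i]].

Definition polytope (R : realType) (n : nat) (P : set 'rV[R]_n) : Prop :=
  exists2 V : set 'rV[R]_n, finite_set V & P = conv_hull V.

Definition has_dim (R : realType) (n : nat) (S : set 'rV[R]_n) (k : nat) :
    Prop :=
  exists (a : 'rV[R]_n) (B : 'M[R]_(k, n)),
    row_free B /\ aff_hull S = [set a + u *m B | u in [set: 'rV[R]_k]].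

(* [c = 0] is allowed: it only adds the improper faces [P] and [set0]. *)
Definition face (R : realType) (n : nat) (P F : set 'rV[R]_n) : Prop :=
  exists (c : 'rV[R]_n) (b : R),
    (forall x, P x -> dotr c x <= b) /\ F = P `&` [set x | dotr c x = b].

Definition kface (R : realType) (n : nat) (k : nat) (P F : set 'rV[R]_n) :
    Prop := face P F /\ has_dim F k.

Definition vertex (R : realType) (n : nat) (P : set 'rV[R]_n) (v : 'rV[R]_n) :
    Prop := kface 0 P [set v].

Definition edge (R : realType) (n : nat) (P e : set 'rV[R]_n) : Prop :=
  kface 1 P e.

Definition face2 (R : realType) (n : nat) (P F : set 'rV[R]_n) : Prop :=
  kface 2 P F.

Definition embed (R : realType) (p : 'rV[R]_2) : 'rV[R]_3 :=
  row_mx p (0 : 'rV[R]_1).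

Definition ground (R : realType) : set 'rV[R]_3 := range (@embed R).

Definition upper_half (R : realType) : set 'rV[R]_3 :=
  [set x | 0 <= x 0 ord_max].

Definition rotation_about (R : realType) (L : set 'rV[R]_3)
    (rho : 'rV[R]_3 -> 'rV[R]_3) : Prop :=
  exists (a : 'rV[R]_3) (M : 'M[R]_3),
    [/\ L a, M *m M^T = 1%:M, \det M = 1,
        forall x, rho x = a + (x - a) *m M &
        forall x, L x -> rho x = x].

(* [reachable P g F]: some finite sequence of rolls takes [P] from its initial
   position to the position [g @` P], with supporting face [g @` F].  Keeping
   the motion [g] rather than the set [g @` P] preserves the labels: faces,
   edges and vertices are always those of the initial [P]. *)
Inductive reachable (R : realType) (P : set 'rV[R]_3) :
    ('rV[R]_3 -> 'rV[R]_3) -> set 'rV[R]_3 -> Prop :=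
| reach_start (F : set 'rV[R]_3) :
    face2 P F -> F `<=` @ground R -> reachable P id F
| reach_roll (g : 'rV[R]_3 -> 'rV[R]_3) (F e F' : set 'rV[R]_3)
    (rho : 'rV[R]_3 -> 'rV[R]_3) :
    reachable P g F ->
    edge P e -> e `<=` F ->
    face2 P F' -> F' <> F -> e `<=` F' ->
    rotation_about (aff_hull (g @` e)) rho ->
    (rho \o g) @` F' `<=` @ground R ->
    (rho \o g) @` P `<=` @upper_half R ->
    reachable P (rho \o g) F'.

Definition trace (R : realType) (P : set 'rV[R]_3) : set 'rV[R]_2 :=
  [set p | exists (g : 'rV[R]_3 -> 'rV[R]_3) (F : set 'rV[R]_3)
             (v : 'rV[R]_3),
    [/\ reachable P g F, vertex P v & g v = embed p]].

(* Main.v *)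
Require Import Defs.
From HB Require Import structures.
From mathcomp Require Import all_boot all_order all_algebra.
From mathcomp Require Import all_classical all_reals all_analysis.
From mathcomp Require Import ring lra zify.
Set Implicit Arguments.
Unset Strict Implicit.
Unset Printing Implicit Defensive.
Import Order.TTheory GRing.Theory Num.Theory.
Import numFieldNormedType.Exports.
Local Open Scope classical_set_scope.
Local Open Scope ring_scope.

(** Let H be the group of planar motions that map reachable positions to reachable
    positions; it preserves the trace.  Rolling around a vertex v shows that H contains
    the rotation about each trace point by the total face angle t of the corresponding
    vertex, and 0 < t < 2 pi by convexity.  The commutator of the rotations about two
    distinct trace points p and q is a nonzero translation of length at most 4 |p - q|,
    so H contains arbitrarily short translations.  If some total angle differs from pi,
    conjugating with that rotation gives short translations in two independent
    directions, and the trace is dense.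
    If all total angles are pi, the three angles between any three directions in the cone
    at a vertex sum to at most pi.  A tetrahedron of vertices has four corners and total
    angle 4 pi, so equality holds everywhere and opposite edges are equal.  Then rolling a
    facet abc over bc sends the next vertex d to the point b + c - a of the plane, the
    trace lies in a lattice, and the infimum of the distances is positive. *)

(** * Vectors in three-space *)

(** The definitions say nothing about the cyclic order of the facets at a vertex, so it has to be
    built: the polytope is seen from [v] in the affine plane [dotr n = 1], gift wrapping yields the
    sides of the resulting polygon, each side gives a facet, and each corner an edge to roll over.
    Angle sums are awkward to carry over from edge directions to arbitrary directions at [v]. The
    condition that three angles sum to at most pi is therefore replaced by [0 <= phi] together with
    nonnegative dot products. For edge directions this follows from the angle sum; being quadratic
    in each vector, it then passes to the whole cone. The same form turns the comparison of the four
    corners of a tetrahedron into inequalities between polynomials in dot products. The total angle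
    pi is exceptional because a half-turn sends every translation to its opposite, so conjugation
    gives no second direction. The factor 4 bounds the product of the two chord factors
    [2 |sin (t / 2)|], each at most 2. *)

Definition vec3 {R : realType} (x y z : R) : 'rV[R]_3 :=
  \row_i (if i == 0 then x else if i == 1 then y else z).

Definition cross {R : realType} (u v : 'rV[R]_3) : 'rV[R]_3 :=
  vec3 (u 0 1 * v 0 2%:R - u 0 2%:R * v 0 1)
       (u 0 2%:R * v 0 0 - u 0 0 * v 0 2%:R)
       (u 0 0 * v 0 1 - u 0 1 * v 0 0).

Definition det3 {R : realType} (u v w : 'rV[R]_3) : R :=
  u 0 0 * (v 0 1 * w 0 2%:R - v 0 2%:R * w 0 1)
  + u 0 1 * (v 0 2%:R * w 0 0 - v 0 0 * w 0 2%:R)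
  + u 0 2%:R * (v 0 0 * w 0 1 - v 0 1 * w 0 0).

Definition rows3 {R : realType} (u v w : 'rV[R]_3) : 'M[R]_3 :=
  \matrix_(i, j) (if i == 0 then u 0 j else if i == 1 then v 0 j else w 0 j).

Lemma ord3_case (i : 'I_3) : [\/ i = 0, i = 1 | i = 2%:R].
Proof.
by case: i => [[|[|[|//]]]] Hi; [constructor 1|constructor 2|constructor 3];
  apply/val_inj.
Qed.

Lemma ord3_max : ord_max = 2%:R :> 'I_3.
Proof. exact/val_inj. Qed.

Lemma sum_ord3 {V : nmodType} (F : 'I_3 -> V) :
  \sum_i F i = F 0 + F 1 + F 2%:R.
Proof.
rewrite !big_ord_recl big_ord0 addr0 addrA.
by congr (_ + F _ + F _); apply/val_inj.
Qed.

Lemma row3P {R : realType} (u v : 'rV[R]_3) :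
  u 0 0 = v 0 0 -> u 0 1 = v 0 1 -> u 0 2%:R = v 0 2%:R -> u = v.
Proof. by move=> h0 h1 h2; apply/rowP => i; have [->|->|->] := ord3_case i. Qed.

Lemma vec3E0 {R : realType} (x y z : R) : vec3 x y z 0 0 = x.
Proof. by rewrite mxE. Qed.
Lemma vec3E1 {R : realType} (x y z : R) : vec3 x y z 0 1 = y.
Proof. by rewrite mxE. Qed.
Lemma vec3E2 {R : realType} (x y z : R) : vec3 x y z 0 2%:R = z.
Proof. by rewrite mxE. Qed.
Definition vec3E := (@vec3E0, @vec3E1, @vec3E2).

Lemma dotr3 {R : realType} (u v : 'rV[R]_3) :
  dotr u v = u 0 0 * v 0 0 + u 0 1 * v 0 1 + u 0 2%:R * v 0 2%:R.
Proof. by rewrite /dotr sum_ord3. Qed.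

Lemma addE {R : realType} (u v : 'rV[R]_3) i : (u + v) 0 i = u 0 i + v 0 i.
Proof. by rewrite mxE. Qed.
Lemma oppE {R : realType} (u : 'rV[R]_3) i : (- u) 0 i = - u 0 i.
Proof. by rewrite mxE. Qed.
Lemma scaleE {R : realType} k (u : 'rV[R]_3) i : (k *: u) 0 i = k * u 0 i.
Proof. by rewrite mxE. Qed.
Lemma zeroE {R : realType} i : (0 : 'rV[R]_3) 0 i = 0.
Proof. by rewrite mxE. Qed.
Definition coordE := (@addE, @oppE, @scaleE, @zeroE).

Ltac vring := rewrite ?dotr3 /det3 /cross ?(coordE, vec3E); ring.
Ltac vecring := apply: row3P; rewrite ?dotr3 /det3 /cross ?(coordE, vec3E); ring.

Lemma dotrC {R : realType} n (u v : 'rV[R]_n) : dotr u v = dotr v u.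
Proof. by apply: eq_bigr => i _; rewrite mulrC. Qed.
Lemma dotrDl {R : realType} n (u v w : 'rV[R]_n) :
  dotr (u + v) w = dotr u w + dotr v w.
Proof. by rewrite -big_split; apply: eq_bigr => i _; rewrite mxE mulrDl. Qed.
Lemma dotrZl {R : realType} n k (u w : 'rV[R]_n) : dotr (k *: u) w = k * dotr u w.
Proof. by rewrite mulr_sumr; apply: eq_bigr => i _; rewrite mxE mulrA. Qed.
Lemma dotrDr {R : realType} n (u v w : 'rV[R]_n) :
  dotr w (u + v) = dotr w u + dotr w v.
Proof. by rewrite ![dotr w _]dotrC dotrDl. Qed.
Lemma dotrZr {R : realType} n k (u w : 'rV[R]_n) : dotr w (k *: u) = k * dotr w u.
Proof. by rewrite ![dotr w _]dotrC dotrZl. Qed.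
Lemma dotrNr {R : realType} n (u w : 'rV[R]_n) : dotr w (- u) = - dotr w u.
Proof. by rewrite -scaleN1r dotrZr mulN1r. Qed.
Lemma dotrNl {R : realType} n (u w : 'rV[R]_n) : dotr (- u) w = - dotr u w.
Proof. by rewrite dotrC dotrNr dotrC. Qed.
Lemma dotrBr {R : realType} n (u v w : 'rV[R]_n) :
  dotr w (u - v) = dotr w u - dotr w v.
Proof. by rewrite dotrDr dotrNr. Qed.
Lemma dotrBl {R : realType} n (u v w : 'rV[R]_n) :
  dotr (u - v) w = dotr u w - dotr v w.
Proof. by rewrite dotrDl dotrNl. Qed.
Lemma dotr0 {R : realType} n (w : 'rV[R]_n) : dotr w 0 = 0.
Proof. by rewrite -(scale0r 0) dotrZr mul0r. Qed.
Lemma dotr_sumr {R : realType} n m (w : 'rV[R]_n) (F : 'I_m -> 'rV[R]_n) :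
  dotr w (\sum_i F i) = \sum_i dotr w (F i).
Proof.
by apply: (big_ind2 (fun x y => dotr w x = y)) => [|x1 x2 y1 y2 <- <-|//];
  rewrite ?dotr0 ?dotrDr.
Qed.

Lemma dotr_ge0 {R : realType} n (u : 'rV[R]_n) : 0 <= dotr u u.
Proof. by apply: sumr_ge0 => i _; rewrite -expr2 sqr_ge0. Qed.

Lemma dotr_eq0 {R : realType} n (u : 'rV[R]_n) : (dotr u u == 0) = (u == 0).
Proof.
apply/eqP/eqP => [/eqP|->]; last by rewrite dotr0.
rewrite psumr_eq0 => [/allP h|i _]; last by rewrite -expr2 sqr_ge0.
apply/rowP => i; rewrite mxE; have := h i (mem_index_enum _).
by rewrite /= -expr2 sqrf_eq0 => /eqP.
Qed.

Lemma dotr_gt0 {R : realType} n (u : 'rV[R]_n) : (0 < dotr u u) = (u != 0).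
Proof. by rewrite lt0r dotr_eq0 dotr_ge0 andbT. Qed.

Lemma dotr_cross {R : realType} (u v w : 'rV[R]_3) : dotr (cross u v) w = det3 u v w.
Proof. vring. Qed.

Lemma det3_rot {R : realType} (u v w : 'rV[R]_3) : det3 u v w = det3 v w u.
Proof. vring. Qed.
Lemma det3_swap {R : realType} (u v w : 'rV[R]_3) : det3 u v w = - det3 v u w.
Proof. vring. Qed.
Lemma det3_lrl {R : realType} (u v : 'rV[R]_3) : det3 u v u = 0.
Proof. vring. Qed.
Lemma det3_lrr {R : realType} (u v : 'rV[R]_3) : det3 u v v = 0.
Proof. vring. Qed.
Lemma det3Dr {R : realType} (u v w w' : 'rV[R]_3) :
  det3 u v (w + w') = det3 u v w + det3 u v w'.
Proof. vring. Qed.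
Lemma det3Zr {R : realType} k (u v w : 'rV[R]_3) :
  det3 u v (k *: w) = k * det3 u v w.
Proof. vring. Qed.

Lemma lagrange {R : realType} (u v : 'rV[R]_3) :
  dotr (cross u v) (cross u v) = dotr u u * dotr v v - dotr u v ^+ 2.
Proof. vring. Qed.

Lemma gram3 {R : realType} (a b c : 'rV[R]_3) :
  det3 a b c ^+ 2 = dotr a a * dotr b b * dotr c c
    + 2%:R * dotr a b * dotr b c * dotr c a
    - dotr a a * dotr b c ^+ 2 - dotr b b * dotr c a ^+ 2
    - dotr c c * dotr a b ^+ 2.
Proof. vring. Qed.

Lemma cramer3 {R : realType} (a b c w : 'rV[R]_3) :
  det3 a b c *: w = det3 w b c *: a + det3 a w c *: b + det3 a b w *: c.
Proof. vecring. Qed.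

Lemma rows3_mul {R : realType} (u v w : 'rV[R]_3) (M : 'M[R]_3) :
  rows3 u v w *m M = rows3 (u *m M) (v *m M) (w *m M).
Proof.
apply/matrixP => i j; rewrite !mxE; have [->|->|->] := ord3_case i => /=;
by apply: eq_bigr => k _; rewrite mxE.
Qed.

Lemma det2E {R : realType} (A : 'M[R]_2) : \det A = A 0 0 * A 1 1 - A 0 1 * A 1 0.
Proof.
rewrite (expand_det_row _ 0) !big_ord_recl big_ord0 /cofactor !det_mx11 !mxE /=.
have e0 : lift 0 0 = 1 :> 'I_2 by exact/val_inj.
have e1 : lift 1 0 = 0 :> 'I_2 by exact/val_inj.
by rewrite !e0 !e1 /bump /=; ring.
Qed.

Lemma det_rows3 {R : realType} (u v w : 'rV[R]_3) : \det (rows3 u v w) = det3 u v w.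
Proof.
rewrite (expand_det_row _ 0) sum_ord3 /cofactor !det2E /det3 !mxE /=.
have e0 : lift 0 0 = 1 :> 'I_3 by exact/val_inj.
have e1 : lift 0 1 = 2%:R :> 'I_3 by exact/val_inj.
have e2 : lift 1 0 = 0 :> 'I_3 by exact/val_inj.
have e3 : lift 1 1 = 2%:R :> 'I_3 by exact/val_inj.
have e4 : lift 2%:R 0 = 0 :> 'I_3 by exact/val_inj.
have e5 : lift 2%:R 1 = 1 :> 'I_3 by exact/val_inj.
rewrite !(e0, e1, e2, e3, e4, e5) /=.
rewrite -[(0 + 1 %% 3)%N]/1%N -[(0 + (1 %% 3 + 1 %% 3) %% 3)%N]/2%N; ring.
Qed.

Lemma det3_mulmx {R : realType} (u v w : 'rV[R]_3) (M : 'M[R]_3) :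
  det3 (u *m M) (v *m M) (w *m M) = det3 u v w * \det M.
Proof. by rewrite -!det_rows3 -rows3_mul det_mulmx. Qed.

Lemma mul_rows3_tr {R : realType} (x u v w : 'rV[R]_3) :
  x *m (rows3 u v w)^T = vec3 (dotr x u) (dotr x v) (dotr x w).
Proof.
by apply: row3P; rewrite vec3E dotr3 !mxE sum_ord3 !mxE.
Qed.

Lemma mul_rows3 {R : realType} (x u v w : 'rV[R]_3) :
  x *m rows3 u v w = x 0 0 *: u + x 0 1 *: v + x 0 2%:R *: w.
Proof. by apply: row3P; rewrite !mxE sum_ord3 !mxE. Qed.

Lemma dotrE {R : realType} n (u v : 'rV[R]_n) : dotr u v = (u *m v^T) 0 0.
Proof. by rewrite mxE; apply: eq_bigr => i _; rewrite mxE. Qed.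

Lemma dotr_adj {R : realType} n (u v : 'rV[R]_n) (M : 'M[R]_n) :
  dotr (u *m M) v = dotr u (v *m M^T).
Proof. by rewrite !dotrE trmx_mul trmxK mulmxA. Qed.

Lemma dotr_orth {R : realType} n (u v : 'rV[R]_n) (M : 'M[R]_n) :
  M *m M^T = 1%:M -> dotr (u *m M) (v *m M) = dotr u v.
Proof. by move=> h; rewrite dotr_adj -mulmxA h mulmx1. Qed.

Lemma dotr_ext {R : realType} n (u v : 'rV[R]_n) :
  (forall w, dotr u w = dotr v w) -> u = v.
Proof.
move=> h; apply/eqP; rewrite -subr_eq0 -dotr_eq0 dotrBl h subrr //.
Qed.

(** Both sides are tested against [w], written as [w *m M^T *m M]; triple products are invariant
    because [\det M = 1]. *)
Lemma cross_mulmx {R : realType} (u v : 'rV[R]_3) (M : 'M[R]_3) :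
  M *m M^T = 1%:M -> \det M = 1 -> cross (u *m M) (v *m M) = cross u v *m M.
Proof.
move=> h d; apply: dotr_ext => w.
have hT := mulmx1C h.
have -> : w = w *m M^T *m M by rewrite -mulmxA hT mulmx1.
by rewrite dotr_orth // !dotr_cross det3_mulmx d mulr1.
Qed.

(** * Angles *)

Lemma ler_cos_itv {R : realType} (x y : R) : 0 <= x -> x <= pi -> 0 <= y -> y <= pi ->
  (cos x <= cos y) = (y <= x).
Proof.
by move=> x0 x1 y0 y1; rewrite leNgt ltr_cos ?in_itv /= ?x0 ?y0 // -leNgt.
Qed.

Lemma ltr_cos_itv {R : realType} (x y : R) : 0 <= x -> x <= pi -> 0 <= y -> y <= pi ->
  (cos x < cos y) = (y < x).
Proof. by move=> x0 x1 y0 y1; rewrite ltr_cos ?in_itv /= ?x0 ?y0. Qed.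

Lemma le_of_sqr {R : realType} (x s : R) : 0 <= s -> x ^+ 2 <= s ^+ 2 -> x <= s.
Proof.
move=> s0 h; apply: le_trans (ler_norm _) _.
by rewrite -(ler_pXn2r (n := 2)) ?nnegrE // real_normK ?num_real.
Qed.

Lemma lt_of_sqr {R : realType} (x s : R) : 0 <= s -> x ^+ 2 < s ^+ 2 -> x < s.
Proof.
move=> s0 h; apply: le_lt_trans (ler_norm _) _.
by rewrite -(ltr_pXn2r (n := 2)) ?nnegrE // real_normK ?num_real.
Qed.

(** The Gram determinant of three unit vectors with pairwise angles [a], [b], [c]. It vanishes
    exactly when [cos c] is [cos (a + b)] or [cos (a - b)]. *)
Definition gramc {R : realType} (a b c : R) : R :=
  1 + 2 * cos a * cos b * cos c - cos a ^+ 2 - cos b ^+ 2 - cos c ^+ 2.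

Lemma gramcE {R : realType} (a b c : R) :
  (sin a * sin b) ^+ 2 - (cos c - cos a * cos b) ^+ 2 = gramc a b c.
Proof. by rewrite exprMn !sin2cos2 /gramc; ring. Qed.

(** By [gramcE] the hypothesis bounds [|cos c - cos a * cos b|] by [sin a * sin b], so
    [cos (a + b) <= cos c]; if [a + b] exceeds pi, there is nothing to prove. *)
Lemma gramc_le {R : realType} (a b c : R) :
  0 <= a <= pi -> 0 <= b <= pi -> 0 <= c <= pi -> 0 <= gramc a b c -> c <= a + b.
Proof.
move=> /andP[a0 a1] /andP[b0 b1] /andP[c0 c1] g.
have [|h] := leP pi (a + b); first exact: le_trans.
rewrite -ler_cos_itv ?addr_ge0 ?(ltW h) // cosD lerBlDr -lerBlDl.
have ss : 0 <= sin a * sin b by rewrite mulr_ge0 ?sin_ge0_pi ?a0 ?b0.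
by apply: le_of_sqr => //; rewrite -[_ - cos c]opprB sqrrN -subr_ge0 gramcE.
Qed.

Lemma gramc_lt {R : realType} (a b c : R) :
  0 <= a <= pi -> 0 <= b <= pi -> 0 <= c <= pi -> 0 < gramc a b c -> c < a + b.
Proof.
move=> /andP[a0 a1] /andP[b0 b1] /andP[c0 c1] g.
have [h|h] := leP pi (a + b).
  rewrite (lt_le_trans _ h) // lt_neqAle c1 andbT; apply/eqP => cpi; move: g.
  rewrite cpi /gramc cospi; apply/negP; rewrite -leNgt.
  have -> : 1 + 2 * cos a * cos b * -1 - cos a ^+ 2 - cos b ^+ 2 - (-1) ^+ 2
    = - (cos a + cos b) ^+ 2 by ring.
  by rewrite oppr_le0 sqr_ge0.
rewrite -ltr_cos_itv ?addr_ge0 ?(ltW h) // cosD ltrBlDr -ltrBlDl.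
have ss : 0 <= sin a * sin b by rewrite mulr_ge0 ?sin_ge0_pi ?a0 ?b0.
by apply: lt_of_sqr => //; rewrite -[_ - cos c]opprB sqrrN -subr_gt0 gramcE.
Qed.

(** The vanishing leaves [cos c = cos (a + b)] or [cos c = cos (a - b)]. The bound on [cos c]
    selects the first, and [0 <= cos a + cos b] says that [a + b <= pi], where the cosine is
    injective. *)
Lemma gramc_eq {R : realType} (a b c : R) :
  0 <= a <= pi -> 0 <= b <= pi -> 0 <= c <= pi -> gramc a b c = 0 ->
  0 <= cos a + cos b -> cos c <= cos a * cos b -> c = a + b.
Proof.
move=> /andP[a0 a1] /andP[b0 b1] /andP[c0 c1] g ab cab.
have h : a + b <= pi.
  rewrite -lerBrDl -ler_cos_itv // ?subr_ge0 // ?lerBlDr ?lerDl //.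
  by rewrite [pi - a]addrC cosDpi cosN -subr_ge0 opprK addrC.
have ss : 0 <= sin a * sin b by rewrite mulr_ge0 ?sin_ge0_pi ?a0 ?b0.
apply: cos_inj; rewrite ?in_itv /= ?c0 ?addr_ge0 ?h // cosD.
move/eqP: g; rewrite -gramcE subr_eq0 eqf_sqr => /orP[/eqP e|/eqP e].
  by move: ss cab; rewrite e; lra.
by rewrite e; ring.
Qed.

(** The condition on the sum gives [cos (pi - (a + b)) <= cos c], that is,
    [sin a * sin b <= cos c + cos a * cos b]; squaring turns the sines into cosines. *)
Lemma three_angles {R : realType} (a b c : R) :
  0 <= a <= pi -> 0 <= b <= pi -> 0 <= c <= pi -> a + b + c <= pi ->
  1 <= cos a ^+ 2 + cos b ^+ 2 + cos c ^+ 2 + 2 * cos a * cos b * cos c.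
Proof.
move=> /andP[a0 a1] /andP[b0 b1] /andP[c0 c1] s.
have h : cos (pi - (a + b)) <= cos c by rewrite ler_cos_itv //; lra.
rewrite addrC cosDpi cosN cosD opprB in h.
have ss : 0 <= sin a * sin b by rewrite mulr_ge0 ?sin_ge0_pi ?a0 ?b0.
have : (sin a * sin b) ^+ 2 <= (cos c + cos a * cos b) ^+ 2.
  by rewrite ler_pXn2r ?nnegrE //; lra.
by rewrite exprMn !sin2cos2; lra.
Qed.

(** If [u] or [v] is zero, the quotient is 0 by the convention for division and the angle is pi / 2,
    so that [ang_itv] and [dotr_cos] hold for all vectors. *)
Definition ang {R : realType} (u v : 'rV[R]_3) : R :=
  acos (dotr u v / (enorm u * enorm v)).

Lemma enorm_sqr {R : realType} n (u : 'rV[R]_n) : enorm u ^+ 2 = dotr u u.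
Proof. by rewrite sqr_sqrtr ?dotr_ge0. Qed.

Lemma enorm_ge0 {R : realType} n (u : 'rV[R]_n) : 0 <= enorm u.
Proof. exact: sqrtr_ge0. Qed.

Lemma enorm_gt0 {R : realType} n (u : 'rV[R]_n) : (0 < enorm u) = (u != 0).
Proof. by rewrite sqrtr_gt0 dotr_gt0. Qed.

Lemma ang_bound {R : realType} (u v : 'rV[R]_3) :
  -1 <= dotr u v / (enorm u * enorm v) <= 1.
Proof.
rewrite -ler_norml; have [->|u0] := eqVneq u 0.
  by rewrite dotrC dotr0 mul0r normr0.
have [->|v0] := eqVneq v 0; first by rewrite dotr0 mul0r normr0.
have p : 0 < enorm u * enorm v by rewrite mulr_gt0 // enorm_gt0.
rewrite normrM normfV [X in _ / X]gtr0_norm // ler_pdivrMr // mul1r.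
rewrite -(ler_pXn2r (n := 2)) ?nnegrE ?(ltW p) // real_normK ?num_real //.
by rewrite exprMn !enorm_sqr -subr_ge0 -lagrange dotr_ge0.
Qed.

Lemma ang_itv {R : realType} (u v : 'rV[R]_3) : 0 <= ang u v <= pi.
Proof. by rewrite /ang acos_ge0 ?acos_lepi ?ang_bound. Qed.

Lemma cos_ang {R : realType} (u v : 'rV[R]_3) :
  cos (ang u v) = dotr u v / (enorm u * enorm v).
Proof. by rewrite acosK ?in_itv ?ang_bound. Qed.

Lemma dotr_cos {R : realType} (u v : 'rV[R]_3) :
  dotr u v = enorm u * enorm v * cos (ang u v).
Proof.
rewrite cos_ang; have [->|u0] := eqVneq u 0.
  by rewrite dotrC dotr0 mul0r mulr0.
have [->|v0] := eqVneq v 0; first by rewrite dotr0 mul0r mulr0.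
by rewrite mulrC divfK // mulf_neq0 // gt_eqF // enorm_gt0.
Qed.

Lemma angC {R : realType} (u v : 'rV[R]_3) : ang u v = ang v u.
Proof. by rewrite /ang dotrC [enorm u * _]mulrC. Qed.

Lemma enormZ {R : realType} n k (u : 'rV[R]_n) : enorm (k *: u) = `|k| * enorm u.
Proof.
by rewrite /enorm dotrZl dotrZr mulrA -expr2 sqrtrM ?sqr_ge0 // sqrtr_sqr.
Qed.

Lemma angZl {R : realType} k (u v : 'rV[R]_3) : 0 < k -> ang (k *: u) v = ang u v.
Proof.
move=> k0; rewrite /ang dotrZl enormZ gtr0_norm //; congr acos.
by rewrite -[k * enorm u * _]mulrA -mulf_div divff ?mul1r ?gt_eqF.
Qed.

Lemma angZr {R : realType} k (u v : 'rV[R]_3) : 0 < k -> ang u (k *: v) = ang u v.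
Proof. by move=> k0; rewrite angC angZl // angC. Qed.

Lemma ang_refl {R : realType} (u : 'rV[R]_3) : u != 0 -> ang u u = 0.
Proof.
by move=> u0; rewrite /ang -expr2 enorm_sqr divff ?acos1 ?dotr_eq0.
Qed.

Lemma angNl {R : realType} (u v : 'rV[R]_3) : ang (- u) v = pi - ang u v.
Proof.
rewrite /ang dotrNl -[in enorm (- u)]scaleN1r enormZ normrN1 mul1r mulNr acosN //.
exact: ang_bound.
Qed.

Lemma det3_gramc {R : realType} (a b c : 'rV[R]_3) :
  det3 a b c ^+ 2 = (enorm a * enorm b * enorm c) ^+ 2
    * gramc (ang a b) (ang b c) (ang c a).
Proof. by rewrite gram3 /gramc -!enorm_sqr !dotr_cos; ring. Qed.

Lemma ang_triangle {R : realType} (a b c : 'rV[R]_3) :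
  a != 0 -> b != 0 -> c != 0 -> ang a c <= ang a b + ang b c.
Proof.
move=> a0 b0 c0; apply: gramc_le; rewrite ?ang_itv // [ang a c]angC.
rewrite -(pmulr_rge0 _ (x := (enorm a * enorm b * enorm c) ^+ 2)).
  by rewrite -det3_gramc sqr_ge0.
by rewrite exprn_gt0 // !mulr_gt0 ?enorm_gt0.
Qed.

Lemma ang_triangle_lt {R : realType} (a b c : 'rV[R]_3) :
  det3 a b c != 0 -> ang a c < ang a b + ang b c.
Proof.
move=> d; have a0 : a != 0 by apply: contraNneq d => ->; rewrite /det3 !mxE; apply/eqP; ring.
have b0 : b != 0 by apply: contraNneq d => ->; rewrite /det3 !mxE; apply/eqP; ring.
have c0 : c != 0 by apply: contraNneq d => ->; rewrite /det3 !mxE; apply/eqP; ring.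
apply: gramc_lt; rewrite ?ang_itv // [ang a c]angC.
rewrite -(pmulr_rgt0 _ (x := (enorm a * enorm b * enorm c) ^+ 2)).
  by rewrite -det3_gramc exprn_even_gt0.
by rewrite exprn_gt0 // !mulr_gt0 ?enorm_gt0.
Qed.

(** The three vectors are coplanar, so their Gram determinant vanishes and [gramc_eq] applies. With
    [z = cos (ang a b)], its two sign conditions become, after multiplication by [enorm m] and by
    its square, products of nonnegative factors such as [1 + z] and [1 - z]. *)
Lemma ang_add {R : realType} (a b : 'rV[R]_3) (s t : R) :
  a != 0 -> b != 0 -> 0 <= s -> 0 <= t -> s *: a + t *: b != 0 ->
  ang a b = ang a (s *: a + t *: b) + ang (s *: a + t *: b) b.
Proof.
set m := _ + _ => a0 b0 s0 t0 m0.
have na : 0 < enorm a by rewrite enorm_gt0.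
have nb : 0 < enorm b by rewrite enorm_gt0.
have nm : 0 < enorm m by rewrite enorm_gt0.
have sa : 0 <= s * enorm a by rewrite mulr_ge0 // ltW.
have tb : 0 <= t * enorm b by rewrite mulr_ge0 // ltW.
have := cos_le1 (ang a b); have := cos_geN1 (ang a b).
set z := cos (ang a b) => z1 z2.
have {}z1 : 0 <= 1 + z by rewrite addrC -[1]opprK subr_ge0.
have {}z2 : 0 <= 1 - z by rewrite subr_ge0.
have ex : enorm m * cos (ang a m) = s * enorm a + t * enorm b * z.
  apply: (mulfI (lt0r_neq0 na)); rewrite mulrA -dotr_cos dotrDr !dotrZr -enorm_sqr.
  by rewrite dotr_cos /z; ring.
have ey : enorm m * cos (ang m b) = s * enorm a * z + t * enorm b.
  apply: (mulfI (lt0r_neq0 nb)); rewrite mulrA [enorm b * _]mulrC -dotr_cos.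
  by rewrite dotrDl !dotrZl -enorm_sqr dotr_cos /z; ring.
have em : enorm m ^+ 2 = (s * enorm a) ^+ 2 + (t * enorm b) ^+ 2
    + 2 * (s * enorm a) * (t * enorm b) * z.
  rewrite enorm_sqr !(dotrDl, dotrDr) !(dotrZl, dotrZr) -!enorm_sqr.
  by rewrite [dotr b a]dotrC dotr_cos /z; ring.
apply: gramc_eq; rewrite ?ang_itv //.
- have p : (enorm a * enorm m * enorm b) ^+ 2 != 0.
    by rewrite expf_neq0 // !mulf_neq0 // gt_eqF.
  apply: (mulfI p); rewrite [ang a b]angC -det3_gramc mulr0.
  by have -> : det3 a m b = 0; rewrite ?expr0n // /m; vring.
- rewrite -(pmulr_rge0 _ nm) mulrDr ex ey.
  have -> : s * enorm a + t * enorm b * z + (s * enorm a * z + t * enorm b)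
    = (s * enorm a + t * enorm b) * (1 + z) by ring.
  by rewrite mulr_ge0 // addr_ge0.
- rewrite -/z -(ler_pM2l (exprn_gt0 2 nm)).
  have -> : enorm m ^+ 2 * (cos (ang a m) * cos (ang m b)) =
    (enorm m * cos (ang a m)) * (enorm m * cos (ang m b)) by ring.
  rewrite ex ey em -subr_ge0.
  have -> : (s * enorm a + t * enorm b * z) * (s * enorm a * z + t * enorm b) -
    ((s * enorm a) ^+ 2 + (t * enorm b) ^+ 2 + 2 * (s * enorm a) * (t * enorm b) * z) * z
    = (s * enorm a) * (t * enorm b) * ((1 - z) * (1 + z)) by ring.
  by apply: mulr_ge0; apply: mulr_ge0.
Qed.

(* Up to a positive factor, phi a b c >= 0 says that the pairwise angles of a, b, c, if
   they are acute, sum to at most pi.  It is a quadratic form in each vector. *)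
Definition phi {R : realType} (a b c : 'rV[R]_3) : R :=
  4 * dotr a b * dotr b c * dotr c a - det3 a b c ^+ 2.

Lemma phi_ge0_ang {R : realType} (a b c : 'rV[R]_3) :
  ang a b + ang b c + ang c a <= pi -> 0 <= phi a b c.
Proof.
move=> h; rewrite /phi gram3 -!enorm_sqr !dotr_cos.
have := three_angles (ang_itv a b) (ang_itv b c) (ang_itv c a) h.
move: (cos _) (cos _) (cos _) => x y z.
move=> /(ler_wpM2l (sqr_ge0 (enorm a * enorm b * enorm c))).
by rewrite -subr_ge0; congr (0 <= _); ring.
Qed.

Lemma dotr_ge0_ang {R : realType} (a b : 'rV[R]_3) : ang a b <= pi / 2 -> 0 <= dotr a b.
Proof.
move=> h; rewrite dotr_cos !mulr_ge0 ?enorm_ge0 // cos_ge0_pihalf // h andbT.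
by rewrite (le_trans _ (andP (ang_itv a b)).1) // oppr_le0 divr_ge0 ?pi_ge0.
Qed.

Lemma ang_split {R : realType} (a b m : 'rV[R]_3) (k s t : R) :
  a != 0 -> b != 0 -> m != 0 -> 0 < k -> 0 <= s -> 0 <= t ->
  k *: m = s *: a + t *: b -> ang a b = ang a m + ang m b.
Proof.
move=> a0 b0 m0 k0 s0 t0 e.
by rewrite (@ang_add _ a b s t) -?e ?angZr ?angZl // scaler_eq0 negb_or gt_eqF.
Qed.

Lemma det3_neq0 {R : realType} (u v w : 'rV[R]_3) :
  det3 u v w != 0 -> [/\ u != 0, v != 0 & w != 0].
Proof.
by move=> d; split; apply: contraNneq d => ->; apply/eqP; vring.
Qed.

Lemma plucker3 {R : realType} (a b c p q : 'rV[R]_3) :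
  det3 b c p * det3 a b q - det3 b c q * det3 a b p = det3 a b c * det3 p b q.
Proof. vring. Qed.

(* Extend each side of the fan until it meets the arc from - a_0 to a_K, at the
   point y_i; each extension only shortens the path from a_0 to a_K through y_i,
   whose initial length is the length 2 pi - ang a_0 a_K of the path through - a_0. *)
Lemma fan_perimeter {R : realType} (a : nat -> 'rV[R]_3) (K : nat) :
  (1 < K)%N ->
  (forall i j, (i < K)%N -> (j <= K)%N -> j != i -> j != i.+1 ->
     0 < det3 (a i) (a i.+1) (a j)) ->
  (forall j, (0 < j < K)%N -> 0 < det3 (a K) (a 0%N) (a j)) ->
  \sum_(i < K) ang (a i) (a i.+1) + ang (a K) (a 0%N) < 2 * pi.
Proof.
move=> K1 h c.
pose P i := det3 (a i) (a i.+1) (a 0%N).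
pose Q i := det3 (a i) (a i.+1) (a K).
(* [y i] lies both in the plane of [a i], [a i.+1] and in that of [a 0], [a K]. It is a positive
   multiple of [- a 0] for [i = 0] and of [a K] for [i = K.-1]. *)
pose y i := P i *: a K - Q i *: a 0%N.
have [nK _ n1] := det3_neq0 (lt0r_neq0 (c 1%N K1)).
have n i : (i <= K)%N -> a i != 0.
  rewrite leq_eqVlt => /predU1P[->//|iK].
  have [->|i0] := eqVneq i 0%N; first by have [] := det3_neq0 (lt0r_neq0 (c 1%N K1)).
  have d : 0 < det3 (a i) (a i.+1) (a 0%N) by apply: h => //; rewrite eq_sym.
  by have [] := det3_neq0 (lt0r_neq0 d).
have P0 i : (0 < i < K)%N -> 0 < P i.
  by move=> /andP[i0 iK]; apply: h => //; rewrite eq_sym -lt0n.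
have Q0 i : (i.+1 < K)%N -> 0 < Q i.
  by move=> iK; apply: h; rewrite ?(ltnW iK) // gtn_eqF // ltnW.
have Q0' i : (i < K)%N -> 0 <= Q i.
  move=> iK; have [/Q0/ltW //|Ki] := ltnP i.+1 K.
  rewrite /Q; have -> : K = i.+1 by lia.
  by rewrite det3_lrr lexx.
have yn i : (i < K)%N -> y i != 0.
  move=> iK; have [i0|i0] := posnP i.
    rewrite /y i0 /P det3_lrl scale0r sub0r oppr_eq0 scaler_eq0 negb_or n //.
    by rewrite andbT gt_eqF // Q0.
  have : det3 (y i) (a 0%N) (a 1%N) != 0.
    have -> : det3 (y i) (a 0%N) (a 1%N) = P i * det3 (a K) (a 0%N) (a 1%N).
      by rewrite /y; vring.
    by rewrite gt_eqF // mulr_gt0 ?P0 ?c // i0.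
  by case/det3_neq0.
have E i : y i = det3 (a 0%N) (a i) (a K) *: a i.+1
    - det3 (a 0%N) (a i.+1) (a K) *: a i by rewrite /y /P /Q; vecring.
(* Two splittings: [a i.+2] lies between [a i.+1] and [y i.+1], and [y i.+1] lies between [y i] and
   [a K]. In the second one the coefficient of [a K] is nonnegative by [plucker3]. *)
have step i : (i.+1 < K)%N ->
    ang (a i.+1) (a i.+2) + ang (a i.+2) (y i.+1) + ang (y i.+1) (a K)
    = ang (a i.+1) (y i.+1) + (ang (y i) (a K) - ang (y i) (y i.+1)).
  move=> iK; have iK' := ltnW iK.
  have -> : ang (a i.+1) (a i.+2) + ang (a i.+2) (y i.+1) = ang (a i.+1) (y i.+1).
    symmetry; apply: (@ang_split _ _ _ _ (det3 (a 0%N) (a i.+1) (a K))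
      (det3 (a 0%N) (a i.+2) (a K)) 1); rewrite ?yn ?n ?ler01 //.
    - by rewrite -det3_rot c.
    - have [->|e] := eqVneq i.+2 K; first by rewrite det3_lrr.
      by rewrite -det3_rot ltW // c //= ltn_neqAle iK e.
    - by rewrite (E i.+1) scale1r addrC subrK.
  congr (_ + _); apply/eqP; rewrite eq_sym subr_eq addrC; apply/eqP.
  apply: (@ang_split _ _ _ _ (Q i) (Q i.+1) (P i.+1 * Q i - Q i.+1 * P i));
    rewrite ?yn ?n ?Q0 ?Q0' //.
    rewrite /P /Q plucker3 mulr_ge0 // ltW ?h //; try lia.
    by rewrite -det3_rot c.
  by rewrite /y; vecring.
pose L i := \sum_(j < i.+1) ang (a j) (a j.+1) + ang (a i.+1) (y i) + ang (y i) (a K).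
have Lstep i : (i.+1 < K)%N -> L i.+1 = L i
    + (ang (a i.+1) (y i.+1) - (ang (a i.+1) (y i) + ang (y i) (y i.+1))).
  move=> iK; rewrite /L [in LHS]big_ord_recr /=; have := step i iK; lra.
(* Only the first shortening has to be strict: [a 1], [y 0], [y 1] are linearly independent. The
   later ones use the weak triangle inequality. *)
have Lle i : (i < K)%N -> (0 < i)%N -> L i < L 0%N.
  case: i => // i iK _; elim: i iK => [|i IH] iK.
    rewrite Lstep // gtrDl subr_lt0; apply: ang_triangle_lt.
    have -> : det3 (a 1%N) (y 0%N) (y 1%N) =
        Q 0%N * det3 (a 0%N) (a 1%N) (a K) * det3 (a 0%N) (a 1%N) (a 2%N).
      by rewrite E /y /P /Q; vring.
    rewrite -[det3 _ _ (a K)]det3_rot !mulf_neq0 // gt_eqF //; first exact: Q0.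
      exact: c.
    by rewrite h // ltnW.
  apply: le_lt_trans (IH (ltnW iK)); rewrite Lstep // gerDl subr_le0.
  by rewrite ang_triangle // ?yn ?n // ltnW.
have e0 : L 0%N = 2 * pi - ang (a K) (a 0%N).
  have -> : L 0%N = ang (a 0%N) (a 1%N) + ang (a 1%N) (y 0%N) + ang (y 0%N) (a K).
    by rewrite /L big_ord1.
  have -> : y 0%N = Q 0%N *: - a 0%N by rewrite /y /P; vecring.
  by rewrite angZr ?angZl ?Q0 // [ang (a 1%N) _]angC !angNl [ang (a K) _]angC; ring.
have eK : L K.-1 = \sum_(i < K) ang (a i) (a i.+1).
  rewrite /L; have KK : K.-1.+1 = K by lia.
  have -> : y K.-1 = P K.-1 *: a K.
    by rewrite /y /Q KK det3_lrr scale0r subr0.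
  by rewrite KK angZr ?angZl ?P0 ?ang_refl ?addr0 //; lia.
by rewrite -eK -ltrBrDr -e0 Lle //; lia.
Qed.

(** * Passing sign conditions from generators to a cone *)

Lemma phi_rot {R : realType} (a b c : 'rV[R]_3) : phi a b c = phi b c a.
Proof. by rewrite /phi [det3 a b c]det3_rot; ring. Qed.

Lemma phi_swap {R : realType} (a b c : 'rV[R]_3) : phi a b c = phi b a c.
Proof. by rewrite /phi; vring. Qed.

(** In the first argument [phi] is a product of two linear forms minus the square of a third. The
    mixed term is controlled because the squares of [x] and [y] are bounded by the hypotheses on
    [phi], and the arithmetic-geometric mean inequality compares [p1 * q2 * q1 * p2] with the square
    of [p1 * q2 + q1 * p2]. *)
Lemma phi_add {R : realType} (p q b c : 'rV[R]_3) :
  0 <= dotr p b -> 0 <= dotr p c -> 0 <= dotr q b -> 0 <= dotr q c ->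
  0 <= dotr b c -> 0 <= phi p b c -> 0 <= phi q b c -> 0 <= phi (p + q) b c.
Proof.
rewrite /phi ![dotr c _]dotrC !dotrDl.
have -> : det3 (p + q) b c = det3 p b c + det3 q b c by vring.
move: (dotr p b) (dotr p c) (dotr q b) (dotr q c) (dotr b c) => p1 p2 q1 q2 d.
move: (det3 p b c) (det3 q b c) => x y p10 p20 q10 q20 d0 hx hy.
have h : x * y <= 2 * d * (p1 * q2 + q1 * p2).
  apply: le_of_sqr; first by rewrite !mulr_ge0 ?addr_ge0 ?mulr_ge0.
  rewrite exprMn; apply: (@le_trans _ _ ((4 * p1 * d * p2) * (4 * q1 * d * q2))).
    by rewrite ler_pM ?sqr_ge0 // -subr_ge0.
  rewrite -subr_ge0; have -> : (2 * d * (p1 * q2 + q1 * p2)) ^+ 2 -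
    4 * p1 * d * p2 * (4 * q1 * d * q2) = 4 * (d * (p1 * q2 - q1 * p2)) ^+ 2 by ring.
  by rewrite mulr_ge0 ?sqr_ge0.
have -> : 4 * (p1 + q1) * d * (p2 + q2) - (x + y) ^+ 2 =
  (4 * p1 * d * p2 - x ^+ 2) + (4 * q1 * d * q2 - y ^+ 2) +
  2 * (2 * d * (p1 * q2 + q1 * p2) - x * y) by ring.
by apply: addr_ge0; [exact: addr_ge0|rewrite mulr_ge0 // subr_ge0].
Qed.

Lemma phiZl {R : realType} k (p b c : 'rV[R]_3) : phi (k *: p) b c = k ^+ 2 * phi p b c.
Proof. by rewrite /phi; vring. Qed.

(** By Carathéodory's theorem three generators, possibly repeated, suffice in dimension three. *)
Definition cone3 {R : realType} (G : 'rV[R]_3 -> Prop) (w : 'rV[R]_3) : Prop :=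
  exists x y z r s t, [/\ G x, G y & G z] /\
    [/\ 0 <= r, 0 <= s, 0 <= t & w = r *: x + s *: y + t *: z].

Lemma dotr_cone3 {R : realType} (G : 'rV[R]_3 -> Prop) (u w : 'rV[R]_3) :
  (forall x, G x -> 0 <= dotr x u) -> cone3 G w -> 0 <= dotr w u.
Proof.
move=> h [x [y [z [r [s [t [[Gx Gy Gz] [r0 s0 t0 ->]]]]]]]].
by rewrite !dotrDl !dotrZl !addr_ge0 // mulr_ge0 // h.
Qed.

Lemma phi_cone3 {R : realType} (G : 'rV[R]_3 -> Prop) (b c w : 'rV[R]_3) :
  (forall x, G x -> [/\ 0 <= dotr x b, 0 <= dotr x c & 0 <= phi x b c]) ->
  0 <= dotr b c -> cone3 G w -> 0 <= phi w b c.
Proof.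
move=> h bc [x [y [z [r [s [t [[Gx Gy Gz] [r0 s0 t0 ->]]]]]]]].
pose N p := [/\ 0 <= dotr p b, 0 <= dotr p c & 0 <= phi p b c].
have NZ k p : 0 <= k -> N p -> N (k *: p).
  by move=> k0 [? ? ?]; split; rewrite ?dotrZl ?phiZl mulr_ge0 ?sqr_ge0.
have ND p q : N p -> N q -> N (p + q).
  move=> [? ? ?] [? ? ?]; split; first by rewrite dotrDl addr_ge0.
    by rewrite dotrDl addr_ge0.
  exact: phi_add.
by have [] := ND _ _ (ND _ _ (NZ r x r0 (h x Gx)) (NZ s y s0 (h y Gy)))
  (NZ t z t0 (h z Gz)).
Qed.

(** The generators are replaced by elements of the cone one argument at a time; the symmetries of
    [phi] always bring the argument to be replaced to the front. *)
Lemma cone3_nonneg {R : realType} (G : 'rV[R]_3 -> Prop) :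
  (forall x y, G x -> G y -> 0 <= dotr x y) ->
  (forall x y z, G x -> G y -> G z -> 0 <= phi x y z) ->
  forall u v w, cone3 G u -> cone3 G v -> cone3 G w ->
  0 <= dotr u v /\ 0 <= phi u v w.
Proof.
move=> hd hp.
have hd1 x v : G x -> cone3 G v -> 0 <= dotr x v.
  move=> Gx; rewrite dotrC; apply: dotr_cone3 => y Gy; exact: hd.
have hd2 u v : cone3 G u -> cone3 G v -> 0 <= dotr u v.
  by move=> Cu Cv; apply: dotr_cone3 Cu => x Gx; exact: hd1.
have hp1 x y w : G x -> G y -> cone3 G w -> 0 <= phi w x y.
  move=> Gx Gy; apply: phi_cone3; last exact: hd.
  by move=> z Gz; split; [exact: hd|exact: hd|exact: hp].
have hp2 x v w : G x -> cone3 G v -> cone3 G w -> 0 <= phi v w x.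
  move=> Gx Cv Cw; move: Cv; apply: phi_cone3; last by rewrite dotrC; exact: hd1.
  move=> y Gy; split; [exact: hd1|exact: hd|].
  by rewrite phi_rot; exact: hp1.
move=> u v w Cu Cv Cw; split; first exact: hd2.
move: Cu; apply: phi_cone3; last exact: hd2.
by move=> x Gx; split; [exact: hd1|exact: hd1|rewrite phi_rot; exact: hp2].
Qed.

Lemma ang_chain {R : realType} (a : nat -> 'rV[R]_3) (K i j : nat) :
  (forall i, (i <= K)%N -> a i != 0) -> (i <= j)%N -> (j <= K)%N ->
  ang (a i) (a j) <=
    \sum_(m < j) ang (a m) (a m.+1) - \sum_(m < i) ang (a m) (a m.+1).
Proof.
move=> n; elim: j => [|j IH].
  by rewrite leqn0 => /eqP-> _; rewrite ang_refl ?n // subrr.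
rewrite leq_eqVlt => /predU1P[->|ij] jK.
  by rewrite ang_refl ?n // subrr.
rewrite [in X in _ <= X - _]big_ord_recr /= addrAC.
apply: le_trans (ang_triangle (b := a j) _ _ _) _; rewrite ?n ?(ltnW jK) //; try lia.
by rewrite lerD2r; apply: IH => //; exact: ltnW.
Qed.

(** Two points of a closed spherical polygon of length pi cut it into two arcs, one of length at
    most pi / 2; three points cut it into three arcs of total length pi. Each angle is at most the
    length of the corresponding arc, which [up] and [down] express for the two ways around. *)
Lemma fan_half_turn {R : realType} (a : nat -> 'rV[R]_3) (K : nat) :
  (forall i, (i <= K)%N -> a i != 0) ->
  \sum_(i < K) ang (a i) (a i.+1) + ang (a K) (a 0%N) = pi ->
  (forall i j, (i <= K)%N -> (j <= K)%N -> 0 <= dotr (a i) (a j)) /\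
  (forall i j l, (i <= K)%N -> (j <= K)%N -> (l <= K)%N ->
     0 <= phi (a i) (a j) (a l)).
Proof.
move=> n hpi; pose S i := \sum_(m < i) ang (a m) (a m.+1).
have up i j : (i <= j)%N -> (j <= K)%N -> ang (a i) (a j) <= S j - S i.
  exact: ang_chain.
have down i j : (i <= K)%N -> (j <= K)%N -> ang (a j) (a i) <= pi - S j + S i.
  move=> iK jK; rewrite -hpi -/(S K).
  apply: le_trans (ang_triangle (b := a K) _ _ _) _; rewrite ?n //.
  have h1 := up j K jK (leqnn K).
  have : ang (a K) (a i) <= ang (a K) (a 0%N) + S i.
    apply: le_trans (ang_triangle (b := a 0%N) _ _ _) _; rewrite ?n //.
    by rewrite lerD2l; apply: le_trans (up 0%N i _ _) _; rewrite // /S big_ord0 subr0.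
  lra.
split.
  have H i j : (i <= j)%N -> (j <= K)%N -> 0 <= dotr (a i) (a j).
    move=> ij jK; apply: dotr_ge0_ang; have := up i j ij jK.
    by have := down i j (leq_trans ij jK) jK; rewrite angC; lra.
  move=> i j iK jK; have [/H-> //|/ltnW/H] := leqP i j.
  by rewrite dotrC => ->.
have H i j l : (i <= j)%N -> (j <= l)%N -> (l <= K)%N -> 0 <= phi (a i) (a j) (a l).
  move=> ij jl lK; apply: phi_ge0_ang.
  have jK := leq_trans jl lK; have iK := leq_trans ij jK.
  by have := up i j ij jK; have := up j l jl lK; have := down i l iK lK; lra.
move=> i j l iK jK lK.
have [ij|/ltnW ji] := leqP i j; have [jl|/ltnW lj] := leqP j l;
  have [il|/ltnW li] := leqP i l.
- exact: H.
- exact: H.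
- by rewrite phi_swap phi_rot; apply: H.
- by rewrite -phi_rot; apply: H.
- by rewrite phi_swap; apply: H.
- by rewrite phi_rot; apply: H.
- by rewrite phi_swap -phi_rot; apply: H.
- by rewrite phi_swap -phi_rot; apply: H.
Qed.

(** The cone is cut into triangular cones with the common ray [a 0]. The first [i] for which [w] is
    not strictly to the left of the plane of [a 0], [a i.+1] locates [w] in one of them, and
    Cramer's rule gives the coefficients. *)
Lemma fan_cone {R : realType} (a : nat -> 'rV[R]_3) (K : nat) (w : 'rV[R]_3) :
  (1 < K)%N ->
  (forall i, (0 < i < K)%N -> 0 < det3 (a 0%N) (a i) (a i.+1)) ->
  (forall i, (i < K)%N -> 0 <= det3 (a i) (a i.+1) w) ->
  0 <= det3 (a K) (a 0%N) w ->
  cone3 (fun x => exists2 i, (i <= K)%N & x = a i) w.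
Proof.
move=> K1 h hw hK.
pose p i := (0 < i < K)%N && (det3 (a 0%N) (a i.+1) w <= 0).
have : exists i, p i.
  exists K.-1; apply/andP; split; first lia.
  by rewrite prednK 1?det3_swap ?oppr_le0 //; lia.
move=> /ex_minnP[i /andP[iK hi] mi].
have hi' : 0 <= det3 (a 0%N) (a i) w.
  have [i1|i1] := eqVneq i 1%N; first by rewrite i1 hw // ltnW.
  rewrite leNgt; apply/negP => hneg.
  have /mi : p i.-1 by apply/andP; split; [lia|rewrite prednK ?ltW //; lia].
  lia.
have d := h i iK; have di := invr_ge0 (det3 (a 0%N) (a i) (a i.+1)).
exists (a 0%N), (a i), (a i.+1).
exists ((det3 (a 0%N) (a i) (a i.+1))^-1 * det3 w (a i) (a i.+1)).
exists ((det3 (a 0%N) (a i) (a i.+1))^-1 * det3 (a 0%N) w (a i.+1)).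
exists ((det3 (a 0%N) (a i) (a i.+1))^-1 * det3 (a 0%N) (a i) w).
split; first by split; [exists 0%N|exists i|exists i.+1] => //; lia.
split.
- by rewrite mulr_ge0 ?di ?(ltW d) // det3_rot hw //; lia.
- rewrite mulr_ge0 ?di ?(ltW d) //.
  by rewrite -det3_rot det3_swap oppr_ge0.
- by rewrite mulr_ge0 ?di ?(ltW d).
- by rewrite -!scalerA -!scalerDr -cramer3 scalerA mulVf ?scale1r // gt_eqF.
Qed.

(** * Sides of a planar convex hull *)

Lemma seq_argmin {R : realType} (T : eqType) (f : T -> R) (x0 : T) (s : seq T) :
  x0 \in s -> exists2 x, x \in s & forall y, y \in s -> f x <= f y.
Proof.
elim: s x0 => // x [_ _ _|y s IH _ _].
  by exists x; rewrite ?mem_head // => z; rewrite inE => /eqP->.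
have [m ms hm] := IH y (mem_head _ _).
have [h|h] := leP (f x) (f m).
  exists x; rewrite ?mem_head // => z; rewrite inE => /predU1P[->//|/hm].
  exact: le_trans.
exists m; first by rewrite inE ms orbT.
by move=> z; rewrite inE => /predU1P[->|/hm//]; exact: ltW.
Qed.

(* In the affine plane dotr n = 1, the oriented segment from a to b is a side of
   the convex hull of W, which lies on its left. *)
Definition hull_side {R : realType} (W : seq 'rV[R]_3) (a b : 'rV[R]_3) : Prop :=
  [/\ a \in W, b \in W, a != b & forall w, w \in W -> 0 <= det3 a b w /\
    (det3 a b w = 0 -> exists s, [/\ 0 <= s, s <= 1 & w = (1 - s) *: a + s *: b])].

Lemma cross_neq0 {R : realType} (n a b : 'rV[R]_3) :
  dotr n a = 1 -> dotr n b = 1 -> a != b -> cross a b != 0.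
Proof.
move=> na nb; apply: contraNneq => c0; rewrite -subr_eq0.
have : cross n (cross a b) = dotr n b *: a - dotr n a *: b by vecring.
rewrite na nb c0 !scale1r => <-; apply/eqP; vecring.
Qed.

(** Each of [a], [a'] lies weakly to the left of the line from the other to [b], and these two
    conditions have opposite signs; so the points are collinear. Then each of [a], [a'] lies on the
    segment from the other to [b], which forces equality. *)
Lemma hull_side_inj {R : realType} (W : seq 'rV[R]_3) (a a' b : 'rV[R]_3) :
  hull_side W a b -> hull_side W a' b -> a = a'.
Proof.
move=> [aW bW ab h] [aW' _ ab' h'].
have [p q] := h a' aW'; have [p' q'] := h' a aW.
have E0 : det3 a' b a = - det3 a b a' by vring.
rewrite E0 in p' q'.
have d : det3 a b a' = 0 by lra.
have [s [s0 s1 e]] := q d.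
have [|t [t0 t1 e']] := q'; first by rewrite d oppr0.
have E : (1 - (1 - s) * (1 - t)) *: (a - b) = 0.
  have -> : (1 - (1 - s) * (1 - t)) *: (a - b) =
    a - ((1 - t) *: ((1 - s) *: a + s *: b) + t *: b) by vecring.
  by rewrite -e -e' subrr.
have /eqP : 1 - (1 - s) * (1 - t) = 0.
  by apply/eqP; move/eqP: E; rewrite scaler_eq0 [a - b == 0]subr_eq0 (negbTE ab) orbF.
move=> /eqP st; have s1' : s = 0 by nra.
by rewrite e s1' subr0 scale0r addr0 scale1r.
Qed.

(** One step of gift wrapping around [b]: among the points strictly to the left of the side from [a]
    to [b], a direction of extreme slope is chosen, and on it the farthest point. *)
Lemma hull_side_succ {R : realType} (n : 'rV[R]_3) (W : seq 'rV[R]_3) (a b : 'rV[R]_3) :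
  (forall w, w \in W -> dotr n w = 1) ->
  (forall c, c != 0 -> exists2 w, w \in W & dotr c w != 0) ->
  hull_side W a b -> exists c, hull_side W b c.
Proof.
move=> hn span [aW bW ab h].
(* [f] measures the distance from the line through [a], [b], and [e] the displacement from [b] back
   towards [a]. By [key], the sign of [det3 b c w] compares the slopes [e / f] of [w] and [c]. *)
pose f w := det3 a b w; pose e w := det3 w b (cross a b).
have cn : cross a b != 0 by apply: (@cross_neq0 _ n); rewrite ?hn.
have [w0 w0W] := span _ cn; rewrite dotr_cross -/(f w0) => fw0.
have f0 : 0 < f w0 by rewrite lt0r fw0 (h w0 w0W).1.
pose W1 := [seq w <- W | 0 < f w].
have w01 : w0 \in W1 by rewrite mem_filter f0.
have [c1 c1W hc1] := seq_argmin (fun w => e w / f w) w01.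
pose W2 := [seq w <- W1 | e w / f w == e c1 / f c1].
have c12 : c1 \in W2 by rewrite mem_filter eqxx.
have [c] := seq_argmin (fun w => - f w) c12.
rewrite !mem_filter => /and3P[/eqP ec fc cW] hc.
have key w : dotr (cross a b) (cross a b) * det3 b c w = f c * e w - e c * f w.
  by rewrite /f /e; vring.
have pos : 0 < dotr (cross a b) (cross a b) by rewrite dotr_gt0.
exists c; split => //.
  by apply: contraTneq fc => <-; rewrite /f det3_lrr ltxx.
move=> w wW; have [fw0' fw1] := h w wW.
have [fw|fw] := ltP 0 (f w); last first.
  have {}fw : f w = 0 by apply/eqP; rewrite eq_le fw.
  have [s [s0 s1 ew]] := fw1 fw.
  have -> : det3 b c w = (1 - s) * f c by rewrite ew /f; vring.
  split; first by rewrite mulr_ge0 ?subr_ge0 // ltW.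
  move/eqP; rewrite mulf_eq0 (gt_eqF fc) orbF => /eqP s1'.
  exists 0; split => //; rewrite ew s1'; have -> : s = 1 by lra.
  by rewrite subr0 !scale0r scale1r add0r addr0.
have wW1 : w \in W1 by rewrite mem_filter fw.
have r : e c / f c <= e w / f w by rewrite ec hc1.
have r' : 0 <= f c * e w - e c * f w.
  move: r; rewrite ler_pdivrMr // mulrAC ler_pdivlMr //. by rewrite subr_ge0 [f c * _]mulrC.
split; first by rewrite -(pmulr_rge0 _ pos) key.
move=> d0; have req : f c * e w - e c * f w = 0 by rewrite -key d0 mulr0.
have wW2 : w \in W2.
  rewrite mem_filter wW1 andbT -ec eqr_div ?lt0r_neq0 //; apply/eqP.
  by rewrite mulrC; apply: subr0_eq.
have fwc : f w <= f c by have := hc w wW2; rewrite lerN2.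
have cr := cramer3 a b c w; rewrite -/(f c) -/(f w) in cr.
have dz : det3 w b c = 0 by rewrite det3_rot.
rewrite dz scale0r add0r in cr.
have nE : f c = det3 a w c + f w.
  by have := congr1 (dotr n) cr; rewrite dotrDr !dotrZr !hn // !mulr1.
exists (f w / f c); split.
- by rewrite divr_ge0 // ltW.
- by rewrite ler_pdivrMr // mul1r.
have -> : 1 - f w / f c = det3 a w c / f c.
  by rewrite -{1}(divff (x := f c)) ?lt0r_neq0 // -mulrBl {1}nE addrK.
apply: (scalerI (a := f c)); first by rewrite lt0r_neq0.
by rewrite scalerDr !scalerA ![f c * (_ / _)]mulrC !divfK ?lt0r_neq0.
Qed.

(** If [c] were interior to the segment from [a] to [b], both ends would lie on the line of [c],
    [d], and both on the ray from [c] towards [d]. Since [c] lies between them, both would equal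
    [c]. *)
Lemma hull_side_corner {R : realType} (W : seq 'rV[R]_3) (a b c d : 'rV[R]_3) :
  hull_side W a b -> hull_side W c d -> det3 a b c = 0 -> c = a \/ c = b.
Proof.
move=> [aW bW ab h] [cW dW cd h'] d0.
have [_ /(_ d0) [s [s0 s1 e]]] := h c cW.
have [pa qa] := h' a aW; have [pb qb] := h' b bW.
have E : (1 - s) * det3 c d a + s * det3 c d b = 0.
  by rewrite {1}(_ : (1 - s) * _ = det3 c d ((1 - s) *: a)) -?det3Zr // -det3Dr -e det3_lrl.
have [s00|sn0] := eqVneq s 0.
  by left; rewrite e s00 subr0 scale1r scale0r addr0.
have [s11|sn1] := eqVneq s 1.
  by right; rewrite e s11 subrr scale1r scale0r add0r.
have {}s0 : 0 < s by rewrite lt0r sn0.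
have {}s1 : 0 < 1 - s by rewrite subr_gt0 lt_neqAle sn1.
have /qa[t [t0 _ ea]] : det3 c d a = 0 by nra.
have /qb[t' [t0' _ eb]] : det3 c d b = 0 by nra.
exfalso.
have : ((1 - s) * t + s * t') *: (d - c) = 0.
  have -> : ((1 - s) * t + s * t') *: (d - c) = (1 - s) *: ((1 - t) *: c + t *: d)
     + s *: ((1 - t') *: c + t' *: d) - c by vecring.
  by rewrite -ea -eb -e subrr.
move/eqP; rewrite scaler_eq0 [d - c == 0]subr_eq0 [d == c]eq_sym (negbTE cd) orbF => /eqP z.
have tz : t = 0 by nra.
have tz' : t' = 0 by nra.
move: ab; rewrite ea eb tz tz' => /negP; apply; apply/eqP; vecring.
Qed.

(** Successors are iterated from [a0]. Finiteness of [W] gives a repetition, and uniqueness of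
    predecessors moves it back to a return to [a0]. For the least period [k] the points are
    distinct, so [hull_side_corner] makes the determinants strict; [K] is the last index [k.-1]. *)
Lemma hull_cycle {R : realType} (n : 'rV[R]_3) (W : seq 'rV[R]_3) (a0 a1 : 'rV[R]_3) :
  (forall w, w \in W -> dotr n w = 1) ->
  (forall c, c != 0 -> exists2 w, w \in W & dotr c w != 0) ->
  hull_side W a0 a1 ->
  exists (K : nat) (a : nat -> 'rV[R]_3), [/\ (1 < K)%N, a 0%N = a0, a 1%N = a1 &
    [/\ forall i, (i < K)%N -> hull_side W (a i) (a i.+1),
      hull_side W (a K) (a 0%N),
      forall i j, (i < K)%N -> (j <= K)%N -> j != i -> j != i.+1 ->
        0 < det3 (a i) (a i.+1) (a j) &
      forall j, (0 < j < K)%N -> 0 < det3 (a K) (a 0%N) (a j)]].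
Proof.
move=> hn span s01.
have /choice[f fP] : forall b, exists c, (exists a, hull_side W a b) -> hull_side W b c.
  move=> b; have [[a ab]|nb] := pselect (exists a, hull_side W a b).
    by have [c bc] := hull_side_succ hn span ab; exists c.
  by exists b => /nb.
pose a i := if i is j.+1 then iter j f a1 else a0.
have side i : hull_side W (a i) (a i.+1).
  by elim: i => // i IH; apply: fP; exists (a i).
have aW i : a i \in W by have [] := side i.
have back i d : a i = a (i + d)%N -> a 0%N = a d.
  elim: i => // i IH e; apply: IH; apply: hull_side_inj (side _) _.
  by rewrite e addSn; apply: side.
have [d d0 ad] : exists2 d, (0 < d)%N & a 0%N = a d.
  apply: contrapT => nd.
  have u : uniq [seq a i | i <- iota 0 (size W).+1].
    rewrite map_inj_in_uniq ?iota_uniq // => i j _ _ e.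
    apply/eqP; case: ltngtP => // ij; exfalso; apply: nd.
      by exists (j - i)%N; rewrite ?subn_gt0 //; apply: (back i); rewrite subnKC // ltnW.
    by exists (i - j)%N; rewrite ?subn_gt0 //; apply: (back j); rewrite subnKC // ltnW.
  have /(uniq_leq_size u) : {subset [seq a i | i <- iota 0 (size W).+1] <= W}.
    by move=> x /mapP[i _ ->].
  by rewrite size_map size_iota ltnn.
have : exists d, (0 < d)%N && (a d == a0) by exists d; rewrite d0 -ad /=.
move=> /ex_minnP[k /andP[k0 /eqP ak] mk].
(* Period 1 would be a side from [a0] to itself. Period 2 would give sides in both directions
   between [a0] and [a1], so all of [W] would lie in one plane through the origin. *)
have k3 : (2 < k)%N.
  case: k k0 ak {mk} => [|[|[|]]] // _ e.
    by have := side 0%N; rewrite e => -[_ _ /eqP].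
  have [a0W _ /(cross_neq0 (hn _ (aW 0%N)) (hn _ (aW 1%N)))/span[w wW]] := side 0%N.
  rewrite dotr_cross => /negP[]; apply/eqP.
  have [_ _ _ /(_ w wW)[p _]] := side 0%N.
  have [_ _ _ /(_ w wW)[q _]] := side 1%N.
  by move: p q; rewrite e /= [det3 a1 a0 w]det3_swap /=; lra.
exists k.-1, a; split=> //; first lia.
have sideK : hull_side W (a k.-1) (a 0%N).
  by have := side k.-1; rewrite prednK // ak.
have inj i j : (i < j)%N -> (j < k)%N -> a i != a j.
  move=> ij jk; apply/eqP => e; have : (k <= j - i)%N.
    apply: mk; rewrite subn_gt0 ij /=; apply/eqP; symmetry.
    by apply: (back i); rewrite subnKC // ltnW.
  lia.
have inj' i j : (i < k)%N -> (j < k)%N -> i != j -> a i != a j.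
  move=> ik jk; case: (ltngtP i j) => // h _; first exact: inj.
  by rewrite eq_sym; apply: inj.
have strict i j : (i < k)%N -> (j < k)%N -> a j != a i -> a j != a i.+1 ->
    0 < det3 (a i) (a i.+1) (a j).
  move=> ik jk n1 n2; have [_ _ _ /(_ (a j) (aW j))[p _]] := side i.
  rewrite lt0r p andbT; apply/eqP => /(hull_side_corner (side i) (side j)).
  by move=> [] /eqP; rewrite ?(negbTE n1) ?(negbTE n2).
split=> // [i j iK jK ij ij'|j jK].
  by apply: strict; try lia; apply: inj'; lia.
have := strict k.-1 j; rewrite prednK // ak; apply; try lia.
  by apply: inj'; lia.
by apply: (inj' j 0%N); lia.
Qed.

(** * Faces of a polytope *)

Lemma sub_conv_hull {R : realType} n (S : set 'rV[R]_n) : S `<=` conv_hull S.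
Proof.
move=> x Sx; exists 1%N, (fun=> x), (fun=> 1); split=> //.
  by rewrite big_ord1.
by rewrite big_ord1 scale1r.
Qed.

Lemma sub_aff_hull {R : realType} n (S : set 'rV[R]_n) : S `<=` aff_hull S.
Proof.
move=> x Sx; exists 1%N, (fun=> x), (fun=> 1); split=> //.
  by rewrite big_ord1.
by rewrite big_ord1 scale1r.
Qed.

Lemma aff_hull_eq {R : realType} n (S : set 'rV[R]_n) c b :
  (forall x, S x -> dotr c x = b) -> forall x, aff_hull S x -> dotr c x = b.
Proof.
move=> h x [m [v [w [Sv w1 ->]]]]; rewrite dotr_sumr.
under eq_bigr => i _ do rewrite dotrZr (h _ (Sv i)).
by rewrite -mulr_suml w1 mul1r.
Qed.

Lemma conv_hull_le {R : realType} n (S : set 'rV[R]_n) c b :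
  (forall x, S x -> dotr c x <= b) -> forall x, conv_hull S x -> dotr c x <= b.
Proof.
move=> h x [m [v [w [Sv w0 w1 ->]]]]; rewrite dotr_sumr.
rewrite -[b]mul1r -w1 mulr_suml; apply: ler_sum => i _.
by rewrite dotrZr ler_wpM2l // h.
Qed.

Lemma conv_hull_face {R : realType} n (S : set 'rV[R]_n) c b :
  (forall x, S x -> dotr c x <= b) ->
  forall x, conv_hull S x -> dotr c x = b ->
  conv_hull (S `&` [set y | dotr c y = b]) x.
Proof.
move=> h x [m [v [w [Sv w0 w1 ->]]]]; rewrite dotr_sumr => e.
have e0 : \sum_i w i * (b - dotr c (v i)) = 0.
  under eq_bigr => i _ do rewrite mulrBr.
  rewrite sumrB -mulr_suml w1 mul1r -{1}e; apply/eqP; rewrite subr_eq0; apply/eqP.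
  by apply: eq_bigr => i _; rewrite dotrZr.
have ge i : 0 <= w i * (b - dotr c (v i)) by rewrite mulr_ge0 // subr_ge0 h.
have z i : w i = 0 \/ dotr c (v i) = b.
  move/eqP: e0; rewrite psumr_eq0 // => /allP/(_ i (mem_index_enum _)).
  by rewrite mulf_eq0 subr_eq0 => /orP[/eqP|/eqP]; [left|right].
have [i0 wi0] : exists i, w i != 0.
  apply: contrapT => nw; move/eqP: w1; rewrite big1 => [|i _].
    by rewrite eq_sym oner_eq0.
  by apply: contrapT => /eqP ?; apply: nw; exists i.
(* Only points of weight 0 can lie off the face; they are replaced by a point of nonzero weight. *)
pose v' i := if w i == 0 then v i0 else v i.
exists m, v', w; split=> // [i|].
  rewrite /v'; have [_|wi] := eqVneq (w i) 0.
    by split=> //=; case: (z i0) => // /eqP; rewrite (negbTE wi0).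
  by split=> //=; case: (z i) => // /eqP; rewrite (negbTE wi).
by apply: eq_bigr => i _; rewrite /v'; have [->|] := eqVneq (w i) 0; rewrite ?scale0r.
Qed.

Lemma conv_hull0 {R : realType} n (S : set 'rV[R]_n) x : conv_hull S x -> exists y, S y.
Proof.
move=> [[|m] [v [w [Sv w0 w1 _]]]]; last by exists (v ord0).
by move/eqP: w1; rewrite big_ord0 eq_sym oner_eq0.
Qed.

Lemma aff_hull0 {R : realType} n (S : set 'rV[R]_n) x : aff_hull S x -> exists y, S y.
Proof.
move=> [[|m] [v [w [Sv w1 _]]]]; last by exists (v ord0).
by move/eqP: w1; rewrite big_ord0 eq_sym oner_eq0.
Qed.

Lemma seq_bound {R : realType} (T : eqType) (f : T -> R) (s : seq T) :
  exists2 N, 0 <= N & forall x, x \in s -> f x < N.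
Proof.
elim: s => [|x s [N N0 IH]]; first by exists 0.
exists (Num.max N (f x + 1)); first by rewrite le_max N0.
move=> y; rewrite inE => /predU1P[->|/IH h]; rewrite lt_max ?h //.
by rewrite ltrDl ltr01 orbT.
Qed.

(** Lexicographic maximization as a single functional: [N] exceeds every ratio of a gain in [d] to a
    loss in [c], so in [N *: c + d] any loss in [c] outweighs the gain. *)
Lemma lex_functional {R : realType} n (V : seq 'rV[R]_n) (v0 c d : 'rV[R]_n) :
  (forall w, w \in V -> dotr c w <= dotr c v0) ->
  (forall w, w \in V -> dotr c w = dotr c v0 -> dotr d w <= dotr d v0) ->
  exists f, forall w, w \in V -> dotr f w <= dotr f v0 /\
    (dotr f w = dotr f v0 -> dotr c w = dotr c v0 /\ dotr d w = dotr d v0).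
Proof.
move=> hc hd.
have [N N0 hN] := seq_bound (fun w => (dotr d w - dotr d v0) / (dotr c v0 - dotr c w)) V.
exists (N *: c + d) => w wV; rewrite !dotrDl !dotrZl.
have := hc w wV; rewrite le_eqVlt => /predU1P[e|lt].
  rewrite e; have h := hd w wV e; split; first by rewrite lerD2l.
  by move=> /addrI.
have := hN w wV; rewrite ltr_pdivrMr ?subr_gt0 // => h.
by split; [|move=> e]; move: h; rewrite mulrBr; lra.
Qed.

Lemma has_dim_point {R : realType} n (v : 'rV[R]_n) : has_dim [set v] 0.
Proof.
exists v, 0; split; first by rewrite /row_free mxrank0.
apply/seteqP; split=> x.
  move=> [m [u [w [hu w1 ->]]]]; exists 0 => //.
  rewrite mulmx0 addr0; under eq_bigr => i _ do rewrite (hu i).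
  by rewrite -scaler_suml w1 scale1r.
by move=> [u _ <-]; rewrite mulmx0 addr0; apply: sub_aff_hull.
Qed.

Lemma vertex_exposed {R : realType} n (V : seq 'rV[R]_n) (v f : 'rV[R]_n) :
  v \in V -> (forall w, w \in V -> w != v -> dotr f w < dotr f v) ->
  vertex (conv_hull [set` V]) v.
Proof.
move=> vV hf; split; last exact: has_dim_point.
have hle x : [set` V] x -> dotr f x <= dotr f v.
  by move=> /= xV; have [->//|/hf-/(_ xV)/ltW] := eqVneq x v.
exists f, (dotr f v); split; first exact: conv_hull_le.
apply/seteqP; split=> [x ->|x [Px ex]].
  by split=> //; apply: sub_conv_hull.
have [m [u [w [hu _ w1 ->]]]] := conv_hull_face hle Px ex.
under eq_bigr => i _.
  have -> : u i = v.
    have [/= uV ue] := hu i; apply: contrapT => /eqP/(hf _ uV).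
    by rewrite ue ltxx.
over.
by rewrite -scaler_suml w1 scale1r.
Qed.

(** The functional [d] is free: opposite choices give the two ends of an edge, and the negated
    functional of an edge gives a vertex of a facet away from that edge. *)
Lemma face_vertex {R : realType} n (V : seq 'rV[R]_n) (c d x : 'rV[R]_n) b :
  let P := conv_hull [set` V] in
  (forall y, P y -> dotr c y <= b) -> P x -> dotr c x = b ->
  exists v, [/\ vertex P v, v \in V, dotr c v = b &
    forall y, P y -> dotr c y = b -> dotr d y <= dotr d v].
Proof.
move=> P hc Px cx.
have hV y : [set` V] y -> dotr c y <= b by move=> ?; apply/hc/sub_conv_hull.
have [y0 [/= y0V cy0]] := conv_hull0 (conv_hull_face hV Px cx).
pose V1 := [seq w <- V | dotr c w == b].
have y01 : y0 \in V1 by rewrite mem_filter cy0 eqxx.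
have [y1 y1V hy1] := seq_argmin (fun w => - dotr d w) y01.
(* Among the remaining ties, the point farthest from the origin is exposed. *)
pose V2 := [seq w <- V1 | dotr d w == dotr d y1].
have y12 : y1 \in V2 by rewrite mem_filter eqxx.
have [v] := seq_argmin (fun w => - dotr w w) y12.
rewrite !mem_filter => /and3P[/eqP dv /eqP cv vV] hv.
have [||f1 hf1] := @lex_functional _ _ V v c d.
- by move=> w wV; rewrite cv; apply: hV.
- move=> w wV cw; rewrite dv -lerN2; apply: hy1.
  by rewrite mem_filter wV cw cv eqxx.
have [||f hf] := @lex_functional _ _ V v f1 v.
- by move=> w wV; have [] := hf1 w wV.
- move=> w wV /(hf1 w wV).2 [cw dw].
  have : dotr w w <= dotr v v.
    by rewrite -lerN2; apply: hv; rewrite !mem_filter wV cw cv dw dv !eqxx.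
  by have := dotr_ge0 (v - w); rewrite dotrBl !dotrBr [dotr w v]dotrC; lra.
exists v; split=> //.
- apply: (@vertex_exposed _ _ V v f) => // w wV nw.
  have [l e] := hf w wV; rewrite lt_neqAle l andbT; apply/eqP => /e[e1 e2].
  have [cw dw] := (hf1 w wV).2 e1.
  have : dotr w w <= dotr v v.
    by rewrite -lerN2; apply: hv; rewrite !mem_filter wV cw cv dw dv !eqxx.
  have := dotr_ge0 (w - v); rewrite dotrBl !dotrBr [dotr w v]dotrC e2 => h1 h2.
  move: nw; rewrite -subr_eq0 -dotr_eq0 => /eqP; apply.
  by rewrite dotrBl !dotrBr [dotr w v]dotrC e2; lra.
move=> y Py cy.
have := conv_hull_face hV Py cy; apply: conv_hull_le => w [/= wV cw].
by rewrite dv -lerN2; apply: hy1; rewrite mem_filter wV cw eqxx.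
Qed.

Lemma vertex_support {R : realType} n (V : seq 'rV[R]_n) (v : 'rV[R]_n) :
  vertex (conv_hull [set` V]) v ->
  v \in V /\ exists f, forall w, w \in V -> w != v -> 0 < dotr f (w - v).
Proof.
move=> [[c [b [hc e]]] _].
have [Pv cv] : (conv_hull [set` V] `&` [set x | dotr c x = b]) v by rewrite -e.
have hV y : [set` V] y -> dotr c y <= b by move=> ?; apply/hc/sub_conv_hull.
have only w : w \in V -> dotr c w = b -> w = v.
  move=> wV cw; have : [set v] w by rewrite e; split=> //; apply: sub_conv_hull.
  by [].
have [w [/= wV cw]] := conv_hull0 (conv_hull_face hV Pv cv).
split; first by rewrite -(only w).
exists (- c) => u uV nu; rewrite dotrNl dotrBr oppr_gt0 subr_lt0 cv lt_neqAle hV // andbT.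
by apply: contraNneq nu => /(only u uV) ->.
Qed.

Lemma cross_normal {R : realType} (u v c : 'rV[R]_3) :
  dotr c u = 0 -> dotr c v = 0 ->
  dotr (cross u v) (cross u v) *: c = dotr c (cross u v) *: cross u v.
Proof.
move=> cu cv; have -> : dotr (cross u v) (cross u v) *: c =
  dotr c (cross u v) *: cross u v - cross (cross u v) (dotr c u *: v - dotr c v *: u).
  by vecring.
by rewrite cu cv !scale0r subrr; vecring.
Qed.

Lemma cross_parallel {R : realType} (d y : 'rV[R]_3) :
  cross d y = 0 -> dotr d d *: y = dotr d y *: d.
Proof.
move=> h; have -> : dotr d d *: y = dotr d y *: d - cross d (cross d y) by vecring.
by rewrite h; vecring.
Qed.

Lemma dim2_points {R : realType} (F : set 'rV[R]_3) : has_dim F 2 ->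
  exists p0 p1 p2, [/\ F p0, F p1, F p2 & cross (p1 - p0) (p2 - p0) != 0].
Proof.
move=> [a [B [fB e]]]; apply: contrapT => no.
have par p0 p1 p2 : F p0 -> F p1 -> F p2 -> cross (p1 - p0) (p2 - p0) = 0.
  by move=> F0 F1 F2; apply: contrapT => /eqP nz; apply: no; exists p0, p1, p2.
have aA u : aff_hull F (a + u *m B) by rewrite e; exists u.
have [p0 F0] := aff_hull0 (aA 0).
have [d Fd] : exists d, forall x, F x -> exists k, x = p0 + k *: d.
  have [[p1 [F1 n1]]|same] := pselect (exists p1, F p1 /\ p1 != p0).
    exists (p1 - p0) => x Fx; exists (dotr (p1 - p0) (x - p0) / dotr (p1 - p0) (p1 - p0)).
    have d0 : dotr (p1 - p0) (p1 - p0) != 0 by rewrite dotr_eq0 subr_eq0.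
    apply: (addrI (- p0)); rewrite addKr addrC.
    apply: (scalerI d0); rewrite (cross_parallel (par _ _ _ F0 F1 Fx)).
    by rewrite scalerA mulrC divfK.
  exists 0 => x Fx; exists 0; rewrite scale0r addr0; apply: contrapT => /eqP nx.
  by apply: same; exists x.
have Ad x : aff_hull F x -> exists k, x = p0 + k *: d.
  move=> [m [v [w [Fv w1 ->]]]].
  have /choice[k hk] : forall i, exists k, v i = p0 + k *: d by move=> i; apply: Fd.
  exists (\sum_i w i * k i).
  under eq_bigr => i _ do rewrite hk scalerDr scalerA.
  by rewrite big_split /= -!scaler_suml w1 scale1r.
have [k0 e0] := Ad _ (aA 0); rewrite mul0mx addr0 in e0.
have lin u : exists k, u *m B = k *: d.
  have [k ek] := Ad _ (aA u); exists (k - k0).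
  by apply: (addrI a); rewrite ek e0 -addrA -scalerDl [k0 + _]addrC subrK.
have inj (u : 'rV[R]_2) : u *m B = 0 -> u = 0.
  by move/eqP; rewrite mulmx_free_eq0 // => /eqP.
have [k1 e1] := lin (delta_mx 0 0); have [k2 e2] := lin (delta_mx 0 1).
have : (k2 *: delta_mx 0 0 - k1 *: delta_mx 0 1 : 'rV[R]_2) = 0.
  by apply: inj; rewrite mulmxBl -!scalemxAl e1 e2 !scalerA mulrC subrr.
move/rowP => h; have := h 0; have := h 1; rewrite !mxE /= !mulr0 !mulr1 subr0 sub0r.
move=> /eqP; rewrite oppr_eq0 => /eqP k1z _.
have : (delta_mx 0 0 : 'rV[R]_2) = 0 by apply: inj; rewrite e1 k1z scale0r.
by move=> /rowP/(_ 0)/eqP; rewrite !mxE /= oner_eq0.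
Qed.

Lemma dim1_points {R : realType} (e : set 'rV[R]_3) : has_dim e 1 ->
  (exists p0 p1, [/\ e p0, e p1 & p0 != p1]) /\
  (exists d p, forall x, e x -> exists k, x = p + k *: d).
Proof.
move=> [a [B [fB h]]].
have aA u : aff_hull e (a + u *m B) by rewrite h; exists u.
have inj (u : 'rV[R]_1) : u *m B = 0 -> u = 0.
  by move/eqP; rewrite mulmx_free_eq0 // => /eqP.
split; last first.
  exists (row 0 B), a => x /sub_aff_hull; rewrite h => -[u _ <-].
  exists (u 0 0); congr (_ + _).
  by apply/rowP => j; rewrite !mxE big_ord1.
have [p0 e0] := aff_hull0 (aA 0).
exists p0; apply: contrapT => no.
have same x : e x -> x = p0.
  by move=> ex; apply: contrapT => /eqP n; apply: no; exists x; rewrite eq_sym.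
have sameA x : aff_hull e x -> x = p0.
  move=> [m [v [w [ev w1 ->]]]].
  under eq_bigr => i _ do rewrite (same _ (ev i)).
  by rewrite -scaler_suml w1 scale1r.
have : (1 : 'rV[R]_1) = 0.
  apply: inj; apply: (addrI a).
  by rewrite (sameA _ (aA 1)) -(sameA _ (aA 0)) mul0mx.
by move/rowP/(_ 0)/eqP; rewrite !mxE oner_eq0.
Qed.

Lemma dim3_span {R : realType} (P : set 'rV[R]_3) c b : has_dim P 3 -> c != 0 ->
  exists2 x, P x & dotr c x != b.
Proof.
move=> [a [B [fB h]]] c0; apply: contrapT => no.
have hc x : P x -> dotr c x = b.
  by move=> Px; apply: contrapT => /eqP n; apply: no; exists x.
have aA u : dotr c (a + u *m B) = b by apply: (aff_hull_eq hc); rewrite h; exists u.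
have : c *m invmx B *m B = c by rewrite mulmxKV // -row_free_unit.
have := aA (c *m invmx B); have := aA 0; rewrite mul0mx addr0 => e0.
rewrite dotrDr e0 => e1 e2; move: e1; rewrite e2 -[RHS]addr0 => /addrI/eqP.
by rewrite dotr_eq0 (negbTE c0).
Qed.

Lemma dim2_intro {R : realType} (F : set 'rV[R]_3) c b p0 p1 p2 : c != 0 ->
  (forall x, F x -> dotr c x = b) -> F p0 -> F p1 -> F p2 ->
  cross (p1 - p0) (p2 - p0) != 0 -> has_dim F 2.
Proof.
move=> c0 hc F0 F1 F2; set d1 := p1 - p0; set d2 := p2 - p0; set N := cross d1 d2 => N0.
have NN : dotr N N != 0 by rewrite dotr_eq0.
pose B : 'M[R]_(2, 3) := \matrix_(i, j) (if i == 0 then d1 0 j else d2 0 j).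
have mulB (u : 'rV[R]_2) : u *m B = u 0 0 *: d1 + u 0 1 *: d2.
  apply/rowP => j; rewrite !mxE big_ord_recl big_ord1 !mxE /=.
  by congr (_ + u 0 _ * _); apply/val_inj.
exists p0, B; split.
  rewrite -kermx_eq0; apply/eqP/row_matrixP => i; rewrite row0.
  have : row i (kermx B) *m B = 0 by rewrite -row_mul mulmx_ker row0.
  move: (row i _) => u; rewrite mulB => e.
  have u0 : u 0 0 = 0.
    have : dotr (cross d2 N) (u 0 0 *: d1 + u 0 1 *: d2) = u 0 0 * dotr N N.
      by rewrite /N; vring.
    by rewrite e dotr0 => /eqP; rewrite eq_sym mulf_eq0 (negbTE NN) orbF => /eqP.
  have u1 : u 0 1 = 0.
    have : dotr (cross N d1) (u 0 0 *: d1 + u 0 1 *: d2) = u 0 1 * dotr N N.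
      by rewrite /N; vring.
    by rewrite e dotr0 => /eqP; rewrite eq_sym mulf_eq0 (negbTE NN) orbF => /eqP.
  apply/rowP => j; rewrite mxE; case: j => [[|[|//]] hj].
    by rewrite -u0; congr (u 0 _); apply/val_inj.
  by rewrite -u1; congr (u 0 _); apply/val_inj.
apply/seteqP; split=> x.
  move=> /(aff_hull_eq hc) cx.
  have Nx : dotr N (x - p0) = 0.
    have ec : dotr N N *: c = dotr c N *: N.
      by apply: cross_normal; rewrite dotrBr !hc // subrr.
    have := ec; move=> /(congr1 (fun y => dotr y (x - p0))); rewrite !dotrZl dotrBr cx hc //.
    rewrite subrr mulr0 => /eqP; rewrite eq_sym mulf_eq0 => /orP[/eqP cN|/eqP //].
    have : dotr N N *: c = 0.
      by rewrite ec cN scale0r.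
    by move/eqP; rewrite scaler_eq0 (negbTE NN) (negbTE c0).
  exists (\row_j (if j == 0 then det3 (x - p0) d2 N / dotr N N
                  else det3 d1 (x - p0) N / dotr N N)) => //.
  have E : dotr N N *: (x - p0) = det3 (x - p0) d2 N *: d1 + det3 d1 (x - p0) N *: d2.
    have := cramer3 d1 d2 N (x - p0).
    by rewrite -[det3 d1 d2 N]dotr_cross -[det3 d1 d2 (x - p0)]dotr_cross Nx scale0r addr0.
  rewrite mulB !mxE /= ![_ / _]mulrC -!scalerA -scalerDr -E scalerA mulVf //.
  by rewrite scale1r addrC subrK.
move=> [u _ <-]; rewrite mulB.
pose v (i : 'I_3) := if i == 0 then p0 else if i == 1 then p1 else p2.
pose w (i : 'I_3) := if i == 0 then 1 - u 0 0 - u 0 1 else if i == 1 then u 0 0 else u 0 1.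
exists 3%N, v, w; split.
- by move=> i; rewrite /v; do 2?case: ifP.
- rewrite (sum_ord3 w) /w /=; ring.
- by rewrite sum_ord3 /w /v /= /d1 /d2; vecring.
Qed.

Lemma dim1_intro {R : realType} (e : set 'rV[R]_3) p d : d != 0 ->
  e p -> (exists2 s, s != 0 & e (p + s *: d)) ->
  (forall x, e x -> exists s, x = p + s *: d) -> has_dim e 1.
Proof.
move=> d0 e0 [s0 s00 e1] h.
exists p, d; split.
  rewrite -kermx_eq0; apply/eqP/row_matrixP => i; rewrite row0.
  have : row i (kermx d) *m d = 0 by rewrite -row_mul mulmx_ker row0.
  move: (row i _) => u.
  have -> : u *m d = u 0 0 *: d by apply/rowP => j; rewrite !mxE big_ord1.
  move/eqP; rewrite scaler_eq0 (negbTE d0) orbF => /eqP u0.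
  by apply/rowP => j; rewrite ord1 u0 mxE.
apply/seteqP; split=> x.
  move=> [m [v [w [ev w1 ->]]]].
  have /choice[k hk] : forall i, exists k, v i = p + k *: d by move=> i; apply: h.
  exists (\sum_i w i * k i)%:M => //.
  under [in RHS]eq_bigr => i _ do rewrite hk scalerDr scalerA.
  by rewrite big_split /= -!scaler_suml w1 scale1r mul_scalar_mx.
move=> [u _ <-].
have -> : u *m d = u 0 0 *: d by apply/rowP => j; rewrite !mxE big_ord1.
pose v (i : 'I_2) := if i == 0 then p else p + s0 *: d.
pose w (i : 'I_2) := if i == 0 then 1 - u 0 0 / s0 else u 0 0 / s0.
exists 2%N, v, w; split.
- by move=> i; rewrite /v; case: ifP.
- by rewrite !big_ord_recl big_ord0 /w /=; ring.
- rewrite !big_ord_recl big_ord0 /w /v /= addr0 scalerDr scalerA divfK //.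
  by rewrite addrA -scalerDl subrK scale1r.
Qed.

(** Since [face] admits [c = 0], a nonempty face could be [P] itself; comparing dimensions excludes
    this. *)
Lemma face2_functional {R : realType} (P F : set 'rV[R]_3) : has_dim P 3 -> face2 P F ->
  exists c b, [/\ c != 0, forall x, P x -> dotr c x <= b &
    F = P `&` [set x | dotr c x = b]].
Proof.
move=> P3 [[c [b [hc e]]] F2]; exists c, b; split=> //.
have [p0 [p1 [p2 [F0 F1 F2' n]]]] := dim2_points F2.
apply/negP => /eqP c0; move: F0; rewrite e => -[_ /= b0].
have z x : dotr c x = 0 by rewrite c0 dotrC dotr0.
have FP : F = P.
  by rewrite e; apply/seteqP; split=> [x []//|x Px]; split=> //=; rewrite -b0 !z.
move: F2 => [a [B [fB h]]]; case: P3 => [a' [B' [fB' h']]].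
rewrite FP in h.
(* The row space of B is two-dimensional, hence cannot contain all of R^3. *)
have sub : (1%:M <= B)%MS.
  apply/rV_subP => u _.
  have [w _ ew] : [set a + u *m B | u in [set: 'rV[R]_2]] (a' + u *m invmx B' *m B').
    by rewrite -h h'; exists (u *m invmx B').
  have [w' _ ew'] : [set a + u *m B | u in [set: 'rV[R]_2]] (a' + 0 *m B').
    by rewrite -h h'; exists 0.
  apply/submxP; exists (w - w'); rewrite mulmxBl.
  move: ew'; rewrite mul0mx addr0 => ew'.
  move: ew; rewrite mulmxKV ?row_free_unit -?row_free_unit // -ew' -addrA => /addrI ->.
  by rewrite addrC addrK.
by have := mxrankS sub; rewrite mxrank1 => /leq_trans/(_ (rank_leq_row B)).
Qed.

Lemma plane_unique {R : realType} (c l p0 p1 p2 : 'rV[R]_3) b b' : c != 0 -> l != 0 ->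
  dotr c p0 = b -> dotr c p1 = b -> dotr c p2 = b ->
  dotr l p0 = b' -> dotr l p1 = b' -> dotr l p2 = b' ->
  cross (p1 - p0) (p2 - p0) != 0 -> forall x, dotr c x = b -> dotr l x = b'.
Proof.
move=> c0 l0 c1 c2 c3 l1 l2 l3; set N := cross _ _ => N0 x cx.
have NN : dotr N N != 0 by rewrite dotr_eq0.
have ec : dotr N N *: c = dotr c N *: N.
  by apply: cross_normal; rewrite dotrBr ?c1 ?c2 ?c3 subrr.
have el : dotr N N *: l = dotr l N *: N.
  by apply: cross_normal; rewrite dotrBr ?l1 ?l2 ?l3 subrr.
have cN : dotr c N != 0.
  apply: contra_neq c0 => z; apply/eqP; move/eqP: ec.
  by rewrite z scale0r scaler_eq0 (negbTE NN).
have Nx : dotr N (x - p0) = 0.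
  have := congr1 (fun y => dotr y (x - p0)) ec; rewrite !dotrZl dotrBr cx c1 subrr mulr0.
  by move/eqP; rewrite eq_sym mulf_eq0 (negbTE cN) => /eqP.
have := congr1 (fun y => dotr y (x - p0)) el; rewrite !dotrZl Nx mulr0 => /eqP.
by rewrite mulf_eq0 (negbTE NN) dotrBr l1 subr_eq0 => /eqP.
Qed.

(** * Rolls and planar motions *)

Definition e3 {R : realType} : 'rV[R]_3 := vec3 0 0 1.

(** Rotation about the vertical axis, acting on row vectors from the right. It is given by cosine
    and sine rather than by an angle, so that products and inverses stay polynomial. *)
Definition rotz {R : realType} (c s : R) : 'M[R]_3 :=
  rows3 (vec3 c s 0) (vec3 (- s) c 0) e3.

Definition planar {R : realType} (c s : R) (t x : 'rV[R]_3) : 'rV[R]_3 :=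
  t + x *m rotz c s.

Lemma mul_rotz {R : realType} (c s : R) (x : 'rV[R]_3) :
  x *m rotz c s = vec3 (c * x 0 0 - s * x 0 1) (s * x 0 0 + c * x 0 1) (x 0 2%:R).
Proof. by rewrite mul_rows3 /e3; vecring. Qed.

Lemma mx3P {R : realType} (A B : 'M[R]_3) : (forall x : 'rV[R]_3, x *m A = x *m B) -> A = B.
Proof. by move=> h; apply/row_matrixP => i; rewrite !rowE h. Qed.

Lemma rotz_mul {R : realType} (c s c' s' : R) :
  rotz c s *m rotz c' s' = rotz (c * c' - s * s') (c * s' + s * c').
Proof. by apply: mx3P => x; rewrite mulmxA !mul_rotz; vecring. Qed.

Lemma rotz10 {R : realType} : rotz 1 0 = 1%:M :> 'M[R]_3.
Proof. by apply: mx3P => x; rewrite mul_rotz mulmx1; vecring. Qed.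

Lemma tr_rotz {R : realType} (c s : R) : (rotz c s)^T = rotz c (- s).
Proof.
by apply/matrixP => i j; rewrite !mxE;
  have [->|->|->] := ord3_case i; have [->|->|->] := ord3_case j;
  rewrite /= ?mxE /= ?oppr0 ?opprK.
Qed.

Lemma rotz_orth {R : realType} (c s : R) : c ^+ 2 + s ^+ 2 = 1 ->
  rotz c s *m (rotz c s)^T = 1%:M.
Proof.
move=> h; rewrite tr_rotz rotz_mul -rotz10; congr (rotz _ _); last by ring.
by rewrite -h; ring.
Qed.

Lemma det_rotz {R : realType} (c s : R) : c ^+ 2 + s ^+ 2 = 1 -> \det (rotz c s) = 1.
Proof. by move=> h; rewrite det_rows3 -h /e3; vring. Qed.

Lemma planar_z {R : realType} (c s : R) (t x : 'rV[R]_3) : t 0 2%:R = 0 ->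
  planar c s t x 0 2%:R = x 0 2%:R.
Proof. by move=> t0; rewrite /planar mul_rotz addE vec3E t0 add0r. Qed.

Lemma planar_inv {R : realType} (c s : R) (t : 'rV[R]_3) : c ^+ 2 + s ^+ 2 = 1 ->
  cancel (planar c s t) (planar c (- s) (- t *m rotz c (- s))).
Proof.
move=> h x; rewrite /planar mulmxDl addrA mulNmx addNr add0r.
by rewrite -mulmxA -tr_rotz rotz_orth // mulmx1.
Qed.

Lemma planar_invr {R : realType} (c s : R) (t : 'rV[R]_3) : c ^+ 2 + s ^+ 2 = 1 ->
  cancel (planar c (- s) (- t *m rotz c (- s))) (planar c s t).
Proof.
move=> h x; rewrite /planar mulmxDl addrA -mulmxA rotz_mul.
have -> : rotz (c * c - - s * s) (c * s + - s * c) = 1%:M.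
  by rewrite -rotz10; congr rotz; rewrite -?h; ring.
rewrite mulmx1 subrr add0r -mulmxA rotz_mul -[in RHS](mulmx1 x) -rotz10.
by congr (_ *m rotz _ _); rewrite -?h; ring.
Qed.

Lemma embedE {R : realType} (p : 'rV[R]_2) : embed p = vec3 (p 0 0) (p 0 1) 0.
Proof.
apply: row3P; rewrite vec3E /embed mxE; case: splitP => k //= e.
- by congr (p 0 _); apply/val_inj.
- by congr (p 0 _); apply/val_inj.
- by case: k e => [[|[|]]].
- by rewrite mxE.
Qed.

Lemma groundP {R : realType} (x : 'rV[R]_3) : @ground R x <-> x 0 2%:R = 0.
Proof.
split=> [[p _ <-]|x0]; first by rewrite embedE vec3E.
exists (\row_j (if j == 0 then x 0 0 else x 0 1)) => //.
by rewrite embedE !mxE /= -x0; apply: row3P; rewrite vec3E.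
Qed.

Lemma upperP {R : realType} (x : 'rV[R]_3) : @upper_half R x <-> 0 <= x 0 2%:R.
Proof. by rewrite /upper_half /= ord3_max. Qed.

Lemma ground_sub {R : realType} (g : 'rV[R]_3 -> 'rV[R]_3) (F : set 'rV[R]_3) :
  g @` F `<=` @ground R <-> (forall x, F x -> g x 0 2%:R = 0).
Proof.
split=> [h x Fx|h _ [x Fx <-]]; first by apply/groundP/h; exists x.
exact/groundP/h.
Qed.

Lemma upper_sub {R : realType} (g : 'rV[R]_3 -> 'rV[R]_3) (P : set 'rV[R]_3) :
  g @` P `<=` @upper_half R <-> (forall x, P x -> 0 <= g x 0 2%:R).
Proof.
split=> [h x Fx|h _ [x Fx <-]]; first by apply/upperP/h; exists x.
exact/upperP/h.
Qed.

Definition rigid {R : realType} (g : 'rV[R]_3 -> 'rV[R]_3) : Prop :=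
  exists t M, [/\ M *m M^T = 1%:M, \det M = 1 & forall x, g x = t + x *m M].

Lemma rigid_comp {R : realType} (g h : 'rV[R]_3 -> 'rV[R]_3) :
  rigid g -> rigid h -> rigid (g \o h).
Proof.
move=> [t [M [oM dM eM]]] [u [N [oN dN eN]]].
exists (t + u *m M), (N *m M); split.
- by rewrite trmx_mul mulmxA -(mulmxA N) oM mulmx1.
- by rewrite det_mulmx dM dN mulr1.
- by move=> x; rewrite /= eM eN mulmxDl addrA mulmxA.
Qed.

Lemma rotation_rigid {R : realType} (L : set 'rV[R]_3) rho :
  rotation_about L rho -> rigid rho.
Proof.
move=> [a [M [_ oM dM e _]]]; exists (a - a *m M), M; split=> // x.
by rewrite e mulmxBl addrCA addrA [_ + a]addrC addrAC.
Qed.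

Lemma reachable_inv {R : realType} (P : set 'rV[R]_3) g F :
  P `<=` @upper_half R -> reachable P g F ->
  [/\ face2 P F, forall x, F x -> g x 0 2%:R = 0, forall x, P x -> 0 <= g x 0 2%:R
    & rigid g].
Proof.
move=> Pu; elim=> {g F} [F FP Fg|g F e F' rho _ [_ _ _ rg] _ _ FP _ _ rr gF gP].
  split=> // [x /Fg/groundP //|x /Pu/upperP //|].
  by exists 0, 1%:M; split=> [||x]; rewrite ?trmx1 ?mul1mx ?det1 // mulmx1 add0r.
split=> //; first exact/ground_sub; first exact/upper_sub.
exact: rigid_comp (rotation_rigid rr) rg.
Qed.

(** The height after [g] is a nonconstant affine function vanishing on three non-collinear points of
    [F], so its zero plane is the supporting plane of [F]. The supporting facet is thus determined
    by the position. *)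
Lemma facet_height {R : realType} (P F : set 'rV[R]_3) g :
  has_dim P 3 -> face2 P F -> rigid g -> (forall x, F x -> g x 0 2%:R = 0) ->
  F = P `&` [set x | g x 0 2%:R = 0].
Proof.
move=> P3 FP [t [M [oM dM eM]]] gF.
have [c [b [c0 hc eF]]] := face2_functional P3 FP.
have [p0 [p1 [p2 [F0 F1 F2 n]]]] := dim2_points FP.2.
pose l : 'rV[R]_3 := e3 *m M^T.
have gz x : g x 0 2%:R = t 0 2%:R + dotr l x.
  rewrite eM addE; congr (_ + _); rewrite /l dotr_adj trmxK dotrC dotr3 /e3 !vec3E.
  by rewrite !mulr0 !add0r mulr1.
have l0 : l != 0.
  rewrite -dotr_eq0 dotr_orth ?trmxK ?(mulmx1C oM) // /e3 dotr3 !vec3E.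
  by rewrite !mulr0 !add0r mulr1 oner_eq0.
have lF x : F x -> dotr l x = - t 0 2%:R.
  by move=> /gF; rewrite gz addrC => /eqP; rewrite addr_eq0 => /eqP.
have cF x : F x -> dotr c x = b by rewrite eF => -[].
apply/seteqP; split=> x.
  by move=> Fx; split; [by move: Fx; rewrite eF => -[]|exact: gF].
move=> [Px /= gx0]; rewrite eF; split=> //=.
apply: (plane_unique l0 c0 (lF _ F0) (lF _ F1) (lF _ F2) (cF _ F0) (cF _ F1) (cF _ F2) n).
by move/eqP: gx0; rewrite gz addrC addr_eq0 => /eqP.
Qed.

(** [reach_start] accepts any facet in the ground; inductions that start from different facets can
    be joined because there is only one. *)
Lemma start_unique {R : realType} (P F F' : set 'rV[R]_3) : has_dim P 3 ->
  face2 P F -> F `<=` @ground R -> face2 P F' -> F' `<=` @ground R -> F = F'.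
Proof.
move=> P3 FP Fg FP' Fg'.
have ri : rigid (id : 'rV[R]_3 -> 'rV[R]_3).
  by exists 0, 1%:M; split=> [||x]; rewrite ?trmx1 ?mul1mx ?det1 // mulmx1 add0r.
rewrite (facet_height P3 FP ri) => [|x /Fg/groundP //].
by rewrite -(facet_height P3 FP' ri) // => x /Fg'/groundP.
Qed.

Definition roll {R : realType} (P : set 'rV[R]_3)
    (g : 'rV[R]_3 -> 'rV[R]_3) (F : set 'rV[R]_3)
    (g' : 'rV[R]_3 -> 'rV[R]_3) (F' : set 'rV[R]_3) : Prop :=
  exists (e : set 'rV[R]_3) (rho : 'rV[R]_3 -> 'rV[R]_3),
    [/\ edge P e, e `<=` F, F' <> F, e `<=` F' &
    [/\ rotation_about (aff_hull (g @` e)) rho, g' = rho \o g,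
      forall x, F' x -> g' x 0 2%:R = 0 & forall x, P x -> 0 <= g' x 0 2%:R]].

Lemma reachable_roll {R : realType} (P : set 'rV[R]_3) g F g' F' :
  reachable P g F -> face2 P F' -> roll P g F g' F' -> reachable P g' F'.
Proof.
move=> r FP' [e [rho [eP eF n eF' [rr -> gF gP]]]].
by apply: reach_roll r eP eF FP' n eF' rr _ _; [exact/ground_sub|exact/upper_sub].
Qed.

Lemma rotation_inv {R : realType} (L : set 'rV[R]_3) rho : rotation_about L rho ->
  exists2 rho', rotation_about L rho' & cancel rho rho'.
Proof.
move=> [a [M [La oM dM e fx]]].
have rK : cancel rho (fun x => a + (x - a) *m M^T).
  by move=> x; rewrite e addrAC subrr add0r -mulmxA oM mulmx1 addrC subrK.
exists (fun x => a + (x - a) *m M^T) => //.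
exists a, M^T; split=> //; rewrite ?trmxK ?det_tr ?(mulmx1C oM) //.
by move=> x Lx; rewrite -{1}(fx x Lx) rK.
Qed.

(** The inverse rotation has the same axis, and that axis is also spanned by the edge in the new
    position, since the roll fixes the edge pointwise. *)
Lemma roll_sym {R : realType} (P : set 'rV[R]_3) (g : 'rV[R]_3 -> 'rV[R]_3)
    (F : set 'rV[R]_3) g' F' :
  (forall x, F x -> g x 0 2%:R = 0) -> (forall x, P x -> 0 <= g x 0 2%:R) ->
  roll P g F g' F' -> roll P g' F' g F.
Proof.
move=> gF gP [e [rho [eP eF n eF' [rr -> gF' gP']]]].
have [rho' rr' rK] := rotation_inv rr.
exists e, rho'; split=> //; first by apply/nesym.
split=> //; last by apply/funext => x /=; rewrite rK.
have -> : (rho \o g) @` e = g @` e.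
  have fx x : e x -> rho (g x) = g x.
    by move=> ex; case: rr => [a [M [_ _ _ _]]]; apply; apply: sub_aff_hull; exists x.
  by apply/seteqP; split=> _ [x ex <-]; exists x; rewrite //= fx.
exact: rr'.
Qed.

Lemma planar_aff {R : realType} (c s : R) (t : 'rV[R]_3) m (w : 'I_m -> R)
    (v : 'I_m -> 'rV[R]_3) : \sum_i w i = 1 ->
  planar c s t (\sum_i w i *: v i) = \sum_i w i *: planar c s t (v i).
Proof.
move=> w1; rewrite /planar; under [in RHS]eq_bigr => i _ do rewrite scalerDr.
rewrite big_split /= -scaler_suml w1 scale1r mulmx_suml; congr (_ + _).
by apply: eq_bigr => i _; rewrite scalemxAl.
Qed.

Lemma aff_hull_planar {R : realType} (c s : R) (t : 'rV[R]_3) (S : set 'rV[R]_3) :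
  aff_hull (planar c s t @` S) = planar c s t @` aff_hull S.
Proof.
apply/seteqP; split=> x.
  move=> [m [v [w [Sv w1 ->]]]].
  have /choice[u hu] : forall i, exists u, S u /\ planar c s t u = v i.
    by move=> i; have [u Su <-] := Sv i; exists u.
  exists (\sum_i w i *: u i); first by exists m, u, w; split=> // i; have [] := hu i.
  by rewrite planar_aff //; apply: eq_bigr => i _; have [_ ->] := hu i.
move=> [_ [m [v [w [Sv w1 ->]]]] <-].
exists m, (fun i => planar c s t (v i)), w; split=> //.
  by move=> i; exists (v i).
by rewrite planar_aff.
Qed.

(** The rotation is conjugated by the planar motion; its axis moves along, and heights do not
    change. *)
Lemma roll_planar {R : realType} (P : set 'rV[R]_3) g F g' F' (c s : R) (t : 'rV[R]_3) :
  c ^+ 2 + s ^+ 2 = 1 -> t 0 2%:R = 0 ->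
  roll P g F g' F' -> roll P (planar c s t \o g) F (planar c s t \o g') F'.
Proof.
move=> cs t0 [e [rho [eP eF n eF' [[a [M [La oM dM er fx]]] -> gF' gP']]]].
set h := planar c s t; set Z := rotz c s.
have oZ : Z *m Z^T = 1%:M := rotz_orth cs.
have hB x y : h x - h y = (x - y) *m Z.
  by rewrite /h /planar opprD addrACA subrr add0r mulmxBl.
have hr x : h a + (h x - h a) *m (Z^T *m M *m Z) = h (rho x).
  rewrite hB !mulmxA -(mulmxA (x - a)) oZ mulmx1 er.
  by rewrite /h /planar (mulmxDl a) addrA.
exists e, (fun y => h a + (y - h a) *m (Z^T *m M *m Z)); split=> //; split.
- exists (h a), (Z^T *m M *m Z).
  rewrite -image_comp /h aff_hull_planar -/h.
  split=> //.
  + rewrite !trmx_mul trmxK !mulmxA -(mulmxA _ Z) oZ mulmx1.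
    by rewrite -(mulmxA _ M) oM mulmx1 (mulmx1C oZ).
  + by rewrite !det_mulmx det_tr dM (det_rotz cs) !mulr1.
  + by move=> _ [x Lx <-]; rewrite hr fx.
- by apply/funext => x /=; rewrite hr.
- by move=> x /gF' /=; rewrite planar_z.
- by move=> x /gP' /=; rewrite planar_z.
Qed.

(* Undo the rolls leading to g0 from the position planar c s t \o g0; this reaches the
   moved initial position, from which all moved rolls can be performed. *)
Lemma reachable_planar {R : realType} (P : set 'rV[R]_3) g0 F0 (c s : R) (t : 'rV[R]_3) :
  has_dim P 3 -> P `<=` @upper_half R ->
  c ^+ 2 + s ^+ 2 = 1 -> t 0 2%:R = 0 ->
  reachable P g0 F0 -> reachable P (planar c s t \o g0) F0 ->
  forall g F, reachable P g F -> reachable P (planar c s t \o g) F.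
Proof.
move=> P3 Pu cs t0 r0 rh0.
have down : exists2 F, face2 P F /\ F `<=` @ground R & reachable P (planar c s t) F.
  elim: r0 rh0 => [F FP Fg|g F e F' rho rg IH eP eF FP' n eF' rr gF' gP'] rh.
    by exists F.
  apply: IH; have [FP gF gP _] := reachable_inv Pu rg.
  apply: (reachable_roll rh FP); apply: roll_planar => //.
  apply: roll_sym => //; exists e, rho; split=> //; split=> //.
    exact/ground_sub.
  exact/upper_sub.
have [F1 [FP1 Fg1] r1] := down.
move=> g F; elim=> {g F} [F FP Fg|g F e F' rho rg IH eP eF FP' n eF' rr gF' gP'].
  by rewrite (start_unique P3 FP Fg FP1 Fg1).
apply: (reachable_roll IH FP'); apply: roll_planar => //.
exists e, rho; split=> //; split=> //; first exact/ground_sub.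
exact/upper_sub.
Qed.

Definition trace_motion {R : realType} (P : set 'rV[R]_3) (h : 'rV[R]_3 -> 'rV[R]_3) :=
  forall g F, reachable P g F -> reachable P (h \o g) F.

(** By [reachable_planar] one instance is enough, and the inverse motion carries the reachable
    position [planar c s t \o g] back to [g]. *)
Lemma trace_motion_inv {R : realType} (P : set 'rV[R]_3) (c s : R) (t : 'rV[R]_3) :
  has_dim P 3 -> P `<=` @upper_half R -> (exists g F, reachable P g F) ->
  c ^+ 2 + s ^+ 2 = 1 -> t 0 2%:R = 0 ->
  trace_motion P (planar c s t) ->
  trace_motion P (planar c (- s) (- t *m rotz c (- s))).
Proof.
move=> P3 Pu [g [F r]] cs t0 hm.
apply: (reachable_planar P3 Pu _ _ (hm _ _ r)); rewrite ?sqrrN //.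
  by rewrite mul_rotz vec3E oppE t0 oppr0.
by have -> : planar c (- s) (- t *m rotz c (- s)) \o (planar c s t \o g) = g;
  first by apply/funext => x /=; rewrite planar_inv.
Qed.

(** * Rolling around a vertex *)

(** The vertex figure of [v]: the directions to the other points of [V], scaled into the affine
    plane [dotr n = 1]. *)
Definition link {R : realType} (V : seq 'rV[R]_3) (n v : 'rV[R]_3) : seq 'rV[R]_3 :=
  [seq (dotr n (w - v))^-1 *: (w - v) | w <- V & w != v].

Definition side_facet {R : realType} (P : set 'rV[R]_3) (v a b : 'rV[R]_3) :
  set 'rV[R]_3 := P `&` [set x | det3 a b (x - v) = 0].

Lemma conv_sub_aff {R : realType} n (S : set 'rV[R]_n) : conv_hull S `<=` aff_hull S.
Proof. by move=> x [m [v [w [? ? ? ->]]]]; exists m, v, w. Qed.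

Lemma aff_line {R : realType} n (S : set 'rV[R]_n) p d :
  (forall x, S x -> exists k, x = p + k *: d) ->
  forall x, aff_hull S x -> exists k, x = p + k *: d.
Proof.
move=> h x [m [v [w [Sv w1 ->]]]].
have /choice[k hk] : forall i, exists k, v i = p + k *: d by move=> i; apply: h.
exists (\sum_i w i * k i).
under eq_bigr => i _ do rewrite hk scalerDr scalerA.
by rewrite big_split /= -!scaler_suml w1 scale1r.
Qed.

Lemma mem_link {R : realType} (V : seq 'rV[R]_3) (n v w : 'rV[R]_3) :
  (forall w, w \in V -> w != v -> 0 < dotr n (w - v)) ->
  w \in V -> w != v -> exists u k, [/\ u \in link V n v, 0 < k & w = v + k *: u].
Proof.
move=> hn wV wv; exists ((dotr n (w - v))^-1 *: (w - v)), (dotr n (w - v)).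
split; [|exact: hn|]; first by apply/mapP; exists w; rewrite // mem_filter wv.
by rewrite scalerA divff ?gt_eqF ?hn // scale1r addrC subrK.
Qed.

Lemma link_mem {R : realType} (V : seq 'rV[R]_3) (n v u : 'rV[R]_3) :
  (forall w, w \in V -> w != v -> 0 < dotr n (w - v)) ->
  u \in link V n v -> exists2 k, 0 < k & v + k *: u \in V.
Proof.
move=> hn /mapP[w]; rewrite mem_filter => /andP[wv wV] ->.
exists (dotr n (w - v)); first exact: hn.
by rewrite scalerA divff ?gt_eqF ?hn // scale1r addrC subrK.
Qed.

Lemma link_height {R : realType} (V : seq 'rV[R]_3) (n v u : 'rV[R]_3) :
  (forall w, w \in V -> w != v -> 0 < dotr n (w - v)) ->
  u \in link V n v -> dotr n u = 1.
Proof.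
move=> hn /mapP[w]; rewrite mem_filter => /andP[wv wV] ->.
by rewrite dotrZr mulVf // gt_eqF // hn.
Qed.

Lemma link_span {R : realType} (V : seq 'rV[R]_3) (n v c : 'rV[R]_3) :
  has_dim (conv_hull [set` V]) 3 ->
  (forall w, w \in V -> w != v -> 0 < dotr n (w - v)) ->
  c != 0 -> exists2 w, w \in link V n v & dotr c w != 0.
Proof.
move=> P3 hn c0; apply: contrapT => no.
have [x Px] := dim3_span (dotr c v) P3 c0; apply/negP; rewrite negbK; apply/eqP.
apply: aff_hull_eq (conv_sub_aff Px) => y /= yV.
have [->//|yv] := eqVneq y v; have [u [k [uL k0 ->]]] := mem_link hn yV yv.
rewrite dotrDr dotrZr; have -> : dotr c u = 0; last by rewrite mulr0 addr0.
by apply: contrapT => /eqP cu; apply: no; exists u.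
Qed.

Lemma side_ge0 {R : realType} (V : seq 'rV[R]_3) (n v a b x : 'rV[R]_3) :
  (forall w, w \in V -> w != v -> 0 < dotr n (w - v)) ->
  hull_side (link V n v) a b -> conv_hull [set` V] x -> 0 <= det3 a b (x - v).
Proof.
move=> hn [_ _ _ h] Px.
rewrite -dotr_cross dotrBr subr_ge0 -lerN2 -!dotrNl.
apply: (conv_hull_le _ Px) => y /= yV.
have [->//|yv] := eqVneq y v; have [u [k [uL k0 ->]]] := mem_link hn yV yv.
rewrite dotrDr gerDl dotrNl dotrZr dotr_cross oppr_le0 mulr_ge0 ?(ltW k0) //.
by have [] := h u uL.
Qed.

Lemma side_facet_face2 {R : realType} (V : seq 'rV[R]_3) (n v a b : 'rV[R]_3) :
  v \in V -> (forall w, w \in V -> w != v -> 0 < dotr n (w - v)) ->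
  hull_side (link V n v) a b ->
  face2 (conv_hull [set` V]) (side_facet (conv_hull [set` V]) v a b).
Proof.
move=> vV hn s; have [aL bL ab h] := s.
have c0 : cross a b != 0 by apply: (@cross_neq0 _ n); rewrite ?(link_height hn).
have e x : (det3 a b (x - v) = 0) <-> (dotr (- cross a b) x = dotr (- cross a b) v).
  rewrite -dotr_cross dotrBr !dotrNl; split=> [/eqP|/oppr_inj ->]; rewrite ?subrr //.
  by rewrite subr_eq0 => /eqP ->.
split.
  exists (- cross a b), (dotr (- cross a b) v); split.
    move=> x /(side_ge0 hn s); rewrite -dotr_cross dotrBr subr_ge0 !dotrNl.
    by rewrite lerN2.
  by apply/seteqP; split=> x [Px /e xe].
have [k k0 kV] := link_mem hn aL; have [l l0 lV] := link_mem hn bL.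
apply: (@dim2_intro _ _ (- cross a b) (dotr (- cross a b) v) v (v + k *: a) (v + l *: b)).
- by rewrite oppr_eq0.
- by move=> x [_ /e].
- by split; [exact: sub_conv_hull|rewrite /= subrr; vring].
- by split; [exact: sub_conv_hull|rewrite /= addrC addKr det3Zr det3_lrl mulr0].
- by split; [exact: sub_conv_hull|rewrite /= addrC addKr det3Zr det3_lrr mulr0].
rewrite [v + _]addrC [v + _]addrC !addrK.
have -> : cross (k *: a) (l *: b) = (k * l) *: cross a b by vecring.
by rewrite scaler_eq0 negb_or c0 mulf_neq0 ?gt_eqF.
Qed.

(** The sum [f] of the outer normals of two adjacent facets is maximal exactly on their
    intersection. The corner at [b] being strict, this intersection meets the cone at [v] only in
    the ray of [b]. *)
Lemma corner_edge {R : realType} (V : seq 'rV[R]_3) (n v a b c : 'rV[R]_3) :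
  let P := conv_hull [set` V] in
  v \in V -> (forall w, w \in V -> w != v -> 0 < dotr n (w - v)) ->
  hull_side (link V n v) a b -> hull_side (link V n v) b c -> 0 < det3 a b c ->
  exists e : set 'rV[R]_3, [/\ edge P e, e v, e `<=` side_facet P v a b,
    e `<=` side_facet P v b c & forall x, e x -> exists k, x = v + k *: b].
Proof.
move=> P vV hn s s' d; have [aL bL _ h] := s; have [_ cL _ h'] := s'.
pose f := - (cross a b + cross b c).
have fE x : dotr f (x - v) = - (det3 a b (x - v) + det3 b c (x - v)).
  by rewrite /f dotrNl dotrDl !dotr_cross.
pose e := P `&` [set x | dotr f x = dotr f v].
have eE x : e x -> det3 a b (x - v) = 0 /\ det3 b c (x - v) = 0.
  move=> [Px /= fx]; have := side_ge0 hn s Px; have := side_ge0 hn s' Px.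
  have : dotr f (x - v) = 0 by rewrite dotrBr fx subrr.
  by rewrite fE; split; lra.
have fle x : P x -> dotr f x <= dotr f v.
  move=> Px; rewrite -subr_le0 -dotrBr fE oppr_le0.
  by rewrite addr_ge0 // (side_ge0 hn).
have ev : e v by split=> //; apply: sub_conv_hull.
have line x : e x -> exists k, x = v + k *: b.
  move=> [Px fx].
  have fV y : [set` V] y -> dotr f y <= dotr f v by move=> ?; apply/fle/sub_conv_hull.
  apply: aff_line (conv_sub_aff (conv_hull_face fV Px fx)) => y [/= yV fy].
  have [->|yv] := eqVneq y v; first by exists 0; rewrite scale0r addr0.
  have [u [k [uL k0 yE]]] := mem_link hn yV yv.
  have [|d1 d2] := eE y; first by split=> //; apply: sub_conv_hull.
  have yu : y - v = k *: u by rewrite yE addrC addKr.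
  have [d1' d2'] : det3 a b u = 0 /\ det3 b c u = 0.
    by move: d1 d2; rewrite yu !det3Zr => /eqP + /eqP; rewrite !mulf_eq0 gt_eqF //=
      => /eqP + /eqP.
  have [_ /(_ d2')[t [_ _ ut]]] := h' u uL.
  have t0 : t = 0.
    apply/eqP; move/eqP: d1'; rewrite ut det3Dr !det3Zr det3_lrr mulr0 add0r.
    by rewrite mulf_eq0 [det3 a b c == 0]gt_eqF // orbF.
  by exists k; rewrite yE ut t0 subr0 scale1r scale0r addr0.
exists e; split=> //.
- split; first by exists f, (dotr f v).
  have [k k0 kV] := link_mem hn bL.
  have nb : b != 0.
    by apply/eqP => b0; have := link_height hn bL; rewrite b0 dotr0 => /eqP;
      rewrite eq_sym oner_eq0.
  apply: (@dim1_intro _ _ v b) => //.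
  exists k; first by rewrite gt_eqF.
  split; first exact: sub_conv_hull.
  rewrite /= dotrDr dotrZr; have -> : dotr f b = 0; last by rewrite mulr0 addr0.
  by rewrite /f dotrNl dotrDl !dotr_cross det3_lrr det3_lrl addr0 oppr0.
- by move=> x ex; split; [case: ex|have [] := eE x ex].
- by move=> x ex; split; [case: ex|have [] := eE x ex].
Qed.

(** The facet plane meets the plane [dotr n = 1] in a line after translating [v] to the origin. The
    two extreme link points on that line are the ends of the side. *)
Lemma facet_side {R : realType} (V : seq 'rV[R]_3) (n v : 'rV[R]_3) (F : set 'rV[R]_3) :
  let P := conv_hull [set` V] in
  has_dim P 3 -> v \in V -> (forall w, w \in V -> w != v -> 0 < dotr n (w - v)) ->
  face2 P F -> F v ->
  exists a b, hull_side (link V n v) a b /\ F = side_facet P v a b.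
Proof.
move=> P P3 vV hn FP Fv.
have [c [b [c0 hc eF]]] := face2_functional P3 FP.
have cv : dotr c v = b by move: Fv; rewrite eF => -[].
have cL u : u \in link V n v -> dotr c u <= 0.
  move=> uL; have [k k0 kV] := link_mem hn uL.
  have : dotr c (v + k *: u) <= b by apply/hc/sub_conv_hull.
  by rewrite dotrDr cv gerDl dotrZr pmulr_rle0.
pose LF := [seq u <- link V n v | dotr c u == 0].
(* A coordinate along the line common to the planes [dotr n = 1] and [dotr c = 0]. If it took a
   single value on [LF], the whole facet would lie on one line through [v]. *)
pose d u := det3 n c u.
have [u1 [u2 [u1L u2L d12]]] : exists u1 u2, [/\ u1 \in LF, u2 \in LF & d u1 != d u2].
  apply: contrapT => same.
  have [p0 [p1 [p2 [F0 F1 F2]]]] := dim2_points FP.2; apply/negP; rewrite negbK.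
  have [w Fw] : exists w, forall x, F x -> exists k, x = v + k *: w.
    have fV y : [set` V] y -> dotr c y <= b by move=> ?; apply/hc/sub_conv_hull.
    have [w hw] : exists w, forall u, u \in LF -> u = w.
      case E : LF => [|w l]; first by exists 0.
      exists w => u; rewrite -E => uL.
      have wL : w \in LF by rewrite E mem_head.
      have := uL; have := wL; rewrite !mem_filter => /andP[/eqP cw wL'] /andP[/eqP cu uL'].
      have duw : d u = d w.
        by apply: contrapT => /eqP ne; apply: same; exists u, w.
      have N0 : cross n c != 0.
        apply: contraNneq c0 => N0; have : cross n (cross n c) = 0 by rewrite N0; vecring.
        have -> : cross n (cross n c) = dotr n c *: n - dotr n n *: c by vecring.
        move=> /(congr1 (fun x => dotr x u)); rewrite dotrBl !dotrZl cu mulr0 subr0.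
        rewrite (link_height hn uL') mulr1 [RHS]dotrC dotr0 => nc.
        have := lagrange n c; rewrite N0 dotr0 nc expr0n subr0 => /eqP.
        rewrite eq_sym mulf_eq0 !dotr_eq0 => /orP[/eqP n0|//].
        have := link_height hn uL'; rewrite n0 dotrC dotr0 => /eqP.
        by rewrite eq_sym oner_eq0.
      apply/eqP; rewrite -subr_eq0; apply/eqP.
      have : dotr (cross n c) (cross n c) *: (u - w) = dotr (u - w) (cross n c) *: cross n c.
        apply: cross_normal; rewrite dotrC dotrBr ?cu ?cw ?subrr //.
        by rewrite !(link_height hn) // subrr.
      rewrite [dotr (u - w) _]dotrC [dotr _ (u - w)]dotrBr ![dotr _ u]dotr_cross
        ![dotr _ w]dotr_cross.
      rewrite -/(d u) -/(d w) duw subrr scale0r.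
      by move/eqP; rewrite scaler_eq0 dotr_eq0 (negbTE N0) => /eqP.
    exists w => x; rewrite eF => -[Px cx].
    apply: aff_line (conv_sub_aff (conv_hull_face fV Px cx)) => y [/= yV cy].
    have [->|yv] := eqVneq y v; first by exists 0; rewrite scale0r addr0.
    have [u [k [uL k0 yE]]] := mem_link hn yV yv.
    exists k; rewrite yE (hw u) // mem_filter uL andbT; move/eqP: cy.
    by rewrite yE dotrDr cv -[X in _ == X]addr0 (inj_eq (addrI _)) dotrZr mulf_eq0 gt_eqF.
  have [k0 ->] := Fw _ F0; have [k1 ->] := Fw _ F1; have [k2 ->] := Fw _ F2.
  by apply/eqP; vecring.
have [m1 m1L hm1] := seq_argmin d u1L.
have [m2 m2L hm2] := seq_argmin (fun u => - d u) u1L.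
have dm : d m1 < d m2.
  have l1 := hm1 _ u1L; have l2 := hm1 _ u2L.
  have := hm2 _ u1L; have := hm2 _ u2L; rewrite !lerN2 => l3 l4.
  rewrite lt_neqAle (le_trans l1 l4) andbT; apply: contra_neq d12 => e.
  by apply/eqP; rewrite eq_le; apply/andP; split; lra.
have := m1L; have := m2L; rewrite !mem_filter => /andP[/eqP c2 m2L'] /andP[/eqP c1 m1L'].
have m12 : m1 != m2 by apply: contraTneq dm => ->; rewrite ltxx.
have N0 : cross n c != 0.
  apply: contraTneq dm => N0; rewrite -leNgt /d -!dotr_cross N0.
  by rewrite dotrC dotr0 dotrC dotr0.
have seg u : u \in link V n v -> dotr c u = 0 ->
    exists s, [/\ 0 <= s, s <= 1 & u = (1 - s) *: m1 + s *: m2].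
  move=> uL cu; have uF : u \in LF by rewrite mem_filter cu eqxx.
  have l1 := hm1 _ uF; have := hm2 _ uF; rewrite lerN2 => l2.
  exists ((d u - d m1) / (d m2 - d m1)).
  have dd : 0 < d m2 - d m1 by rewrite subr_gt0.
  split; [by rewrite divr_ge0 ?subr_ge0 // ltW|by rewrite ler_pdivrMr // mul1r lerD2r|].
  set s := _ / _; have sE : s * (d m2 - d m1) = d u - d m1 by rewrite divfK // gt_eqF.
  apply/eqP; rewrite -subr_eq0; set z := _ - _.
  have nz : dotr n z = 0.
    by rewrite /z dotrBr dotrDr !dotrZr !(link_height hn) // !mulr1 subrK subrr.
  have cz : dotr c z = 0 by rewrite /z dotrBr dotrDr !dotrZr cu c1 c2 !mulr0 addr0 subrr.
  have dz : det3 n c z = 0.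
    have -> : det3 n c z = d u - d m1 - s * (d m2 - d m1) by rewrite /z /d; vring.
    by rewrite sE subrr.
  have : dotr (cross n c) (cross n c) *: z = dotr z (cross n c) *: cross n c.
    by apply: cross_normal; rewrite dotrC.
  rewrite [dotr z _]dotrC [dotr _ z]dotr_cross dz scale0r => /eqP.
  by rewrite scaler_eq0 dotr_eq0 (negbTE N0).
pose C := cross m1 m2.
have C0 : C != 0 by apply: (@cross_neq0 _ n); rewrite ?(link_height hn).
have CC : 0 < dotr C C by rewrite dotr_gt0.
have cE : dotr C C *: c = dotr c C *: C by apply: cross_normal.
have cC0 : dotr c C != 0.
  apply: contraNneq c0 => z; move/eqP: cE; rewrite z scale0r scaler_eq0 dotr_eq0.
  by rewrite (negbTE C0).
have cu u : dotr C C * dotr c u = dotr c C * det3 m1 m2 u.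
  by rewrite -dotrZl cE dotrZl dotr_cross.
have eF' : F = P `&` [set x | det3 m1 m2 (x - v) = 0].
  rewrite eF; apply/seteqP; split=> x [Px /= cx]; split=> //=.
    apply: (mulfI cC0); rewrite mulr0 -cu dotrBr cx cv subrr mulr0 //.
  apply/eqP; rewrite -cv -subr_eq0 -dotrBr; apply/eqP/(mulfI (lt0r_neq0 CC)).
  by rewrite cu cx !mulr0.
have iff u : det3 m1 m2 u = 0 -> dotr c u = 0.
  by move=> z; apply: (mulfI (lt0r_neq0 CC)); rewrite cu z !mulr0.
(* The sign decides the orientation: the cross product of the two ends in order must point into the
   polytope, against the outer normal [c]. *)
have [cC|cC] : dotr c C < 0 \/ 0 < dotr c C.
  by move: cC0; rewrite neq_lt => /orP.
- exists m1, m2; split=> //; split=> // u uL; split; last by move/iff/(seg u uL).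
  have := cL u uL; rewrite -(pmulr_rle0 _ CC) cu => h.
  by rewrite -oppr_le0 -(pmulr_rle0 _ (x := - dotr c C)) ?oppr_gt0 // mulrNN.
- exists m2, m1; split.
    split=> //; [by rewrite eq_sym|move=> u uL].
    rewrite det3_swap; split.
      by rewrite oppr_ge0 -(pmulr_rle0 _ cC) -cu (pmulr_rle0 _ CC) cL.
    move/eqP; rewrite oppr_eq0 => /eqP/iff/(seg u uL)[s [s0 s1 ->]].
    exists (1 - s); split; [lra|lra|by rewrite subKr addrC].
  rewrite eF'; apply/seteqP; split=> x [Px /= e]; split=> //=.
    by rewrite det3_swap e oppr0.
  by rewrite det3_swap e oppr0.
Qed.

(** * Standard positions of a facet and the rolls between them *)

Definition unitv {R : realType} (u : 'rV[R]_3) : 'rV[R]_3 := (enorm u)^-1 *: u.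

(** An orthonormal positive basis adapted to the facet spanned by [a] and [b]. Its transpose lays
    that facet flat, with [a] along the first axis, [b] at the angle [ang a b] from it, and the
    normal [cross a b] upwards. *)
Definition frame {R : realType} (a b : 'rV[R]_3) : 'M[R]_3 :=
  rows3 (unitv a) (cross (unitv (cross a b)) (unitv a)) (unitv (cross a b)).

Lemma unitv1 {R : realType} (u : 'rV[R]_3) : u != 0 -> dotr (unitv u) (unitv u) = 1.
Proof.
move=> u0; rewrite dotrZl dotrZr -enorm_sqr expr2 mulKf ?mulVf //;
by rewrite gt_eqF // enorm_gt0.
Qed.

Lemma rows3_orth {R : realType} (p q : 'rV[R]_3) :
  dotr p p = 1 -> dotr q q = 1 -> dotr p q = 0 ->
  rows3 p (cross q p) q *m (rows3 p (cross q p) q)^T = 1%:M /\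
  \det (rows3 p (cross q p) q) = 1.
Proof.
move=> pp qq pq; set r := cross q p.
have rr : dotr r r = 1.
  by rewrite lagrange pp qq [dotr q p]dotrC pq expr0n subr0 mulr1.
have rp : dotr r p = 0 by rewrite dotr_cross det3_lrr.
have rq : dotr r q = 0 by rewrite dotr_cross det3_lrl.
split; last first.
  have -> : \det (rows3 p r q) = dotr r r by rewrite det_rows3 /r; vring.
  exact: rr.
apply: mx3P => x; rewrite mulmxA mul_rows3 mul_rows3_tr mulmx1.
rewrite !(dotrDl, dotrZl) pp qq rr rp rq pq [dotr p r]dotrC rp [dotr q p]dotrC pq.
rewrite [dotr q r]dotrC rq; vecring.
Qed.

Lemma cross_neq0_factors {R : realType} (a b : 'rV[R]_3) : cross a b != 0 -> a != 0 /\ b != 0.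
Proof.
by move=> h; split; apply: contraNneq h => ->; apply/eqP; vecring.
Qed.

Lemma frame_orth {R : realType} (a b : 'rV[R]_3) : cross a b != 0 ->
  frame a b *m (frame a b)^T = 1%:M /\ \det (frame a b) = 1.
Proof.
move=> h; have [a0 b0] := cross_neq0_factors h.
apply: rows3_orth; rewrite ?unitv1 // dotrZl dotrZr dotrC dotr_cross det3_lrl.
by rewrite !mulr0.
Qed.

Lemma frame_height {R : realType} (a b x : 'rV[R]_3) :
  (x *m (frame a b)^T) 0 2%:R = (enorm (cross a b))^-1 * det3 a b x.
Proof. by rewrite mul_rows3_tr vec3E dotrZr dotrC dotr_cross. Qed.

Lemma enorm_cross {R : realType} (a b : 'rV[R]_3) :
  enorm (cross a b) = enorm a * enorm b * sin (ang a b).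
Proof.
have s0 : 0 <= sin (ang a b) by rewrite sin_ge0_pi // ang_itv.
apply/eqP; rewrite -(eqrXn2 (n := 2)) ?enorm_ge0 ?mulr_ge0 ?enorm_ge0 //; apply/eqP.
by rewrite enorm_sqr lagrange -!enorm_sqr dotr_cos !exprMn sin2cos2; ring.
Qed.

Lemma frame_fst {R : realType} (a b : 'rV[R]_3) : cross a b != 0 ->
  a *m (frame a b)^T = enorm a *: vec3 1 0 0.
Proof.
move=> h; have [a0 b0] := cross_neq0_factors h; have na : enorm a != 0 by rewrite gt_eqF ?enorm_gt0.
rewrite mul_rows3_tr.
have -> : dotr a (unitv a) = enorm a by rewrite dotrZr -enorm_sqr expr2 mulKf.
have -> : dotr a (cross (unitv (cross a b)) (unitv a)) = 0.
  by rewrite dotrC dotr_cross /unitv; vring.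
have -> : dotr a (unitv (cross a b)) = 0.
  by rewrite dotrZr dotrC dotr_cross det3_lrl mulr0.
vecring.
Qed.

Lemma frame_snd {R : realType} (a b : 'rV[R]_3) : cross a b != 0 ->
  b *m (frame a b)^T = enorm b *: vec3 (cos (ang a b)) (sin (ang a b)) 0.
Proof.
move=> h; have [a0 b0] := cross_neq0_factors h.
have na : enorm a != 0 by rewrite gt_eqF ?enorm_gt0.
have nc : enorm (cross a b) != 0 by rewrite gt_eqF ?enorm_gt0.
rewrite mul_rows3_tr.
have -> : dotr b (unitv a) = enorm b * cos (ang a b).
  by rewrite dotrZr dotrC dotr_cos -!mulrA mulKf.
have -> : dotr b (cross (unitv (cross a b)) (unitv a)) = enorm b * sin (ang a b).
  have -> : dotr b (cross (unitv (cross a b)) (unitv a)) =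
    (enorm a)^-1 * ((enorm (cross a b))^-1 * dotr (cross a b) (cross a b)).
    by rewrite /unitv; vring.
  by rewrite -enorm_sqr expr2 mulKf // enorm_cross -!mulrA mulKf.
have -> : dotr b (unitv (cross a b)) = 0.
  by rewrite dotrZr dotrC dotr_cross det3_lrr mulr0.
vecring.
Qed.

Lemma orth_mul {R : realType} n (A B : 'M[R]_n) :
  A *m A^T = 1%:M -> B *m B^T = 1%:M -> (A *m B) *m (A *m B)^T = 1%:M.
Proof. by move=> oA oB; rewrite trmx_mul mulmxA -(mulmxA A) oB mulmx1. Qed.

Lemma orth_tr {R : realType} n (A : 'M[R]_n) :
  A *m A^T = 1%:M -> A^T *m (A^T)^T = 1%:M.
Proof. by rewrite trmxK => /mulmx1C. Qed.

Definition is_rotz {R : realType} (Z : 'M[R]_3) : Prop :=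
  exists c s, c ^+ 2 + s ^+ 2 = 1 /\ Z = rotz c s.

Lemma is_rotz_mul {R : realType} (Z Z' : 'M[R]_3) :
  is_rotz Z -> is_rotz Z' -> is_rotz (Z *m Z').
Proof.
move=> [c [s [h ->]]] [c' [s' [h' ->]]]; rewrite rotz_mul.
exists (c * c' - s * s'), (c * s' + s * c'); split=> //.
have -> : (c * c' - s * s') ^+ 2 + (c * s' + s * c') ^+ 2 =
  (c ^+ 2 + s ^+ 2) * (c' ^+ 2 + s' ^+ 2) by ring.
by rewrite h h' mulr1.
Qed.

Lemma is_rotz_angle {R : realType} (t : R) : is_rotz (rotz (cos t) (sin t)).
Proof. by exists (cos t), (sin t); rewrite cos2Dsin2. Qed.

Lemma is_rotz_orth {R : realType} (Z : 'M[R]_3) :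
  is_rotz Z -> Z *m Z^T = 1%:M /\ \det Z = 1.
Proof. by move=> [c [s [h ->]]]; rewrite rotz_orth ?det_rotz. Qed.

Lemma is_rotz_z {R : realType} (Z : 'M[R]_3) (x : 'rV[R]_3) :
  is_rotz Z -> (x *m Z) 0 2%:R = x 0 2%:R.
Proof. by move=> [c [s [h ->]]]; rewrite mul_rotz vec3E. Qed.

Lemma rotz_angleD {R : realType} (t u : R) :
  rotz (cos t) (sin t) *m rotz (cos u) (sin u) = rotz (cos (t + u)) (sin (t + u)).
Proof. by rewrite rotz_mul cosD sinD; congr rotz; ring. Qed.

Lemma is_rotz_comm {R : realType} (Z Z' : 'M[R]_3) :
  is_rotz Z -> is_rotz Z' -> Z *m Z' = Z' *m Z.
Proof.
by move=> [c [s [_ ->]]] [c' [s' [_ ->]]]; rewrite !rotz_mul; congr rotz; ring.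
Qed.

Definition place {R : realType} (p v : 'rV[R]_3) (M : 'M[R]_3) (x : 'rV[R]_3) :
  'rV[R]_3 := p + (x - v) *m M.

(** The direction [b] has angle [ang a b] in [frame a b] and angle 0 in [frame b c]. The additional
    turn by [ang a b] makes both positions agree on the edge, so passing from one to the other is a
    rotation about it. *)
Lemma roll_corner {R : realType} (V : seq 'rV[R]_3) (n v a b c p : 'rV[R]_3) (Z : 'M[R]_3) :
  let P := conv_hull [set` V] in
  v \in V -> (forall w, w \in V -> w != v -> 0 < dotr n (w - v)) ->
  hull_side (link V n v) a b -> hull_side (link V n v) b c -> 0 < det3 a b c ->
  is_rotz Z -> p 0 2%:R = 0 ->
  roll P (place p v ((frame a b)^T *m Z)) (side_facet P v a b)
    (place p v ((frame b c)^T *m (rotz (cos (ang a b)) (sin (ang a b)) *m Z)))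
    (side_facet P v b c).
Proof.
move=> P vV hn s s' d rZ p0; have [aL bL ab _] := s; have [_ cL bc _] := s'.
have hL u : u \in link V n v -> dotr n u = 1 by apply: link_height.
have ab0 : cross a b != 0 by apply: (@cross_neq0 _ n); rewrite ?hL.
have bc0 : cross b c != 0 by apply: (@cross_neq0 _ n); rewrite ?hL.
have [oF dF] := frame_orth ab0; have [oF' dF'] := frame_orth bc0.
set r := rotz _ _; have rr : is_rotz r := is_rotz_angle _.
have [oZ dZ] := is_rotz_orth rZ.
have [oZ' dZ'] := is_rotz_orth (is_rotz_mul rr rZ).
set M := (frame a b)^T *m Z; set M' := (frame b c)^T *m (r *m Z).
have oM : M *m M^T = 1%:M by apply: orth_mul => //; apply: orth_tr.
have oM' : M' *m M'^T = 1%:M by apply: orth_mul => //; apply: orth_tr.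
have dM : \det M = 1 by rewrite /M det_mulmx det_tr dF dZ mulr1.
have dM' : \det M' = 1 by rewrite /M' det_mulmx det_tr dF' dZ' mulr1.
have bM : b *m M = b *m M'.
  rewrite !mulmxA frame_snd // frame_fst // -!scalemxAl; congr (_ *: (_ *m Z)).
  by rewrite mul_rotz; vecring.
have [e [eP ev eF eF' eL]] := corner_edge vV hn s s' d.
exists e, (place p p (M^T *m M')); split=> //.
  have [k k0 kV] := link_mem hn cL => eq.
  have : side_facet P v b c (v + k *: c).
    by split; [exact: sub_conv_hull|rewrite /= addrC addKr det3Zr det3_lrr mulr0].
  rewrite eq => -[_ /=]; rewrite addrC addKr det3Zr => /eqP.
  by rewrite mulf_eq0 !gt_eqF.
have rp x : place p p (M^T *m M') (place p v M x) = place p v M' x.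
  have pK y : p + y - p = y by rewrite addrC addKr.
  by rewrite /place pK -(mulmxA (x - v)) (mulmxA M) oM mul1mx.
split.
- exists p, (M^T *m M'); split=> //.
  + apply: sub_aff_hull; exists v => //.
    by rewrite /place subrr mul0mx addr0.
  + by apply: orth_mul => //; apply: orth_tr.
  + by rewrite det_mulmx det_tr dM dM' mulr1.
  + move=> x /(@aff_line _ _ _ p (b *m M)) [y [x' /eL[k ->] <-]|k ->].
      by exists k; rewrite /place [_ - v]addrC addKr scalemxAl.
    rewrite /place [_ - p]addrC addKr -!scalemxAl -(mulmxA b) (mulmxA M) oM mul1mx.
    by rewrite bM.
- by apply/funext => x /=; rewrite rp.
- move=> x [Px /= xd]; rewrite /place addE p0 add0r mulmxA is_rotz_z; last exact: is_rotz_mul.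
  by rewrite frame_height xd mulr0.
- move=> x Px; rewrite /place addE p0 add0r mulmxA is_rotz_z; last exact: is_rotz_mul.
  rewrite frame_height mulr_ge0 ?invr_ge0 ?enorm_ge0 //.
  exact: side_ge0 hn s' Px.
Qed.

(** A position in which the facet lies flat sends the unit normal [q] to a vertical unit vector. A
    link point off the facet must stay above the ground, so this vector points upwards, and only a
    rotation about the vertical axis remains free. *)
Lemma frame_grounded {R : realType} (V : seq 'rV[R]_3) (n v a b t : 'rV[R]_3) (M : 'M[R]_3) :
  let P := conv_hull [set` V] in
  has_dim P 3 -> v \in V -> (forall w, w \in V -> w != v -> 0 < dotr n (w - v)) ->
  hull_side (link V n v) a b -> M *m M^T = 1%:M -> \det M = 1 ->
  (forall x, side_facet P v a b x -> (t + x *m M) 0 2%:R = 0) ->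
  (forall x, P x -> 0 <= (t + x *m M) 0 2%:R) ->
  is_rotz (frame a b *m M).
Proof.
move=> P P3 vV hn s oM dM F0 P0; have [aL bL ab h] := s.
have ab0 : cross a b != 0 by apply: (@cross_neq0 _ n); rewrite ?(link_height hn).
have [a0 b0] := cross_neq0_factors ab0.
have vz : (t + v *m M) 0 2%:R = 0.
  apply: F0; split; first exact: sub_conv_hull.
  by rewrite /= subrr; vring.
have kz k u : (t + (v + k *: u) *m M) 0 2%:R = k * (u *m M) 0 2%:R.
  by rewrite mulmxDl addrA addE vz add0r -scalemxAl scaleE.
have az : (a *m M) 0 2%:R = 0.
  have [k k0 kV] := link_mem hn aL; apply: (mulfI (lt0r_neq0 k0)); rewrite mulr0 -kz.
  apply: F0; split; first exact: sub_conv_hull.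
  by rewrite /= addrC addKr det3Zr det3_lrl mulr0.
have bz : (b *m M) 0 2%:R = 0.
  have [k k0 kV] := link_mem hn bL; apply: (mulfI (lt0r_neq0 k0)); rewrite mulr0 -kz.
  apply: F0; split; first exact: sub_conv_hull.
  by rewrite /= addrC addKr det3Zr det3_lrr mulr0.
have [w wL] := link_span P3 hn ab0; rewrite dotr_cross => dw.
have {}dw : 0 < det3 a b w by rewrite lt0r dw (h w wL).1.
have wz : 0 <= (w *m M) 0 2%:R.
  have [k k0 kV] := link_mem hn wL; rewrite -(pmulr_rge0 _ k0) -kz.
  by apply/P0/sub_conv_hull.
set q := unitv (cross a b); set p := unitv a.
have q1 : dotr q q = 1 by apply: unitv1.
have p1 : dotr p p = 1 by apply: unitv1.
pose z := (q *m M) 0 2%:R.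
have qM : q *m M = vec3 0 0 z.
  rewrite /z /q /unitv -scalemxAl -cross_mulmx //.
  by apply: row3P; rewrite !vec3E !scaleE ?vec3E // az bz; ring.
have zz : z ^+ 2 = 1 by rewrite -q1 -(dotr_orth q q oM) qM; vring.
have z0 : 0 < z.
  have : 0 < dotr q w.
    by rewrite /q /unitv dotrZl dotr_cross mulr_gt0 // invr_gt0 enorm_gt0.
  rewrite -(dotr_orth q w oM) qM dotr3 !vec3E !mul0r !add0r => zw.
  by rewrite ltNge; apply/negP => zn; move: zw; rewrite ltNge mulr_le0_ge0.
have z1 : z = 1.
  by apply/eqP; rewrite -(eqrXn2 (n := 2)) ?ltW ?expr1n ?zz // ltr01.
have pz : (p *m M) 0 2%:R = 0 by rewrite /p /unitv -scalemxAl scaleE az mulr0.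
exists ((p *m M) 0 0), ((p *m M) 0 1); split.
  by rewrite -p1 -(dotr_orth p p oM) dotr3 pz; ring.
rewrite /frame -/q -/p rows3_mul -cross_mulmx // qM z1 /rotz /e3; congr rows3.
  by apply: row3P; rewrite !vec3E.
by apply: row3P; rewrite /cross !vec3E ?pz; ring.
Qed.

Lemma reachable_around {R : realType} (V : seq 'rV[R]_3) (n v p : 'rV[R]_3)
    (b : nat -> 'rV[R]_3) (Z : 'M[R]_3) :
  let P := conv_hull [set` V] in
  v \in V -> (forall w, w \in V -> w != v -> 0 < dotr n (w - v)) ->
  (forall i, hull_side (link V n v) (b i) (b i.+1)) ->
  (forall i, 0 < det3 (b i) (b i.+1) (b i.+2)) ->
  is_rotz Z -> p 0 2%:R = 0 ->
  reachable P (place p v ((frame (b 0%N) (b 1%N))^T *m Z)) (side_facet P v (b 0%N) (b 1%N)) ->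
  forall i, reachable P
    (place p v ((frame (b i) (b i.+1))^T *m
      (rotz (cos (\sum_(j < i) ang (b j) (b j.+1))) (sin (\sum_(j < i) ang (b j) (b j.+1)))
        *m Z)))
    (side_facet P v (b i) (b i.+1)).
Proof.
move=> P vV hn s d rZ p0 r0; elim=> [|i IH].
  by rewrite big_ord0 cos0 sin0 rotz10 mul1mx.
apply: (reachable_roll IH); first exact: side_facet_face2 (s i.+1).
rewrite big_ord_recr /= addrC -rotz_angleD -mulmxA.
apply: (roll_corner _ hn) => //; apply: is_rotz_mul => //; exact: is_rotz_angle.
Qed.

(* t is the total face angle at v. *)
Lemma vertex_rotation {R : realType} (V : seq 'rV[R]_3) (v : 'rV[R]_3) g (F : set 'rV[R]_3) :
  let P := conv_hull [set` V] in
  has_dim P 3 -> P `<=` @upper_half R -> reachable P g F -> vertex P v -> F v ->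
  exists t : R, [/\ 0 < t, t < 2 * pi,
    trace_motion P (planar (cos t) (sin t) (g v - g v *m rotz (cos t) (sin t))) &
    t = pi -> forall u1 u2 u3, u1 \in V -> u2 \in V -> u3 \in V ->
      0 <= dotr (u1 - v) (u2 - v) /\ 0 <= phi (u1 - v) (u2 - v) (u3 - v)].
Proof.
move=> P P3 Pu r vP Fv.
have [vV [n hn]] := vertex_support vP.
have [FP gF gP [t [M [oM dM eM]]]] := reachable_inv Pu r.
have [a0 [a1 [s01 eF]]] := facet_side P3 vV hn FP Fv.
have hL u : u \in link V n v -> dotr n u = 1 by apply: link_height.
have [K [a [K1 e0 e1 [sa sK pa pK]]]] := hull_cycle hL (fun c => link_span P3 hn) s01.
have aL i : (i <= K)%N -> a i \in link V n v.
  by rewrite leq_eqVlt => /predU1P[->|/sa[]//]; have [] := sK.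
have an i : (i <= K)%N -> a i != 0.
  move=> /aL/hL ai; apply/eqP => z; move: ai; rewrite z dotr0 => /eqP.
  by rewrite eq_sym oner_eq0.
(* The cycle of [K.+1] link points is repeated periodically, so that closing it is a roll like any
   other. *)
pose b i := a (i %% K.+1)%N.
have mS i : (i.+1 %% K.+1 = if i %% K.+1 == K then 0 else (i %% K.+1).+1)%N.
  have m := ltn_pmod i (ltn0Sn K); rewrite -addn1 -modnDml addn1.
  by case: eqP => [->|e]; [exact: modnn|rewrite modn_small //; lia].
have bS i : b i.+1 = if (i %% K.+1 == K)%N then a 0%N else a (i %% K.+1).+1.
  by rewrite /b mS; case: eqP.
have sb i : hull_side (link V n v) (b i) (b i.+1).
  rewrite bS; have m := ltn_pmod i (ltn0Sn K); case: eqP => e; rewrite /b.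
    by rewrite e.
  by apply: sa; lia.
have db i : 0 < det3 (b i) (b i.+1) (b i.+2).
  rewrite (bS i.+1) bS; have m := ltn_pmod i (ltn0Sn K).
  rewrite mS; case: eqP => e.
    rewrite /b e; case: eqP => [K0|_]; first lia.
    by apply: pK; lia.
  rewrite /b; case: eqP => e'; first by apply: pa; lia.
  by apply: pa; lia.
have b0 : b 0%N = a0 by rewrite /b mod0n.
have b1 : b 1%N = a1 by rewrite /b modn_small //; lia.
have bK : b K.+1 = a0 by rewrite /b modnn.
have bK1 : b K.+2 = a1 by rewrite (bS K.+1) modnn; case: eqP => // ?; lia.
have ab0 : cross a0 a1 != 0.
  by have [? ? ? _] := s01; apply: (@cross_neq0 _ n); rewrite ?hL.
have [oF dF] := frame_orth ab0.
set Z := frame a0 a1 *m M.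
have rZ : is_rotz Z.
  apply: (@frame_grounded _ V n v a0 a1 t M) => // [x|x Px].
    by rewrite -eF -eM; apply: gF.
  by rewrite -eM; apply: gP.
have gE : g = place (g v) v ((frame a0 a1)^T *m Z).
  apply/funext => x; rewrite /place /Z (mulmxA (frame a0 a1)^T) (mulmx1C oF) mul1mx !eM mulmxBl.
  by rewrite -addrA [v *m M + _]addrC subrK.
have p0 : g v 0 2%:R = 0 by apply: gF.
have r0 : reachable P (place (g v) v ((frame (b 0%N) (b 1%N))^T *m Z))
    (side_facet P v (b 0%N) (b 1%N)) by rewrite b0 b1 -gE -eF.
have := @reachable_around _ V n v (g v) b Z vV hn sb db rZ p0 r0 K.+1.
set T := \sum_(j < K.+1) ang (b j) (b j.+1); rewrite bK bK1 -eF => rT.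
have TE : T = \sum_(i < K) ang (a i) (a i.+1) + ang (a K) (a 0%N).
  rewrite /T big_ord_recr /=; congr (_ + _).
    apply: eq_bigr => i _; rewrite /b !modn_small //; have := ltn_ord i; lia.
  by rewrite bS modn_small // eqxx /b modn_small.
exists T; split.
(* The first two angles alone exceed [ang (a 0) (a 2)], strictly because three consecutive
   directions are independent. *)
- have h0 : 0 < det3 (a 0%N) (a 1%N) (a 2%N) by apply: pa; lia.
  have := ang_triangle_lt (lt0r_neq0 h0).
  have := (andP (ang_itv (a 0%N) (a 2%N))).1; have := (andP (ang_itv (a K) (a 0%N))).1.
  rewrite TE; case: (K) K1 => [|[|k]] // _.
  rewrite big_ord_recl big_ord_recl /= !/bump /= !add1n.
  have : 0 <= \sum_(i < k) ang (a i.+2) (a i.+3).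
    by apply: sumr_ge0 => i _; exact: (andP (ang_itv _ _)).1.
  lra.
- by rewrite TE; apply: fan_perimeter.
(* After [K.+1] rolls [F] is again the supporting facet, turned by [T] about [g v]. This one
   instance makes the rotation a trace motion. *)
- apply: (reachable_planar P3 Pu (cos2Dsin2 T) _ r).
    by rewrite addE oppE mul_rotz vec3E subrr.
  have -> : planar (cos T) (sin T) (g v - g v *m rotz (cos T) (sin T)) \o g =
    place (g v) v ((frame a0 a1)^T *m (rotz (cos T) (sin T) *m Z)).
    apply/funext => x; rewrite /= {3}gE /place /planar.
    rewrite (is_rotz_comm (is_rotz_angle T) rZ) mulmxDl addrA subrK.
    by rewrite !mulmxA.
  exact: rT.
(* The sign conditions hold for the directions [a i] and extend to every [u - v] with [u] in [V], as
   all of these lie in the cone of the [a i]. *)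
- move=> Tpi; rewrite TE in Tpi; have [hd hp] := fan_half_turn an Tpi.
  pose G x := exists2 i, (i <= K)%N & x = a i.
  have cV u : u \in V -> cone3 G (u - v).
    move=> uV; have [->|uv] := eqVneq u v.
      exists (a 0%N), (a 0%N), (a 0%N), 0, 0, 0; split; first by split; exists 0%N.
      by rewrite subrr !scale0r !addr0.
    have [w [k [wL k0 ->]]] := mem_link hn uV uv; rewrite addrC addKr.
    have [|||x [y [z [r1 [r2 [r3 [Gs [h1 h2 h3 ->]]]]]]]] := @fan_cone _ a K w K1.
    + by move=> i iK; rewrite det3_rot; apply: pa; lia.
    + by move=> i iK; have [_ _ _ /(_ w wL)[]] := sa i iK.
    + by have [_ _ _ /(_ w wL)[]] := sK.
    exists x, y, z, (k * r1), (k * r2), (k * r3); split=> //.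
    by rewrite !scalerDr !scalerA; split=> //; rewrite mulr_ge0 // ltW.
  move=> u1 u2 u3 h1 h2 h3; apply: (@cone3_nonneg _ G); try exact: cV.
    by move=> _ _ [i iK ->] [j jK ->]; apply: hd.
  by move=> _ _ _ [i iK ->] [j jK ->] [l lK ->]; apply: hp.
Qed.

(** * Equifacial tetrahedra and the lattice case *)

(* x, y, z are the dot products at one corner of a tetrahedron, and X, Y, Z the
   excesses of the squared edge lengths there over their values in an equifacial
   tetrahedron; m is the squared volume form. *)
Lemma equifacial_scalar {R : realType} (x y z X Y Z : R) :
  let m := 4 * x * y * z + (X + Y + Z) * (x * y + y * z + z * x)
    + X * Y * (y + z) + Y * Z * (x + z) + X * Z * (x + y) + X * Y * Z in
  0 < x -> 0 < y -> 0 < z -> 0 <= X -> 0 <= Y -> 0 <= Z -> m <= 4 * x * y * z ->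
  [/\ X = 0, Y = 0 & Z = 0].
Proof.
move=> m x0 y0 z0 X0 Y0 Z0; rewrite /m => h.
have s : 0 < x * y + y * z + z * x by rewrite !addr_gt0 // mulr_gt0.
have t1 : 0 <= X * Y * (y + z) by rewrite !mulr_ge0 // addr_ge0 // ltW.
have t2 : 0 <= Y * Z * (x + z) by rewrite !mulr_ge0 // addr_ge0 // ltW.
have t3 : 0 <= X * Z * (x + y) by rewrite !mulr_ge0 // addr_ge0 // ltW.
have t4 : 0 <= X * Y * Z by rewrite !mulr_ge0.
have : (X + Y + Z) * (x * y + y * z + z * x) <= 0.
  by move: h t1 t2 t3 t4; lra.
by rewrite pmulr_lle0 // => ?; split; lra.
Qed.

(** From the four corners the excesses are [(X, Y, Z)], [(-X, Y - X, Z - X)], [(X - Y, -Y, Z - Y)]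
    and [(X - Z, Y - Z, -Z)]. The least of 0, [X], [Y], [Z] selects a corner where all three are
    nonnegative, as [equifacial_scalar] requires. *)
Lemma min4_cases {R : realType} (X Y Z : R) :
  [\/ [/\ 0 <= X, 0 <= Y & 0 <= Z], [/\ X <= 0, X <= Y & X <= Z],
     [/\ Y <= 0, Y <= X & Y <= Z] | [/\ Z <= 0, Z <= X & Z <= Y]].
Proof.
have [h1|/ltW h1] := leP X Y.
  have [h2|/ltW h2] := leP X Z.
    have [h3|/ltW h3] := leP 0 X; [constructor 1|constructor 2]; split; lra.
  have [h3|/ltW h3] := leP 0 Z; [constructor 1|constructor 4]; split; lra.
have [h2|/ltW h2] := leP Y Z.
  have [h3|/ltW h3] := leP 0 Y; [constructor 1|constructor 3]; split; lra.
have [h3|/ltW h3] := leP 0 Z; [constructor 1|constructor 4]; split; lra.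
Qed.

Definition corner {R : realType} (v a b c : 'rV[R]_3) : Prop :=
  [/\ 0 <= dotr (a - v) (b - v), 0 <= dotr (b - v) (c - v), 0 <= dotr (c - v) (a - v)
    & 0 <= phi (a - v) (b - v) (c - v)].

(** Nonnegativity of [phi] bounds the positive square of the determinant by four times the product
    of the dot products. *)
Lemma corner_pos {R : realType} (v a b c : 'rV[R]_3) :
  det3 (a - v) (b - v) (c - v) != 0 -> corner v a b c ->
  [/\ 0 < dotr (a - v) (b - v), 0 < dotr (b - v) (c - v) & 0 < dotr (c - v) (a - v)].
Proof.
move=> d [h1 h2 h3]; rewrite /phi subr_ge0 => h.
have : 0 < det3 (a - v) (b - v) (c - v) ^+ 2 by rewrite exprn_even_gt0.
move=> /lt_le_trans/(_ h); rewrite !lt0r h1 h2 h3 !andbT => /andP[].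
by rewrite !mulf_eq0 !negb_or => /andP[/andP[/andP[_ -> ->] ->]].
Qed.

(* With four corners whose face angles sum to at most pi, all sums are pi. *)
Lemma equifacial {R : realType} (a b c d : 'rV[R]_3) :
  det3 (a - d) (b - d) (c - d) != 0 ->
  corner d a b c -> corner a d b c -> corner b a d c -> corner c a b d ->
  [/\ dotr (a - d) (a - d) = dotr (b - c) (b - c),
      dotr (b - d) (b - d) = dotr (a - c) (a - c)
    & dotr (c - d) (c - d) = dotr (a - b) (a - b)].
Proof.
move=> nz kd ka kb kc.
have ea : det3 (d - a) (b - a) (c - a) = - det3 (a - d) (b - d) (c - d) by vring.
have eb : det3 (a - b) (d - b) (c - b) = - det3 (a - d) (b - d) (c - d) by vring.
have ec : det3 (a - c) (b - c) (d - c) = - det3 (a - d) (b - d) (c - d) by vring.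
have [x0 y0 z0] := corner_pos nz kd.
have [|xa ya za] := corner_pos _ ka; first by rewrite ea oppr_eq0.
have [|xb yb zb] := corner_pos _ kb; first by rewrite eb oppr_eq0.
have [|xc yc zc] := corner_pos _ kc; first by rewrite ec oppr_eq0.
case: kd ka kb kc => _ _ _ + [_ _ _ +] [_ _ _ +] [_ _ _ +].
rewrite /phi ea eb ec !sqrrN !subr_ge0 gram3.
pose u := a - d; pose v := b - d; pose w := c - d.
have ab : b - a = v - u by rewrite /u /v; vecring.
have ac : c - a = w - u by rewrite /u /w; vecring.
have ba : a - b = u - v by rewrite /u /v; vecring.
have bc : c - b = w - v by rewrite /v /w; vecring.
have ca : a - c = u - w by rewrite /u /w; vecring.
have cb : b - c = v - w by rewrite /v /w; vecring.
have da : d - a = - u by rewrite /u; vecring.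
have db : d - b = - v by rewrite /v; vecring.
have dc : d - c = - w by rewrite /w; vecring.
move: x0 y0 z0 xa ya za xb yb zb xc yc zc.
rewrite ab ac ba bc ca cb da db dc -/u -/v -/w.
clearbody u v w.
rewrite !(dotrBl, dotrBr, dotrNl, dotrNr) ?[dotr v u]dotrC ?[dotr w u]dotrC ?[dotr w v]dotrC.
(* The vanishing of [X], [Y], [Z] gives the equality of opposite edges. All dot products at the
   other three corners are linear in these and in the dot products at [d]. *)
pose X := dotr u u - dotr u v - dotr u w.
pose Y := dotr v v - dotr u v - dotr v w.
pose Z := dotr w w - dotr v w - dotr u w.
have -> : dotr u u = X + dotr u v + dotr u w by rewrite /X; ring.
have -> : dotr v v = Y + dotr u v + dotr v w by rewrite /Y; ring.
have -> : dotr w w = Z + dotr v w + dotr u w by rewrite /Z; ring.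
move: X Y Z (dotr u v) (dotr v w) (dotr u w) => X Y Z x y z.
move=> x0 y0 z0 xa ya za xb yb zb xc yc zc hd ha hb hc.
suff [-> -> ->] : [/\ X = 0, Y = 0 & Z = 0] by split; ring.
case: (min4_cases X Y Z) => -[h1 h2 h3].
- by apply: (equifacial_scalar (x := x) (y := y) (z := z)) => //; move: hd; lra.
- have [|||||||e1 e2 e3] := @equifacial_scalar _ (X + z) (X + y) (X + x) (- X) (Y - X) (Z - X);
    try (clear hd ha hb hc; lra); last by split; lra.
  by move: ha; lra.
- have [|||||||e1 e2 e3] := @equifacial_scalar _ (Y + y) (Y + x) (Y + z) (X - Y) (- Y) (Z - Y);
    try (clear hd ha hb hc; lra); last by split; lra.
  by move: hb; lra.
- have [|||||||e1 e2 e3] := @equifacial_scalar _ (Z + x) (Z + z) (Z + y) (X - Z) (Y - Z) (- Z);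
    try (clear hd ha hb hc; lra); last by split; lra.
  by move: hc; lra.
Qed.

Lemma edge_vertices {R : realType} (V : seq 'rV[R]_3) (e : set 'rV[R]_3) :
  let P := conv_hull [set` V] in edge P e ->
  exists b c, [/\ vertex P b, vertex P c, e b, e c & b != c].
Proof.
move=> P [[f [k [hf eE]]] /dim1_points[[p0 [p1 [e0 e1 n01]]] _]].
have [P0 f0] : P p0 /\ dotr f p0 = k by move: e0; rewrite eE.
have [P1 f1] : P p1 /\ dotr f p1 = k by move: e1; rewrite eE.
pose d := p1 - p0.
have [b [vb bV fb hb]] := @face_vertex _ _ V f d p0 k hf P0 f0.
have [c [vc cV fc hc]] := @face_vertex _ _ V f (- d) p0 k hf P0 f0.
exists b, c; split=> //.
- by rewrite eE; split=> //; apply: sub_conv_hull.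
- by rewrite eE; split=> //; apply: sub_conv_hull.
apply: contraNneq n01 => bc; rewrite eq_sym -subr_eq0 -dotr_eq0 eq_le dotr_ge0 andbT.
rewrite -/d {2}/d dotrBr; have := hb p1 P1 f1; have := hc p0 P0 f0.
by rewrite !dotrNl bc lerN2; lra.
Qed.

Lemma edge_functional {R : realType} (P e : set 'rV[R]_3) : edge P e ->
  exists f k, (forall x, P x -> dotr f x <= k) /\ e = P `&` [set x | dotr f x = k].
Proof. by case. Qed.

Lemma cross0_line {R : realType} (f b c x : 'rV[R]_3) k :
  b != c -> dotr f b = k -> dotr f c = k -> cross (c - b) (x - b) = 0 -> dotr f x = k.
Proof.
move=> bc fb fc z; have /(congr1 (dotr f)) := cross_parallel z.
rewrite !dotrZr [dotr f (c - b)]dotrBr [dotr f (x - b)]dotrBr fb fc subrr mulr0.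
move=> /eqP; rewrite mulf_eq0 dotr_eq0 !subr_eq0.
by rewrite [c == b]eq_sym (negbTE bc) => /eqP.
Qed.

(** The functional of the edge is minimized over [F]. If the minimum were attained on the edge, all
    of [F] would lie in it, hence on a line. *)
Lemma vertex_off_edge {R : realType} (V : seq 'rV[R]_3) (F e : set 'rV[R]_3) :
  let P := conv_hull [set` V] in has_dim P 3 -> face2 P F -> edge P e -> e `<=` F ->
  exists a, [/\ vertex P a, F a & ~ e a].
Proof.
move=> P P3 FP eP eF; have [f [k [hf eE]]] := edge_functional eP.
have [c [b [c0 hc FE]]] := face2_functional P3 FP.
have [p0 [p1 [p2 [F0 F1 F2 n]]]] := dim2_points FP.2.
have [P0 c0'] : P p0 /\ dotr c p0 = b by move: F0; rewrite FE.
have [a [va aV ca ha]] := @face_vertex _ _ V c (- f) p0 b hc P0 c0'.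
have Pa : P a by apply: sub_conv_hull.
exists a; split=> //; first by rewrite FE.
rewrite eE => -[_ /= fa]; move/negP: n; apply; apply/eqP.
have Fe x : F x -> e x.
  rewrite FE => -[Px /= cx]; rewrite eE; split=> //=; apply/eqP; rewrite eq_le hf //=.
  by have := ha x Px cx; rewrite !dotrNl lerN2 fa.
have [_ [d [p line]]] := dim1_points eP.2.
have [k0 ->] := line _ (Fe _ F0); have [k1 ->] := line _ (Fe _ F1).
have [k2 ->] := line _ (Fe _ F2); vecring.
Qed.

(* M turns space about the horizontal line spanned by d; w' *m M^T is the position of
   w' before the turn. *)
Lemma opposite_sides {R : realType} (d w w' : 'rV[R]_3) (M : 'M[R]_3) :
  d != 0 -> M *m M^T = 1%:M -> \det M = 1 -> d *m M = d ->
  d 0 2%:R = 0 -> w 0 2%:R = 0 -> w' 0 2%:R = 0 ->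
  0 < (w *m M) 0 2%:R -> 0 < (w' *m M^T) 0 2%:R ->
  det3 e3 d w * det3 e3 d w' < 0.
Proof.
rewrite -dotr_gt0 => d0 oM dM dMd dz wz wz'.
have zE (x : 'rV[R]_3) : x 0 2%:R = dotr x e3 by rewrite /e3; vring.
have oMT := mulmx1C oM.
have dMT : d *m M^T = d by rewrite -{1}dMd -mulmxA oM mulmx1.
pose l := e3 *m M; pose m := e3 *m M^T.
have h1 : (w *m M) 0 2%:R = dotr w m by rewrite zE dotr_adj.
have h2 : (w' *m M^T) 0 2%:R = dotr w' l by rewrite zE dotr_adj trmxK.
have lam : dotr (cross e3 d) m = det3 l d e3.
  by rewrite -dotr_adj -cross_mulmx // dMd dotr_cross.
have lam' : dotr (cross e3 d) l = - det3 l d e3 by rewrite dotr_cross; vring.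
have dl : dotr d l = 0 by rewrite dotrC /l dotr_adj dMT dotrC -zE.
have dm : dotr d m = 0 by rewrite dotrC /m dotr_adj trmxK dMd dotrC -zE.
(* Only the component of [x] along the horizontal normal [cross e3 d] contributes. The turn and its
   inverse give that normal opposite heights, by [lam] and [lam'], so the two side determinants
   differ in sign. *)
have comp (x y : 'rV[R]_3) : x 0 2%:R = 0 -> dotr d y = 0 ->
    dotr d d * dotr x y = det3 e3 d x * dotr (cross e3 d) y.
  move=> xz dy.
  have -> : dotr d d * dotr x y = det3 e3 d x * dotr (cross e3 d) y
     + dotr d x * dotr d y + d 0 2%:R * (d 0 2%:R * dotr x y - x 0 2%:R * dotr d y)
     + x 0 2%:R * (dotr d d * y 0 2%:R - d 0 2%:R * dotr d y).
    by rewrite /e3 !dotr3 /det3 /cross !vec3E dz xz; ring.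
  by rewrite dy dz xz; ring.
rewrite h1 h2 => p1 p2.
have := comp _ _ wz dm; have := comp _ _ wz' dl; rewrite lam lam' => e2 e1.
have q1 : 0 < det3 e3 d w * det3 l d e3 by rewrite -e1 mulr_gt0.
have q2 : 0 < det3 e3 d w' * - det3 l d e3 by rewrite -e2 mulr_gt0.
have := mulr_gt0 q1 q2.
have -> : det3 e3 d w * det3 l d e3 * (det3 e3 d w' * - det3 l d e3) =
  - (det3 e3 d w * det3 e3 d w') * det3 l d e3 ^+ 2 by ring.
have l2 : 0 <= det3 l d e3 ^+ 2 by rewrite sqr_ge0.
by rewrite ltNge => /negP h; rewrite ltNge; apply/negP => h'; apply: h;
  rewrite mulr_le0_ge0 // oppr_le0.
Qed.

Lemma facets_meet {R : realType} (P F F' e : set 'rV[R]_3) (a b c : 'rV[R]_3) :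
  has_dim P 3 -> face2 P F -> face2 P F' -> edge P e -> e `<=` F -> e `<=` F' ->
  e b -> e c -> b != c -> F a -> F' a -> ~ e a -> F = F'.
Proof.
move=> P3 FP FP' eP eF eF' eb ec bc Fa Fa' ea.
have [f [k [hf eE]]] := edge_functional eP.
have [l [m [l0 hl FE]]] := face2_functional P3 FP.
have [l' [m' [l0' hl' FE']]] := face2_functional P3 FP'.
have n : cross (c - b) (a - b) != 0.
  apply/eqP => z; apply: ea; move: eb ec; rewrite eE => -[_ /= fb] [_ /= fc].
  split; first by move: Fa; rewrite FE => -[].
  exact: cross0_line bc fb fc z.
have on x : F x -> dotr l x = m by rewrite FE => -[].
have on' x : F' x -> dotr l' x = m' by rewrite FE' => -[].
have Fb := eF _ eb; have Fc := eF _ ec; have Fb' := eF' _ eb; have Fc' := eF' _ ec.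
rewrite FE FE'; apply/seteqP; split=> x [Px /= lx]; split=> //=.
  exact: (plane_unique l0 l0' (on _ Fb) (on _ Fc) (on _ Fa) (on' _ Fb') (on' _ Fc')
    (on' _ Fa') n).
exact: (plane_unique l0' l0 (on' _ Fb') (on' _ Fc') (on' _ Fa') (on _ Fb) (on _ Fc)
  (on _ Fa) n).
Qed.

Lemma sqr_eq_opp {R : realType} (x y : R) : x ^+ 2 = y ^+ 2 -> x * y < 0 -> y = - x.
Proof.
move=> /eqP; rewrite eqf_sqr => /orP[/eqP ->|/eqP -> _]; last by rewrite opprK.
by rewrite -expr2 ltNge sqr_ge0.
Qed.

(** Equality of opposite edges gives the unfolded [d] the same distances to [b] and [c] as the point
    completing the parallelogram. Two positions in the ground plane fit, mirror images in the line
    of the edge, and [opposite_sides] selects the right one. *)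
Lemma unfold_equifacial {R : realType} (P F F' e : set 'rV[R]_3)
    (g rho : 'rV[R]_3 -> 'rV[R]_3) (a b c d : 'rV[R]_3) :
  has_dim P 3 -> face2 P F -> face2 P F' -> F' <> F -> edge P e -> e `<=` F -> e `<=` F' ->
  rigid g -> (forall x, F x -> g x 0 2%:R = 0) -> (forall x, P x -> 0 <= g x 0 2%:R) ->
  rotation_about (aff_hull (g @` e)) rho ->
  (forall x, F' x -> rho (g x) 0 2%:R = 0) -> (forall x, P x -> 0 <= rho (g x) 0 2%:R) ->
  e b -> e c -> b != c -> F a -> ~ e a -> F' d -> ~ e d ->
  corner d a b c -> corner a d b c -> corner b a d c -> corner c a b d ->
  rho (g d) = g b + g c - g a.
Proof.
move=> P3 FP FP' nF eP eF eF' rg gF gP rr gF' gP' eb ec bc Fa ea Fd ed kd ka kb kc.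
have sub G x : face2 P G -> G x -> P x by move=> [[? [? [_ ->]]] _] [].
have rg' : rigid (rho \o g) by apply: rigid_comp => //; apply: rotation_rigid rr.
have FE := facet_height P3 FP rg gF; have FE' := facet_height P3 FP' rg' gF'.
have fx x : e x -> rho (g x) = g x.
  by move=> ex; case: rr => [? [? [_ _ _ _]]]; apply; apply: sub_aff_hull; exists x.
have az : 0 < rho (g a) 0 2%:R.
  rewrite lt0r gP' ?andbT; last exact: sub Fa.
  apply/eqP => z; apply: nF; symmetry; apply: (facets_meet P3 FP FP' eP eF eF' eb ec bc Fa) ea.
  by rewrite FE'; split=> //; apply: sub Fa.
have dz : 0 < g d 0 2%:R.
  rewrite lt0r gP ?andbT; last exact: sub Fd.
  apply/eqP => z; apply: nF; symmetry; apply: (facets_meet P3 FP FP' eP eF eF' eb ec bc) ed.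
    by rewrite FE; split=> //; apply: sub Fd.
  exact: Fd.
have [t [N [oN dN gE]]] := rg.
have [p [M [_ oM dM rE _]]] := rr.
have rB x y : rho x - rho y = (x - y) *m M.
  by rewrite !rE opprD addrACA subrr add0r -mulmxBl opprB addrA subrK.
have gB x y : g x - g y = (x - y) *m N by rewrite !gE opprD addrACA subrr add0r mulmxBl.
pose D := g c - g b; pose w := g a - g b; pose w' := rho (g d) - g b.
have DM : D *m M = D by rewrite /D -rB !fx.
have bz : g b 0 2%:R = 0 by apply/gF/eF.
have cz : g c 0 2%:R = 0 by apply/gF/eF.
have Dz : D 0 2%:R = 0 by rewrite /D addE oppE bz cz subr0.
have wz : w 0 2%:R = 0 by rewrite /w addE oppE bz gF // subr0.
have wz' : w' 0 2%:R = 0 by rewrite /w' addE oppE bz gF' // subr0.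
have wM : 0 < (w *m M) 0 2%:R by rewrite /w -rB addE oppE (fx b eb) bz subr0.
have wE' : w' = (g d - g b) *m M by rewrite /w' -{1}(fx _ eb) rB.
have wM' : 0 < (w' *m M^T) 0 2%:R.
  by rewrite wE' -mulmxA oM mulmx1 addE oppE bz subr0.
have DE : D = (c - b) *m N by rewrite /D gB.
have D0 : D != 0.
  by rewrite -dotr_eq0 DE dotr_orth // dotr_eq0 subr_eq0 eq_sym.
have op := opposite_sides D0 oM dM DM Dz wz wz' wM wM'.
pose u := g d - g b.
have lin (x y z : 'rV[R]_3) : x 0 2%:R = 0 -> z 0 2%:R = 0 ->
    det3 (x - y) (- y) (z - y) = - (y 0 2%:R * det3 e3 z x).
  by move=> xz zz; rewrite /e3 /det3 !coordE !vec3E xz zz; ring.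
(* Up to sign, the height of [d] before the roll times the determinant of the triangle in the
   ground. *)
have nz : det3 (a - d) (b - d) (c - d) != 0.
  have -> : det3 (a - d) (b - d) (c - d) = - (u 0 2%:R * det3 e3 D w).
    rewrite -[LHS]mulr1 -dN -det3_mulmx -!gB.
    have -> : g a - g d = w - u by rewrite /w /u; vecring.
    have -> : g b - g d = - u by rewrite /u; vecring.
    have -> : g c - g d = D - u by rewrite /D /u; vecring.
    exact: lin.
  rewrite oppr_eq0 mulf_neq0 //; last by apply: contraTneq op => ->; rewrite mul0r ltxx.
  by rewrite gt_eqF // /u addE oppE bz subr0.
have [_ eb' ec'] := equifacial nz kd ka kb kc.
have DD : dotr D D = dotr (c - b) (c - b) by rewrite DE dotr_orth.
have ww : dotr w w = dotr (a - b) (a - b) by rewrite /w gB dotr_orth.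
have Dw : dotr D w = dotr (c - b) (a - b) by rewrite DE /w gB dotr_orth.
have ww' : dotr w' w' = dotr (d - b) (d - b) by rewrite wE' dotr_orth // gB dotr_orth.
have Dw' : dotr D w' = dotr (c - b) (d - b).
  by rewrite -{1}DM wE' dotr_orth // DE gB dotr_orth.
have e1 : dotr w' w' = dotr D D + dotr w w - 2 * dotr D w.
  rewrite ww' DD ww Dw; have -> : dotr (d - b) (d - b) = dotr (b - d) (b - d) by vring.
  by rewrite eb'; vring.
have e2 : dotr D w' = dotr D D - dotr D w.
  have H : 2 * dotr (c - b) (d - b) = dotr (c - b) (c - b) + dotr (b - d) (b - d)
     - dotr (c - d) (c - d) by vring.
  have H' : 2 * dotr (c - b) (a - b) = dotr (c - b) (c - b) + dotr (a - b) (a - b)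
     - dotr (a - c) (a - c) by vring.
  by rewrite Dw' DD Dw; move: H H'; rewrite eb' ec'; lra.
have zB (x y : 'rV[R]_3) : (x - y) 0 2%:R = x 0 2%:R - y 0 2%:R by rewrite addE oppE.
have area (x : 'rV[R]_3) : x 0 2%:R = 0 -> det3 e3 D x ^+ 2 = dotr D D * dotr x x - dotr D x ^+ 2.
  by move=> xz; rewrite /e3 /det3 !dotr3 !vec3E Dz xz; ring.
have kk : det3 e3 D w ^+ 2 = det3 e3 D w' ^+ 2.
  by rewrite !area // e1 e2; ring.
have k' := sqr_eq_opp kk op.
suff : w' - (D - w) = 0.
  move=> /eqP; rewrite subr_eq0 => /eqP; rewrite /w' /D /w => E.
  by apply: (addIr (- g b)); rewrite E; vecring.
suff : dotr D D * dotr (w' - (D - w)) (w' - (D - w)) = 0.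
  by move/eqP; rewrite mulf_eq0 dotr_eq0 (negbTE D0) dotr_eq0 => /eqP.
have yz : (w' - (D - w)) 0 2%:R = 0.
  by rewrite (zB w' (D - w)) (zB D w) wz' Dz wz !subrr.
have A := area _ yz.
have B1 : dotr D (w' - (D - w)) = 0 by rewrite (dotrBr w' (D - w) D) (dotrBr D w D) e2; ring.
have B2 : det3 e3 D (w' - (D - w)) = 0.
  have -> : det3 e3 D (w' - (D - w)) = det3 e3 D w' + det3 e3 D w by vring.
  by rewrite k' addNr.
by move: A; rewrite B1 B2 expr0n subr0 => <-.
Qed.

(** * The trace when all total angles are pi *)

Lemma polytope_seq {R : realType} n (P : set 'rV[R]_n) : polytope P ->
  exists V : seq 'rV[R]_n, P = conv_hull [set` V].
Proof. by move=> [S /finite_seqP[V ->] ->]; exists V. Qed.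

Lemma trace_vertex {R : realType} (P : set 'rV[R]_3) (p : 'rV[R]_2) :
  has_dim P 3 -> P `<=` @upper_half R -> trace P p ->
  exists g F v, [/\ reachable P g F, vertex P v, F v & g v = embed p].
Proof.
move=> P3 Pu [g [F [v [r vP gv]]]]; exists g, F, v; split=> //.
have [FP gF _ rg] := reachable_inv Pu r.
rewrite (facet_height P3 FP rg gF); split; last by rewrite /= gv embedE vec3E.
case: vP => [[c [b [_ e]]] _]; have : [set v] v by [].
by rewrite e => -[].
Qed.

Lemma reachable_last {R : realType} (P : set 'rV[R]_3) g F : reachable P g F ->
  g = id \/ exists g1 F1, [/\ reachable P g1 F1, face2 P F & roll P g1 F1 g F].
Proof.
case=> [F0 _ _|g0 F0 e F' rho r eP eF FP' n eF' rr gF' gP']; first by left.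
right; exists g0, F0; split=> //; exists e, rho; split=> //; split=> //.
  exact/ground_sub.
exact/upper_sub.
Qed.

(** The vertices [v] are restricted to those of facets that become supporting, which is what rolling
    around a vertex provides. *)
Definition all_corners {R : realType} (V : seq 'rV[R]_3) : Prop :=
  forall g F v, reachable (conv_hull [set` V]) g F -> vertex (conv_hull [set` V]) v -> F v ->
  forall a b c, a \in V -> b \in V -> c \in V -> corner v a b c.

Lemma roll_parallelogram {R : realType} (V : seq 'rV[R]_3) g g' (F F' : set 'rV[R]_3) :
  let P := conv_hull [set` V] in
  has_dim P 3 -> P `<=` @upper_half R -> all_corners V ->
  reachable P g F -> face2 P F' -> roll P g F g' F' ->
  exists e a b c, [/\ edge P e, e `<=` F, e `<=` F',
    [/\ vertex P a, vertex P b & vertex P c] &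
    [/\ F a /\ ~ e a, e b /\ e c, b != c, forall x, e x -> g' x = g x &
    forall d, vertex P d -> F' d -> ~ e d -> g' d = g b + g c - g a]].
Proof.
move=> P P3 Pu co r FP' ro; have r' := reachable_roll r FP' ro.
have [e [rho [eP eF nF eF' [rr gE gF' gP']]]] := ro.
have [FP gF gP rg] := reachable_inv Pu r.
have [b [c [vb vc eb ec bc]]] := edge_vertices eP.
have [a [va Fa ea]] := vertex_off_edge P3 FP eP eF.
exists e, a, b, c; split=> //; split=> // [x ex|d vd Fd ed].
  by rewrite gE; case: rr => [? [? [_ _ _ _]]]; apply; apply: sub_aff_hull; exists x.
have [aV _] := vertex_support va; have [bV _] := vertex_support vb.
have [cV _] := vertex_support vc; have [dV _] := vertex_support vd.
move: gF' gP'; rewrite gE /= => gF' gP'.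
apply: (unfold_equifacial P3 FP FP' nF eP eF eF' rg gF gP rr gF' gP' eb ec bc Fa ea Fd ed).
- exact: (co _ _ _ r' vd Fd).
- exact: (co _ _ _ r va Fa).
- exact: (co _ _ _ r vb (eF _ eb)).
- exact: (co _ _ _ r vc (eF _ ec)).
Qed.

(** With [x = b + k *: (c - b)] the first two dot products give [0 <= k <= 1] and the third gives
    [(1 - k) * k <= 0]. Hence an edge contains no third vertex. *)
Lemma collinear_corners {R : realType} (b c x : 'rV[R]_3) : b != c ->
  cross (c - b) (x - b) = 0 -> 0 <= dotr (c - b) (x - b) -> 0 <= dotr (b - c) (x - c) ->
  0 <= dotr (b - x) (c - x) -> x = b \/ x = c.
Proof.
move=> bc /cross_parallel; set d := c - b.
have d0 : 0 < dotr d d by rewrite dotr_gt0 /d subr_eq0 eq_sym.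
move=> e; pose k := dotr d (x - b) / dotr d d.
have xE : x - b = k *: d.
  apply: (scalerI (lt0r_neq0 d0)); rewrite e scalerA; congr (_ *: _).
  by rewrite mulrC divfK // gt_eqF.
have -> : b - c = - d by rewrite /d; vecring.
have -> : x - c = (k - 1) *: d by rewrite scalerBl -xE /d; vecring.
have -> : b - x = - k *: d by rewrite scaleNr -xE; vecring.
have -> : c - x = (1 - k) *: d by rewrite scalerBl -xE /d; vecring.
rewrite xE !dotrZr dotrNl dotrZl => h1 h2 h3.
have k0 : 0 <= k by rewrite -(pmulr_lge0 _ d0).
have k1 : 0 <= 1 - k.
  by rewrite -(pmulr_lge0 _ d0); move: h2; lra.
have kk : (1 - k) * k <= 0.
  by rewrite -(pmulr_lle0 _ d0); move: h3; lra.
have /eqP : (1 - k) * k = 0 by apply/eqP; rewrite eq_le kk mulr_ge0.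
rewrite mulf_eq0 subr_eq0 => /orP[/eqP k1'|/eqP k0'].
  right; apply: (addIr (- b)); rewrite xE -k1' scale1r //.
by left; apply: (addIr (- b)); rewrite xE k0' scale0r subrr.
Qed.

Lemma rigid_inj {R : realType} (g : 'rV[R]_3 -> 'rV[R]_3) : rigid g -> injective g.
Proof.
move=> [t [M [oM _ gE]]] x y; rewrite !gE => /addrI/(congr1 (mulmxr M^T)) /=.
by rewrite -!mulmxA oM !mulmx1.
Qed.

(** A roll onto [F0] sends all its vertices off the edge to the same fourth point of a
    parallelogram, so there is only one and [F0] is a triangle. It spans the lattice, and the
    parallelogram rule keeps all later vertices in it. *)
Lemma lattice_trace {R : realType} (V : seq 'rV[R]_3) (F0 F1 : set 'rV[R]_3) h g1 :
  let P := conv_hull [set` V] in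
  has_dim P 3 -> P `<=` @upper_half R -> all_corners V ->
  face2 P F0 -> F0 `<=` @ground R ->
  reachable P g1 F1 -> roll P g1 F1 h F0 ->
  exists o u w : 'rV[R]_3, [/\ u 0 2%:R = 0, w 0 2%:R = 0, det3 e3 u w != 0 &
    forall g F v, reachable P g F -> vertex P v -> F v ->
    exists m n : int, g v = o + m%:~R *: u + n%:~R *: w].
Proof.
move=> P P3 Pu co FP0 F0g r1 ro.
have r0 : reachable P id F0 by apply: reach_start.
have F0z x : F0 x -> x 0 2%:R = 0 by move=> /F0g/groundP.
have rh := reachable_roll r1 FP0 ro.
have [_ _ _ righ] := reachable_inv Pu rh.
have [e [a [b [c [eP _ eF0 [va vb vc] [_ [eb ec] bc _ hd]]]]]] :=
  roll_parallelogram P3 Pu co r1 FP0 ro.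
have [d [vd Fd ed]] := vertex_off_edge P3 FP0 eP eF0.
have [bV _] := vertex_support vb; have [cV _] := vertex_support vc.
exists b, (c - b), (d - b).
have zB x y : F0 x -> F0 y -> (x - y) 0 2%:R = 0.
  by move=> Fx Fy; rewrite addE oppE !F0z // subr0.
have Fb := eF0 _ eb; have Fc := eF0 _ ec.
have line x : F0 x -> cross (c - b) (x - b) = 0 -> e x.
  have [f [k [hf eE]]] := edge_functional eP.
  move=> Fx z; move: eb ec; rewrite eE => -[_ /= fb] [_ /= fc]; split.
    by move: Fx; case: FP0 => -[? [? [_ ->]]] _ [].
  exact: cross0_line bc fb fc z.
split; [exact: zB|exact: zB| |].
  apply/eqP => z; apply/ed/line => //.
  have : cross (c - b) (d - b) = vec3 0 0 (det3 e3 (c - b) (d - b)).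
    have := zB _ _ Fc Fb; have := zB _ _ Fd Fb; move: (c - b) (d - b) => x y xz yz.
    by apply: row3P; rewrite /cross /e3 /det3 !vec3E xz yz; ring.
  by rewrite z => ->; apply: row3P; rewrite vec3E zeroE.
have inL x : vertex P x -> F0 x -> exists m n : int, x = b + m%:~R *: (c - b) + n%:~R *: (d - b).
  move=> vx Fx; have [ex|ex] := pselect (e x); last first.
    have -> : x = d by apply: (rigid_inj righ); rewrite !hd.
    by exists 0, 1; rewrite scale0r addr0 scale1r addrC subrK.
  have [xV _] := vertex_support vx.
  have z : cross (c - b) (x - b) = 0.
    have [_ [l [p hl]]] := dim1_points eP.2.
    have [k1 ->] := hl _ eb; have [k2 ->] := hl _ ec; have [k3 ->] := hl _ ex; vecring.
  have [->|->] : x = b \/ x = c.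
    apply: (collinear_corners bc z).
    + by have [] := co _ _ _ r0 vb Fb c x x cV xV xV.
    + by have [] := co _ _ _ r0 vc Fc b x x bV xV xV.
    + by have [] := co _ _ _ r0 vx Fx b c c bV cV cV.
    by exists 0, 0; rewrite !scale0r !addr0.
  by exists 1, 0; rewrite scale0r addr0 scale1r addrC subrK.
move=> g F v r; elim: r v => {g F} [F FP Fg|g F e' F' rho r IH eP' eF FP' n eF' rr gF' gP'] v.
  by move=> vv Fv; apply: inL => //; rewrite (start_unique P3 FP0 F0g FP Fg).
move=> vv Fv.
have ro' : roll P g F (rho \o g) F'.
  by exists e', rho; split=> //; split=> //; [exact/ground_sub|exact/upper_sub].
have [e2 [a2 [b2 [c2 [_ e2F _ [va2 vb2 vc2] [[Fa2 _] [eb2 ec2] _ fix2 par]]]]]] :=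
  roll_parallelogram P3 Pu co r FP' ro'.
have [ev|ev] := pselect (e2 v); first by rewrite fix2 //; apply: IH => //; apply: e2F.
rewrite par //.
have [m1 [n1 ->]] := IH _ va2 Fa2; have [m2 [n2 ->]] := IH _ vb2 (e2F _ eb2).
have [m3 [n3 ->]] := IH _ vc2 (e2F _ ec2).
exists (m2 + m3 - m1), (n2 + n3 - n1).
by rewrite !intrD !intrN; vecring.
Qed.

(** If [m] is nonzero, the vector is at distance at least [|k| / enorm w] from the line of [w];
    otherwise it is a nonzero integer multiple of [w]. *)
Lemma lattice_separated {R : realType} (u w : 'rV[R]_3) :
  u 0 2%:R = 0 -> w 0 2%:R = 0 -> det3 e3 u w != 0 ->
  exists2 s : R, 0 < s & forall m n : int, m%:~R *: u + n%:~R *: w != 0 ->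
    s <= dotr (m%:~R *: u + n%:~R *: w) (m%:~R *: u + n%:~R *: w).
Proof.
move=> uz wz; set k := det3 e3 u w => k0.
have w0 : 0 < dotr w w.
  by rewrite dotr_gt0; apply: contraNneq k0 => w0; rewrite /k w0; apply/eqP; vring.
have one (i : int) : i != 0 -> 1 <= i%:~R ^+ 2 :> R.
  move=> i0; rewrite -rmorphXn /= -[1]/(1%:~R) ler_int.
  by rewrite -gtz0_ge1 exprn_even_gt0.
exists (Num.min (k ^+ 2 / dotr w w) (dotr w w)).
  by rewrite lt_min w0 andbT divr_gt0 // exprn_even_gt0.
move=> m n; have [->|m0] := eqVneq m 0.
  rewrite scale0r add0r scaler_eq0 intr_eq0 negb_or => /andP[n0 _].
  rewrite ge_min; apply/orP; right; rewrite dotrZl dotrZr mulrA -expr2.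
  by rewrite ler_peMl ?(ltW w0) ?one.
move=> _; rewrite ge_min; apply/orP; left; rewrite ler_pdivrMr //.
set x := _ + _.
have e : dotr x x * dotr w w = det3 e3 x w ^+ 2 + dotr x w ^+ 2.
  have xz : x 0 2%:R = 0 by rewrite /x addE !scaleE uz wz !mulr0 addr0.
  by rewrite /e3 /det3 !dotr3 !vec3E xz wz; ring.
have -> : dotr x x * dotr w w = m%:~R ^+ 2 * k ^+ 2 + dotr x w ^+ 2.
  by rewrite e; congr (_ + _); rewrite /x /k; vring.
apply: (@le_trans _ _ (m%:~R ^+ 2 * k ^+ 2)); last by rewrite lerDl sqr_ge0.
by rewrite ler_peMl ?sqr_ge0 ?one.
Qed.

(** * Rotations, translations and density *)

Lemma cos_lt1 {R : realType} (t : R) : 0 < t -> t < 2 * pi -> cos t < 1.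
Proof.
move=> t0 t1; have -> : t = t / 2 + t / 2 by rewrite -splitr.
have s0 : 0 < sin (t / 2) by apply: sin_gt0_pi; lra.
have := cos2Dsin2 (t / 2); rewrite cosD -!expr2.
by have := exprn_gt0 2 s0; lra.
Qed.

Lemma sin_eq0_pi {R : realType} (t : R) : 0 < t -> t < 2 * pi -> sin t = 0 -> t = pi.
Proof.
move=> t0 t1 st; case: (ltrgtP t pi) => // h.
  by have := @sin_gt0_pi _ t; rewrite st ltxx t0 h => /(_ isT).
have : 0 < sin (t - pi) by apply: sin_gt0_pi; lra.
have e : sin t = - sin (t - pi) by rewrite -{1}(subrK pi t) sinDpi.
by move: e; rewrite st => /eqP; rewrite eq_sym oppr_eq0 => /eqP ->; rewrite ltxx.
Qed.

Definition rotation_at {R : realType} (P : set 'rV[R]_3) (p : 'rV[R]_3) (t : R) : Prop :=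
  trace_motion P (planar (cos t) (sin t) (p - p *m rotz (cos t) (sin t))).

Definition translation_by {R : realType} (P : set 'rV[R]_3) (w : 'rV[R]_3) : Prop :=
  w 0 2%:R = 0 /\ trace_motion P (planar 1 0 w).

Lemma trace_motion_comp {R : realType} (P : set 'rV[R]_3) h k :
  trace_motion P h -> trace_motion P k -> trace_motion P (h \o k).
Proof. by move=> hh hk g F /hk/hh. Qed.

Lemma planar10 {R : realType} (w x : 'rV[R]_3) : planar 1 0 w x = w + x.
Proof. by rewrite /planar rotz10 mulmx1. Qed.

Lemma translation_add {R : realType} (P : set 'rV[R]_3) (w w' : 'rV[R]_3) :
  translation_by P w -> translation_by P w' -> translation_by P (w + w').
Proof.
move=> [wz hw] [wz' hw']; split; first by rewrite addE wz wz' addr0.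
have -> : planar 1 0 (w + w') = planar 1 0 w \o planar 1 0 w'.
  by apply/funext => x /=; rewrite !planar10 addrA.
exact: trace_motion_comp.
Qed.

Lemma translation_opp {R : realType} (P : set 'rV[R]_3) (w : 'rV[R]_3) :
  has_dim P 3 -> P `<=` @upper_half R -> (exists g F, reachable P g F) ->
  translation_by P w -> translation_by P (- w).
Proof.
move=> P3 Pu ne [wz hw]; split; first by rewrite oppE wz oppr0.
have := trace_motion_inv P3 Pu ne _ wz hw.
rewrite expr1n expr0n addr0 oppr0 => /(_ erefl).
by rewrite rotz10 mulmx1.
Qed.

Lemma translation_int {R : realType} (P : set 'rV[R]_3) (w : 'rV[R]_3) (m : int) :
  has_dim P 3 -> P `<=` @upper_half R -> (exists g F, reachable P g F) ->
  translation_by P w -> translation_by P (m%:~R *: w).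
Proof.
move=> P3 Pu ne tw.
have nat_case (k : nat) : translation_by P (k%:R *: w).
  elim: k => [|k IH]; last by rewrite -natr1 scalerDl scale1r; apply: translation_add.
  rewrite scale0r; split; first by rewrite zeroE.
  have -> : planar 1 0 (0 : 'rV[R]_3) = id by apply/funext => x; rewrite planar10 add0r.
  by [].
case: m => k; first exact: nat_case.
by rewrite NegzE intrN scaleNr; apply: translation_opp => //; apply: nat_case.
Qed.

Lemma rotation_inverse {R : realType} (P : set 'rV[R]_3) (p : 'rV[R]_3) (t : R) :
  has_dim P 3 -> P `<=` @upper_half R -> (exists g F, reachable P g F) ->
  p 0 2%:R = 0 -> rotation_at P p t ->
  exists2 k, trace_motion P k &
    cancel k (planar (cos t) (sin t) (p - p *m rotz (cos t) (sin t))).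
Proof.
move=> P3 Pu ne pz hp.
have cs := cos2Dsin2 t.
have tz : (p - p *m rotz (cos t) (sin t)) 0 2%:R = 0.
  by rewrite addE oppE mul_rotz vec3E subrr.
exists (planar (cos t) (- sin t)
  (- (p - p *m rotz (cos t) (sin t)) *m rotz (cos t) (- sin t))).
  exact: trace_motion_inv.
exact: planar_invr.
Qed.

(** The linear parts commute, so the two orders of composition differ by a translation, whose vector
    [key] computes. *)
Lemma commutator_translation {R : realType} (P : set 'rV[R]_3) (p q : 'rV[R]_3) (t u : R) :
  has_dim P 3 -> P `<=` @upper_half R -> (exists g F, reachable P g F) ->
  p 0 2%:R = 0 -> q 0 2%:R = 0 -> rotation_at P p t -> rotation_at P q u ->
  translation_by P ((p - q) *m (1%:M - rotz (cos t) (sin t)) *m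
                    (1%:M - rotz (cos u) (sin u))).
Proof.
move=> P3 Pu ne pz qz hp hq.
have [ip hip ipK] := rotation_inverse P3 Pu ne pz hp.
have [iq hiq iqK] := rotation_inverse P3 Pu ne qz hq.
rewrite /rotation_at in hp hq.
move: (cos t) (sin t) (cos u) (sin u) hp hq ipK iqK => c s c' s' hp hq ipK iqK.
set A := rotz c s; set B := rotz c' s'.
have Yz : ((p - q) *m (1%:M - A) *m (1%:M - B)) 0 2%:R = 0.
  rewrite mulmxBr mulmx1 addE oppE mul_rotz vec3E.
  by rewrite mulmxBr mulmx1 addE oppE mul_rotz vec3E addE oppE pz qz !subrr.
split=> //.
pose rp := planar c s (p - p *m A); pose rq := planar c' s' (q - q *m B).
have ipK' : cancel ip rp := ipK; have iqK' : cancel iq rq := iqK.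
have key y : planar 1 0 ((p - q) *m (1%:M - A) *m (1%:M - B)) (rq (rp y)) = rp (rq y).
  rewrite planar10 /rp /rq /planar !(mulmxBr, mulmxBl, mulmxDl) !mulmx1 !mul_rotz.
  by vecring.
have -> : planar 1 0 ((p - q) *m (1%:M - A) *m (1%:M - B)) = rp \o (rq \o (ip \o iq)).
  apply/funext => x /=; rewrite -key.
  by rewrite ipK' iqK'.
exact: (trace_motion_comp hp (trace_motion_comp hq (trace_motion_comp hip hiq))).
Qed.

Lemma conjugate_translation {R : realType} (P : set 'rV[R]_3) (p w : 'rV[R]_3) (t : R) :
  has_dim P 3 -> P `<=` @upper_half R -> (exists g F, reachable P g F) ->
  p 0 2%:R = 0 -> rotation_at P p t -> translation_by P w ->
  translation_by P (w *m rotz (cos t) (sin t)).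
Proof.
move=> P3 Pu ne pz hp [wz hw].
have [ip hip ipK] := rotation_inverse P3 Pu ne pz hp.
split; first by rewrite mul_rotz vec3E.
set r := planar (cos t) (sin t) _ in ipK.
have -> : planar 1 0 (w *m rotz (cos t) (sin t)) = r \o (planar 1 0 w \o ip).
  apply/funext => x /=; rewrite !planar10 -{1}(ipK x) /r /planar mulmxDl.
  by rewrite addrCA.
exact: (trace_motion_comp hp (trace_motion_comp hw hip)).
Qed.

Lemma rotz_displacement {R : realType} (c s : R) (x : 'rV[R]_3) :
  c ^+ 2 + s ^+ 2 = 1 -> x 0 2%:R = 0 ->
  dotr (x *m (1%:M - rotz c s)) (x *m (1%:M - rotz c s)) = (2 - 2 * c) * dotr x x.
Proof.
move=> cs xz; rewrite mulmxBr mulmx1 mul_rotz.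
have -> : 2 - 2 * c = 1 - 2 * c + (c ^+ 2 + s ^+ 2) by rewrite cs; ring.
by rewrite !dotr3 !coordE !vec3E xz; ring.
Qed.

Lemma trace_translate {R : realType} (P : set 'rV[R]_3) (p w : 'rV[R]_2) :
  translation_by P (embed w) -> trace P p -> trace P (w + p).
Proof.
move=> [_ hw] [g [F [v [r vP gv]]]].
exists (planar 1 0 (embed w) \o g), F, v; split=> //; first exact: hw.
by rewrite /= planar10 gv !embedE !mxE; vecring.
Qed.

Lemma dotr2 {R : realType} (u v : 'rV[R]_2) : dotr u v = u 0 0 * v 0 0 + u 0 1 * v 0 1.
Proof.
rewrite /dotr big_ord_recl big_ord1; congr (_ + u 0 _ * v 0 _); exact/val_inj.
Qed.

Lemma dotr_embed {R : realType} (u v : 'rV[R]_2) : dotr (embed u) (embed v) = dotr u v.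
Proof. by rewrite dotr2 !embedE dotr3 !vec3E mulr0 addr0. Qed.

Lemma embedB {R : realType} (u v : 'rV[R]_2) : embed (u - v) = embed u - embed v.
Proof. by rewrite !embedE !mxE; vecring. Qed.

Lemma le_norm_coord {R : realType} (w : 'rV[R]_2) (i : 'I_2) (d : R) :
  0 <= d -> dotr w w <= d ^+ 2 -> `|w 0 i| <= d.
Proof.
move=> d0 h; rewrite -(ler_pXn2r (n := 2)) ?nnegrE // real_normK ?num_real //.
apply: le_trans h; rewrite dotr2 -!expr2.
by case: i => [[|[|//]] hi]; [rewrite (_ : Ordinal hi = 0) ?lerDl ?sqr_ge0 //|
  rewrite (_ : Ordinal hi = 1) ?lerDr ?sqr_ge0 //]; apply/val_inj.
Qed.

(** Independent short translations carry [p0] to a lattice of small cells. The target is written in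
    their basis by Cramer's rule and its coefficients are rounded down. *)
Lemma dense_of_short_translations {R : realType} (P : set 'rV[R]_3) (p0 : 'rV[R]_2) :
  has_dim P 3 -> P `<=` @upper_half R -> (exists g F, reachable P g F) ->
  trace P p0 ->
  (forall d : R, 0 < d -> exists w w' : 'rV[R]_2,
    [/\ translation_by P (embed w), translation_by P (embed w'),
        w 0 0 * w' 0 1 - w 0 1 * w' 0 0 != 0 &
        dotr w w <= d ^+ 2 /\ dotr w' w' <= d ^+ 2]) ->
  dense (trace P).
Proof.
move=> P3 Pu ne T0 short O [x Ox] oO.
have /nbhs_ballP[eps /= eps0 hball] : nbhs x O by apply: open_nbhs_nbhs.
(* Rounding changes each coefficient by at most 1, so every coordinate is off by at most
   [eps / 2]. *)
have [|w [w' [tw tw' dt [hw hw']]]] := short (eps / 4); first by rewrite divr_gt0.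
pose D := w 0 0 * w' 0 1 - w 0 1 * w' 0 0.
pose y := x - p0.
pose al := (y 0 0 * w' 0 1 - y 0 1 * w' 0 0) / D.
pose be := (w 0 0 * y 0 1 - w 0 1 * y 0 0) / D.
have yE i : y 0 i = al * w 0 i + be * w' 0 i.
  have E j : y 0 j = (al * D * w 0 j + be * D * w' 0 j) / D ->
      y 0 j = al * w 0 j + be * w' 0 j.
    by move=> ->; rewrite /D; field.
  apply: E; rewrite /al /be !divfK //; apply: (mulIf dt); rewrite -/D divfK //.
  by case: i => [[|[|//]] hi]; [rewrite (_ : Ordinal hi = 0)|
    rewrite (_ : Ordinal hi = 1)]; rewrite /D //; try (by apply/val_inj); ring.
pose m := Num.floor al; pose n := Num.floor be.
pose q := m%:~R *: w + (n%:~R *: w' + p0).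
exists q; split; last first.
  have embedZ k (z : 'rV[R]_2) : embed (k *: z) = k *: embed z.
    by rewrite !embedE !mxE; vecring.
  by apply: trace_translate; [|apply: trace_translate => //];
    rewrite embedZ; apply: translation_int.
apply: hball; split=> // i j; rewrite ord1 /ball /=.
have -> : x 0 j - q 0 j = (al - m%:~R) * w 0 j + (be - n%:~R) * w' 0 j.
  by have := yE j; rewrite /q !mxE => /eqP; rewrite subr_eq => /eqP ->; ring.
have fl (r : R) : `|r - (Num.floor r)%:~R| <= 1.
  have := floor_le_tmp r; have := floorD1_gt r; rewrite intrD => h1 h2.
  by rewrite ger0_norm ?subr_ge0 //; lra.
have e4 : 0 <= eps / 4 by rewrite divr_ge0 // ltW.
have b1 := le_norm_coord j e4 hw; have b2 := le_norm_coord j e4 hw'.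
apply: (@le_lt_trans _ _ (eps / 4 + eps / 4)); last lra.
apply: le_trans (ler_normD _ _) _; rewrite !normrM.
by apply: lerD; rewrite -[X in _ <= X]mul1r; apply: ler_pM.
Qed.

Lemma embed_surj {R : realType} (x : 'rV[R]_3) : x 0 2%:R = 0 -> exists w, embed w = x.
Proof. by move=> /groundP[w _ <-]; exists w. Qed.

(** The two factors of the commutator scale squared lengths by [2 - 2 * cos t] and [2 - 2 * cos u].
    These are positive since the angles lie strictly between 0 and 2 pi, and at most 4, which
    accounts for [d / 4]. *)
Lemma short_translation {R : realType} (P : set 'rV[R]_3) (p q : 'rV[R]_2) (t u d : R) :
  has_dim P 3 -> P `<=` @upper_half R -> (exists g F, reachable P g F) ->
  0 < t -> t < 2 * pi -> 0 < u -> u < 2 * pi ->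
  rotation_at P (embed p) t -> rotation_at P (embed q) u ->
  p != q -> enorm (p - q) < d / 4 ->
  exists w, [/\ translation_by P (embed w), w != 0 & dotr w w <= d ^+ 2].
Proof.
move=> P3 Pu ne t0 t1 u0 u1 hp hq pq hd.
have zz (x : 'rV[R]_2) : embed x 0 2%:R = 0 by rewrite embedE vec3E.
have := commutator_translation P3 Pu ne (zz p) (zz q) hp hq.
set Y := _ *m _ => tY; have [w wY] := embed_surj tY.1.
have xz : (embed p - embed q) 0 2%:R = 0 by rewrite -embedB.
have cs := cos2Dsin2 t; have cs' := cos2Dsin2 u.
have yz : ((embed p - embed q) *m (1%:M - rotz (cos t) (sin t))) 0 2%:R = 0.
  by rewrite mulmxBr mulmx1 mul_rotz addE oppE vec3E subrr.
have ww : dotr w w = (2 - 2 * cos u) * ((2 - 2 * cos t) * dotr (p - q) (p - q)).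
  by rewrite -dotr_embed wY /Y !rotz_displacement // -embedB dotr_embed.
have c1 := cos_lt1 t0 t1; have c2 := cos_lt1 u0 u1.
have pp : 0 < dotr (p - q) (p - q) by rewrite dotr_gt0 subr_eq0.
exists w; split; first by rewrite wY.
  rewrite -dotr_gt0 ww !mulr_gt0 // subr_gt0; lra.
have pd : dotr (p - q) (p - q) <= (d / 4) ^+ 2.
  rewrite -enorm_sqr ler_pXn2r ?nnegrE ?enorm_ge0 ?(ltW hd) //.
  exact: le_trans (enorm_ge0 _) (ltW hd).
have -> : d ^+ 2 = 4 * (4 * (d / 4) ^+ 2) by field.
have b (t' : R) : 0 <= 2 - 2 * cos t' <= 4.
  by have := cos_le1 t'; have := cos_geN1 t' => h1 h2; apply/andP; split; lra.
have [/andP[bt0 bt1] /andP[bu0 bu1]] := (b t, b u).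
by rewrite ww; apply: ler_pM => //; rewrite ?mulr_ge0 ?(ltW pp) //; apply: ler_pM;
  rewrite // ltW.
Qed.

Unset Implicit Arguments.
Theorem theorem1p3 (R : realType) (P : set 'rV[R]_3)
    (P_polytope : polytope P) (P_dim3 : has_dim P 3)
    (P_upper : P `<=` @upper_half R)
    (P_rests : exists2 F : set 'rV[R]_3, face2 P F & F `<=` @ground R) :
  ereal_inf [set (enorm (pq.1 - pq.2))%:E | pq in
               [set pq : 'rV[R]_2 * 'rV[R]_2 |
                 [/\ trace P pq.1, trace P pq.2 & pq.1 <> pq.2]]] = 0%E ->
  dense (trace P).
Proof.
move=> inf0.
have [V PE] := polytope_seq P_polytope; subst P; set P := conv_hull _ in inf0 *.
have [F0 FP0 F0g] := P_rests.
have r0 : reachable P id F0 by apply: reach_start.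
have ne : exists g F, reachable P g F by exists id, F0.
have close d : 0 < d -> exists p q, [/\ trace P p, trace P q, p != q & enorm (p - q) < d].
  move=> d0; have /ereal_inf_lt[_ [[p q] /= [Tp Tq /eqP pq] <-]] :
    (ereal_inf [set (enorm (pq.1 - pq.2))%:E | pq in
               [set pq : 'rV[R]_2 * 'rV[R]_2 |
                 [/\ trace P pq.1, trace P pq.2 & pq.1 <> pq.2]]] < d%:E)%E.
    by rewrite inf0 lte_fin.
  by rewrite lte_fin => h; exists p, q.
have Trot p : trace P p -> exists t : R, [/\ 0 < t, t < 2 * pi & rotation_at P (embed p) t].
  move=> /(trace_vertex P_dim3 P_upper)[g [F [v [r vv Fv <-]]]].
  by have [t [t0 t1 h _]] := vertex_rotation P_dim3 P_upper r vv Fv; exists t.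
(* Between 0 and 2 pi the sine vanishes only at pi, so the two cases are a total angle other than pi
   and all total angles equal to pi. *)
have [[g [F [v [t [r vv Fv tr st]]]]]|flat] := pselect (exists g F v (t : R),
    [/\ reachable P g F, vertex P v, F v, rotation_at P (g v) t & sin t != 0]).
  have [p0 [_ [T0 _ _ _]]] := close 1 ltr01.
  apply: (dense_of_short_translations P_dim3 P_upper ne T0) => d d0.
  have [|p [q [Tp Tq pq dpq]]] := close (d / 4); first by rewrite divr_gt0.
  have [t1 [t10 t11 rp]] := Trot p Tp; have [t2 [t20 t21 rq]] := Trot q Tq.
  have [w [tw w0 ww]] :=
    short_translation P_dim3 P_upper ne t10 t11 t20 t21 rp rq pq dpq.
  have gz : g v 0 2%:R = 0 by have [_ gF _ _] := reachable_inv P_upper r; apply: gF.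
  have tw' := conjugate_translation P_dim3 P_upper ne gz tr tw.
  have [w' w'E] := embed_surj tw'.1.
  have : embed w' = vec3 (cos t * w 0 0 - sin t * w 0 1) (sin t * w 0 0 + cos t * w 0 1) 0.
    by rewrite w'E mul_rotz embedE !vec3E.
  rewrite embedE => e; have e0 := congr1 (fun x : 'rV[R]_3 => x 0 0) e.
  have e1 := congr1 (fun x : 'rV[R]_3 => x 0 1) e; rewrite /= !vec3E in e0 e1.
  exists w, w'; split=> //; first by rewrite w'E.
    (* [w'] is [w] turned by [t], so the parallelogram of the two has signed area
       [sin t * dotr w w]. *)
    have -> : w 0 0 * w' 0 1 - w 0 1 * w' 0 0 = sin t * dotr w w.
      by rewrite e0 e1 dotr2; ring.
    by rewrite mulf_neq0 // dotr_eq0.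
  split=> //; have -> : dotr w' w' = dotr w w; last by [].
  by rewrite -dotr_embed w'E dotr_orth ?dotr_embed // rotz_orth // cos2Dsin2.
exfalso.
have pit g F v : reachable P g F -> vertex P v -> F v -> rotation_at P (g v) pi /\
    forall u1 u2 u3, u1 \in V -> u2 \in V -> u3 \in V ->
      0 <= dotr (u1 - v) (u2 - v) /\ 0 <= phi (u1 - v) (u2 - v) (u3 - v).
  move=> r vv Fv; have [t [t0 t1 tr h]] := vertex_rotation P_dim3 P_upper r vv Fv.
  have tpi : t = pi.
    apply: sin_eq0_pi => //; apply: contrapT => /eqP st; apply: flat.
    by exists g, F, v, t.
  by rewrite -tpi; split=> //; apply: h.
have co : all_corners V.
  move=> g F v r vv Fv a b c aV bV cV; have [_ h] := pit _ _ _ r vv Fv.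
  have [h1 h2] := h a b c aV bV cV; have [h3 _] := h b c a bV cV aV.
  by have [h4 _] := h c a b cV aV bV.
have [x0 [_ [_ [F0x _ _ _]]]] := dim2_points FP0.2.
have [c [k [_ hc F0E]]] := face2_functional P_dim3 FP0.
have [v [vv vV cv _]] : exists v, [/\ vertex P v, v \in V, dotr c v = k &
    forall y, P y -> dotr c y = k -> dotr c y <= dotr c v].
  by move: F0x; rewrite F0E => -[Px cx]; apply: face_vertex hc Px cx.
have Fv : F0 v by rewrite F0E; split=> //; apply: sub_conv_hull.
have [tr _] := pit _ _ _ r0 vv Fv.
have rh := tr _ _ r0; rewrite cospi sinpi in rh.
(* The half-turn about v leads back to F0 in a position other than the initial one, so
   some roll ends on F0. *)
have [hid|[g1 [F1 [r1 _ ro]]]] := reachable_last rh.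
  have : (planar (-1) 0 (v - v *m rotz (-1) 0) \o id) (v + vec3 1 0 0) = v + vec3 1 0 0.
    by rewrite hid.
  rewrite /= /planar mulmxDl addrA subrK => /addrI/(congr1 (fun x : 'rV[R]_3 => x 0 0)).
  by rewrite mul_rotz !vec3E; lra.
have [org [u [w [uz wz uw lat]]]] := lattice_trace P_dim3 P_upper co FP0 F0g r1 ro.
have [s s0 sep] := lattice_separated uz wz uw.
(* [s] bounds squared lengths from below, hence the square root. *)
have [|p [q [Tp Tq pq dpq]]] := close (Num.sqrt s); first by rewrite sqrtr_gt0.
have [gp [Fp [vp [rp vvp Fvp ep]]]] := trace_vertex P_dim3 P_upper Tp.
have [gq [Fq [vq [rq vvq Fvq eq]]]] := trace_vertex P_dim3 P_upper Tq.
have [m1 [n1 E1]] := lat _ _ _ rp vvp Fvp; have [m2 [n2 E2]] := lat _ _ _ rq vvq Fvq.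
have dE : embed (p - q) = (m1 - m2)%:~R *: u + (n1 - n2)%:~R *: w.
  by rewrite embedB -ep -eq E1 E2 !intrB; vecring.
have nz : embed (p - q) != 0.
  by rewrite -dotr_eq0 dotr_embed dotr_eq0 subr_eq0.
have := sep (m1 - m2) (n1 - n2); rewrite -dE => /(_ nz); rewrite dotr_embed leNgt => /negP;
apply; rewrite -enorm_sqr -[s]sqr_sqrtr ?(ltW s0) // ltr_pXn2r ?nnegrE ?enorm_ge0 //.
Qed.
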